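(* Let $T>0$. Each state $W^0\in\widetilde H^0$ is approximately controllable to any target state $W^T\in\widetilde H^0$ in the time $T$, for the control system $W_t=W_{xx}-2u\delta'$, $x\in\mathbb R$, $t\in(0,T)$, $W(\cdot,0)=W^0$; that is, $W^T\in\overline{\mathcal R_T(W^0)}$ for all $W^0,W^T\in\widetilde H^0$, where the closure is taken in $\widetilde H^0$.
   Context: For $m=0,1,2$, $H^m$ is the Sobolev space of $\varphi\in L^2(\mathbb R)$ with $\varphi^{(k)}\in L^2(\mathbb R)$, $k\le m$; $H^{-m}=(H^m)^*$; $\widetilde H^{n}$ is the closed subspace of odd distributions in $H^{n}$, $n=-2,\dots,2$. In particular $\widetilde H^0$ is the space of odd functions in $L^2(\mathbb R)$ with the $L^2(\mathbb R)$ norm. States and controls are over one fixed scalar field. Control system: for $T>0$, an initial state $W^0\in\widetilde H^0$ and a control $u\in L^\infty(0,T)$ consider $$W_t=W_{xx}-2u(t)\delta',\quad x\in\mathbb R,\ t\in(0,T),\qquad W(\cdot,0)=W^0,$$ where $\delta$ is the Dirac distribution in $x$ and $\left(\frac{d}{dt}\right)^m W:[0,T]\to\widetilde H^{-2m}$, $m=0,1$. Its unique solution is given, for $t\in(0,T]$, by $$W(x,t)=\frac{e^{-\frac{x^2}{4t}}}{\sqrt{4\pi t}}*W^0(x)+\sqrt{\tfrac2\pi}\,x\int_0^t e^{-\frac{x^2}{4\xi}}\frac{u(t-\xi)}{(2\xi)^{3/2}}\,d\xi,$$ where $*$ is convolution in $x$. A state $W^T\in\widetilde H^0$ is reachable from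 $W^0$ in time $T$ if there is $u\in L^\infty(0,T)$ such that there exists a unique solution $W$ of the system, and $W(\cdot,T)=W^T$. $\mathcal R_T(W^0)$ is the set of all states in $\widetilde H^0$ reachable from $W^0$ in time $T$. A state $W^0\in\widetilde H^0$ is approximately controllable to a target state $W^T\in\widetilde H^0$ in time $T$ if $W^T\in\overline{\mathcal R_T(W^0)}$, with closure in $\widetilde H^0$; equivalently, for each $\varepsilon>0$ there is $u_\varepsilon\in L^\infty(0,T)$ such that the solution $W$ with $u=u_\varepsilon$ satisfies $\|W(\cdot,T)-W^T\|_{L^2(\mathbb R)}<\varepsilon$. *)

(* Defs.v *)
From HB Require Import structures.
From mathcomp Require Import all_boot all_order all_algebra.
From mathcomp Require Import all_classical all_reals all_analysis.

Set Implicit Arguments.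
Unset Strict Implicit.
Unset Printing Implicit Defensive.

Import Order.TTheory GRing.Theory Num.Theory.
Import numFieldNormedType.Exports.

Local Open Scope classical_set_scope.
Local Open Scope ring_scope.

(* Elements of L^2 are represented by functions R -> R; two functions stand for
   the same element when they agree almost everywhere.  Scalars are real. *)

Definition ae_eq_fun (R : realType) (f g : R -> R) : Prop :=
  {ae @lebesgue_measure R, forall x, f x = g x}.

Definition L2 (R : realType) : set (R -> R) :=
  [set f | f \in Lfun (@lebesgue_measure R) 2%:E].

Definition normL2 (R : realType) (f : R -> R) : \bar R :=
  'N[@lebesgue_measure R]_2%:E[EFin \o f]%E.

Definition Htilde0 (R : realType) : set (R -> R) :=
  [set f | L2 f /\ ae_eq_fun (fun x => f (- x)) (fun x => - f x)].

(* L^oo(0,T); the values of u outside ]0, T[ are irrelevant. *)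
Definition Linfty (R : realType) (T : R) : set (R -> R) :=
  [set u | u \_ `]0, T[ \in Lfun (@lebesgue_measure R) +oo%E].

(* f is absolutely continuous on [a, b] and its derivative is g a.e. *)
Definition AC_derivative (R : realType) (a b : R) (f g : R -> R) : Prop :=
  (@lebesgue_measure R).-integrable `]a, b[ (EFin \o g) /\
  forall s t, a <= s -> s < t -> t <= b ->
    f t - f s = \int[@lebesgue_measure R]_(x in `]s, t[) g x.

(* The Sobolev space H^2.  Every class in H^2 has exactly one C^1 representative
   [H2_val]; [H2_d1] is its derivative (a function defined everywhere, so that
   [H2_d1 phi 0] makes sense) and [H2_d2], unique up to a.e. equality, is its
   second distributional derivative. *)
Record H2 (R : realType) := MkH2 {
  H2_val : R -> R;
  H2_d1 : R -> R;
  H2_d2 : R -> R;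
  H2_val_L2 : L2 H2_val;
  H2_d1_L2 : L2 H2_d1;
  H2_d2_L2 : L2 H2_d2;
  H2_val_deriv : forall a b, a < b -> AC_derivative a b H2_val H2_d1;
  H2_d1_deriv : forall a b, a < b -> AC_derivative a b H2_d1 H2_d2
}.

(* Elements of H^{-2} = (H^2)^*, as functionals on H^2: an L^2 function f, its
   second distributional derivative f'', and delta'.  All of them are linear
   and bounded for the H^2 norm. *)
Definition L2_Hm2 (R : realType) (f : R -> R) (phi : H2 R) : R :=
  \int[@lebesgue_measure R]_x (f x * H2_val phi x).

Definition dxx (R : realType) (f : R -> R) (phi : H2 R) : R :=
  \int[@lebesgue_measure R]_x (f x * H2_d2 phi x).

Definition delta' (R : realType) (phi : H2 R) : R := - H2_d1 phi 0.

(* V is the time derivative on ]0, T[ of the H^{-2}-valued curve W. *)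
Definition time_derivative (R : realType) (T : R) (W V : R -> H2 R -> R) : Prop :=
  forall phi : H2 R, AC_derivative 0 T (fun t => W t phi) (fun t => V t phi).

Definition continuous_L2 (R : realType) (T : R) (W : R -> R -> R) : Prop :=
  forall t, `[0, T]%classic t ->
    normL2 (W s \- W t) @[s --> within `[0, T] (nbhs t)] --> 0%E.

(* W t is the state W(., t); only the times t in [0, T] matter.  The equation
   W_t = W_xx - 2 u delta' holds in H^{-2}, hence its right-hand side, and so
   W_t, automatically takes its values in the odd elements of H^{-2}. *)
Definition is_solution (R : realType) (T : R) (W0 u : R -> R) (W : R -> R -> R) :
    Prop :=
  [/\ forall t, `[0, T]%classic t -> Htilde0 (W t),
      continuous_L2 T W,
      time_derivative T (fun t => L2_Hm2 (W t))
        (fun t phi => dxx (W t) phi - 2 * u t * delta' phi)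
    & ae_eq_fun (W 0) W0].

Definition is_unique_solution (R : realType) (T : R) (W0 u : R -> R)
    (W : R -> R -> R) : Prop :=
  is_solution T W0 u W /\
  forall W', is_solution T W0 u W' ->
    forall t, `[0, T]%classic t -> ae_eq_fun (W' t) (W t).

Definition reachable (R : realType) (T : R) (W0 : R -> R) : set (R -> R) :=
  [set WT | Htilde0 WT /\
     exists u, Linfty T u /\
       exists W, is_unique_solution T W0 u W /\ ae_eq_fun (W T) WT].

Definition closure_Htilde0 (R : realType) (A : set (R -> R)) : set (R -> R) :=
  [set f | Htilde0 f /\
     forall e : R, 0 < e -> exists2 g, A g & (normL2 (g \- f)%R < e%:E)%E].

Definition approx_controllable (R : realType) (T : R) (W0 WT : R -> R) : Prop :=
  closure_Htilde0 (reachable T W0) WT.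

(* Main.v *)
(* Let k_t(x) = x exp(-x^2/4t) / (2 sqrt(pi) t^(3/2)), the odd heat kernel, and let E_t be
   the state reached from 0 at time t under the control u = 1; its time derivative is k_t.
   - The k_t with 0 < t < d span a dense subspace of the odd functions of L^2(R): for
     w = x exp(-x^2/d) and z = exp(-x^2/d), the span contains w p(z) for every polynomial p;
     polynomials in z tend to indicators of {z < c}, so the closure contains w 1_A(|x|) for
     all Borel sets A, hence every odd function.
   - The heat flow k_s |-> k_(s+t) contracts the L^2 norm on this span and so extends to all
     odd initial data.
   - A difference D of two solutions satisfies <D(t), k_s> = <D(0), k_(s+t)> = 0, so that
     D = 0 by density.
   - The k_t are limits of difference quotients of t |-> E_t, so the E_s with 0 < s <= T, which
     are reached from 0 at time T with u = 1 on [T - s, T], span a dense subspace as well. *)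

Require Import Defs.
From mathcomp Require Import all_boot all_order all_algebra.
From mathcomp Require Import all_classical all_reals all_analysis.
From mathcomp Require Import measurable_realfun ftc gauss_integral.
From mathcomp Require Import lebesgue_integral_under ess_sup_inf.
From mathcomp Require Import ring lra.

Set Implicit Arguments.
Unset Strict Implicit.
Unset Printing Implicit Defensive.
Import Order.TTheory GRing.Theory Num.Theory.
Import numFieldNormedType.Exports.
Local Open Scope classical_set_scope.
Local Open Scope ring_scope.

(** * The space L^2 *)

Section L2_toolkit.
Context {R : realType}.
Local Notation mu := (@lebesgue_measure R).
Implicit Types f g : R -> R.

(** Neither a Fourier transform nor the convolution formula for solutions is used. The contraction
    comes from a change of variable: the inner product of the kernels at times a and b is a constant
    times the integral of x^2 exp(-(a+b)x^2), so on finite combinations the heat flow acts on norms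
    like multiplication by exp(-t x^2) <= 1. The obstacle is regularity. Test functions in [H2] have
    only absolutely continuous derivatives, and a solution is only a continuous curve of states with
    a weak equation for each fixed test function; no classical product rule applies. Integration by
    parts and the duality behind uniqueness are both reduced to [flat_eq]: a function whose
    increments over short intervals are o(y - x) is constant. A single kernel would be the response
    to an impulse, which is not a bounded control; hence the difference quotients, which are
    responses to short high pulses. Nonzero initial data are absorbed by subtracting their free
    evolution from the target. All dominations use the weight 1/(1+x^2), with constants uniform over
    a range of times. *)

Definition ip f g : R := \int[mu]_x (f x * g x).
Definition nrm f : R := Num.sqrt (ip f f).

Lemma L2P f : L2 f <->
  measurable_fun setT f /\ mu.-integrable setT (EFin \o (fun x => f x ^+ 2)).
Proof.
split=> [Lf|[mf intf]].
  split; last by apply: Lfun2_integrable_sqr.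
  by case/andP : Lf => /[!inE].
rewrite /L2/=; apply/andP; split; rewrite inE//=.
rewrite /finite_norm unlock /Lnorm.
apply: poweR_lty.
case/integrableP : intf => _; apply: le_lt_trans.
rewrite le_eqVlt; apply/orP; left; apply/eqP.
apply: eq_integral => x _ /=.
by rewrite powR_mulrn// normrX.
Qed.

Lemma L2_measurable f : L2 f -> measurable_fun setT f.
Proof. by move=> /L2P[]. Qed.

Lemma ip_integrable f g : L2 f -> L2 g ->
  mu.-integrable setT (EFin \o (fun x => f x * g x)).
Proof. by move=> Lf Lg; apply/Lfun1_integrable; exact: Lfun2_mul_Lfun1. Qed.

Lemma L2_le f g : measurable_fun setT f -> L2 g ->
  (forall x, `|f x| <= `|g x|) -> L2 f.
Proof.
move=> mf /L2P[mg ig] fg; apply/L2P; split=> //.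
apply: (le_integrable measurableT _ _ ig).
  by apply/measurable_EFinP; exact: measurable_funX.
by move=> x _/=; rewrite lee_fin !normrX lerXn2r ?nnegrE.
Qed.

Lemma L2Z a f : L2 f -> L2 (fun x => a * f x).
Proof.
move=> /L2P[mf intf]; apply/L2P; split; first exact: measurable_funM.
have := @integrableZl _ _ _ mu setT measurableT (a ^+ 2) _ intf.
by apply: eq_integrable => // x _ /=; rewrite -EFinM exprMn.
Qed.

Lemma L2D f g : L2 f -> L2 g -> L2 (f \+ g).
Proof.
move=> /[dup] Lf /L2P[mf intf] /[dup] Lg /L2P[mg intg]; apply/L2P; split.
  exact: measurable_funD.
have i2 := @integrableZl _ _ _ mu setT measurableT 2 _ (ip_integrable Lf Lg).
have := integrableD measurableT (integrableD measurableT intf intg) i2.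
by apply: eq_integrable => // x _ /=; rewrite -EFinM -!EFinD; congr EFin; ring.
Qed.

Lemma L2N f : L2 f -> L2 (fun x => - f x).
Proof.
by move=> /(L2Z (-1)); congr (L2 _); apply/funext => x; rewrite mulN1r.
Qed.

Lemma L2B f g : L2 f -> L2 g -> L2 (f \- g).
Proof. by move=> Lf /L2N; exact: L2D. Qed.

Lemma L20 : L2 (fun _ : R => 0 : R).
Proof.
apply/L2P; split=> //.
have : mu.-integrable setT (cst 0%E) by exact: integrable0.
by apply: eq_integrable => // x _ /=; rewrite expr0n.
Qed.

Lemma ipC f g : ip f g = ip g f.
Proof. by apply: eq_Rintegral => x _; rewrite mulrC. Qed.

Lemma ipDl f g h : L2 f -> L2 g -> L2 h ->
  ip (f \+ g) h = ip f h + ip g h.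
Proof.
move=> Lf Lg Lh; rewrite /ip -RintegralD//; [|exact: ip_integrable..].
by apply: eq_Rintegral => x _ /=; rewrite mulrDl.
Qed.

Lemma ipZl a f h : L2 f -> L2 h -> ip (fun x => a * f x) h = a * ip f h.
Proof.
move=> Lf Lh; rewrite /ip -RintegralZl//; last exact: ip_integrable.
by apply: eq_Rintegral => x _ /=; rewrite mulrA.
Qed.

Lemma ipBl f g h : L2 f -> L2 g -> L2 h ->
  ip (f \- g) h = ip f h - ip g h.
Proof.
move=> Lf Lg Lh; rewrite /ip -RintegralB//; [|exact: ip_integrable..].
by apply: eq_Rintegral => x _ /=; rewrite mulrBl.
Qed.

Lemma ipDr f g h : L2 f -> L2 g -> L2 h -> ip h (f \+ g) = ip h f + ip h g.
Proof. by move=> *; rewrite ipC ipDl// ![ip h _]ipC. Qed.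

Lemma ipBr f g h : L2 f -> L2 g -> L2 h -> ip h (f \- g) = ip h f - ip h g.
Proof. by move=> *; rewrite ipC ipBl// ![ip h _]ipC. Qed.

Lemma ipZr a f h : L2 f -> L2 h -> ip h (fun x => a * f x) = a * ip h f.
Proof. by move=> *; rewrite ipC ipZl// [ip h _]ipC. Qed.

Lemma ip_ge0 f : 0 <= ip f f.
Proof. by apply: Rintegral_ge0 => x _; rewrite -expr2 sqr_ge0. Qed.

Lemma nrm_ge0 f : 0 <= nrm f. Proof. exact: sqrtr_ge0. Qed.

Lemma sqr_nrm f : nrm f ^+ 2 = ip f f.
Proof. by rewrite sqr_sqrtr// ip_ge0. Qed.

Lemma CS f g : L2 f -> L2 g -> `|ip f g| <= nrm f * nrm g.
Proof.
move=> Lf Lg.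
have key t : 0 <= ip f f + 2 * t * ip f g + t ^+ 2 * ip g g.
  have := ip_ge0 (f \+ (fun x => t * g x)).
  have Ltg := L2Z t Lg.
  rewrite ipDl ?ipDr ?ipZl ?ipZr//; last exact: L2D.
  by rewrite [ip g f]ipC => /le_trans; apply; rewrite le_eqVlt; apply/orP; left; apply/eqP; ring.
rewrite -(@ler_pXn2r _ 2)// ?nnegrE// ?mulr_ge0 ?nrm_ge0//.
rewrite exprMn !sqr_nrm real_normK ?num_real//.
have [g0|g0] := eqVneq (ip g g) 0.
  suff -> : ip f g = 0 by rewrite expr0n/= mulr_ge0 ?ip_ge0.
  apply/eqP/negP => /negP fg0.
  (* When [ip g g = 0] the quadratic is affine in [t]; this [t] would give it the value -1. *)
  have := key (- (ip f f + 1) / (2 * ip f g)).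
  rewrite g0 mulr0 addr0.
  have -> : 2 * (- (ip f f + 1) / (2 * ip f g)) * ip f g = - (ip f f + 1) by field.
  by lra.
have gp : 0 < ip g g by rewrite lt_neqAle eq_sym g0 ip_ge0.
(* The minimizer of the quadratic. *)
have := key (- ip f g / ip g g).
have -> : ip f f + 2 * (- ip f g / ip g g) * ip f g + (- ip f g / ip g g) ^+ 2 * ip g g
  = ip f f - ip f g ^+ 2 / ip g g by field.
by rewrite subr_ge0 ler_pdivrMr.
Qed.

Lemma nrmD f g : L2 f -> L2 g -> nrm (f \+ g) <= nrm f + nrm g.
Proof.
move=> Lf Lg; rewrite -(@ler_pXn2r _ 2)// ?nnegrE// ?addr_ge0 ?nrm_ge0//.
rewrite sqrrD !sqr_nrm ipDl ?ipDr//; last exact: L2D.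
have := ler_norm (ip f g); have := CS Lf Lg; rewrite [ip g f]ipC; lra.
Qed.

Lemma nrmZ a f : L2 f -> nrm (fun x => a * f x) = `|a| * nrm f.
Proof.
move=> Lf; rewrite /nrm ipZl ?ipZr//; last exact: L2Z.
by rewrite mulrA -expr2 sqrtrM ?sqr_ge0// sqrtr_sqr.
Qed.

Lemma nrmB f g : L2 f -> L2 g -> nrm (f \- g) <= nrm f + nrm g.
Proof.
move=> Lf Lg; apply: le_trans (nrmD Lf (L2N Lg)) _.
rewrite lerD2l (_ : nrm (fun x => - g x) = nrm g)//.
by congr Num.sqrt; apply: eq_Rintegral => x _; rewrite mulrNN.
Qed.

Lemma nrm_triangle f g h : L2 f -> L2 g -> L2 h ->
  nrm (f \- h) <= nrm (f \- g) + nrm (g \- h).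
Proof.
move=> Lf Lg Lh; apply: le_trans (nrmD (L2B Lf Lg) (L2B Lg Lh)).
by rewrite le_eqVlt; apply/orP; left; apply/eqP; congr nrm; apply/funext => x /=; ring.
Qed.

Lemma nrmC f g : nrm (f \- g) = nrm (g \- f).
Proof. by congr Num.sqrt; apply: eq_Rintegral => x _ /=; ring. Qed.

Lemma nrm0 : nrm (fun _ : R => 0 : R) = 0.
Proof.
by rewrite /nrm /ip; under eq_Rintegral do rewrite mul0r; rewrite Rintegral_cst// mul0r sqrtr0.
Qed.

Lemma normL2E f : L2 f -> normL2 f = (nrm f)%:E.
Proof.
move=> /[dup] Lf /L2P[mf intf].
rewrite /normL2 unlock /Lnorm.
under eq_integral => x _ do
  rewrite /= powR_mulrn// real_normK ?num_real//.
rewrite -[X in poweR X _]fineK; last exact: integrable_fin_num.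
rewrite poweR_EFin powR12_sqrt//.
  by apply: fine_ge0; apply: integral_ge0 => x _; rewrite lee_fin sqr_ge0.
Qed.

(** The steps sum to at most twice the first one, the ratio being 1/2. The auxiliary bound [hb]
    keeps the exact finite geometric sum, which is what lets its induction close. *)
Lemma geometric_steps_cvg (a : nat -> R) (c : R) : 0 <= c ->
  (forall n, `|a n.+1 - a n| <= c * 2^-1 ^+ n) ->
  cvgn a /\ forall n, `|a n - limn a| <= 2 * c * 2^-1 ^+ n.
Proof.
move=> c0 ha.
have hb n m : `|a (n + m)%N - a n| <= 2 * c * (2^-1 ^+ n - 2^-1 ^+ (n + m)%N).
  elim: m => [|m IH]; first by rewrite addn0 !subrr normr0 mulr0.
  rewrite addnS (_ : a (n + m).+1 - a n = (a (n + m).+1 - a (n + m)%N) + (a (n + m)%N - a n)); last by ring.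
  apply: le_trans (ler_normD _ _) _; apply: le_trans (lerD (ha _) IH) _.
  by rewrite le_eqVlt; apply/orP; left; apply/eqP; rewrite exprS; field.
have hc n m : (n <= m)%N -> `|a m - a n| <= 2 * c * 2^-1 ^+ n.
  move=> nm; rewrite -(subnKC nm); apply: le_trans (hb _ _) _.
  by rewrite ler_wpM2l ?mulr_ge0// gerBl exprn_ge0.
have ca : cvgn a.
  apply: cauchy_cvg; apply: cauchy_exP => e e0.
  have : (fun n => 2 * c * 2^-1 ^+ n : R) @ \oo --> (0 : R).
    rewrite -[X in _ --> X](mulr0 (2 * c)); apply: cvgMr.
    have /cvg_geometric : `|2^-1 : R| < 1 by rewrite ger0_norm ?invf_lt1// ltr1n.
    by move=> /(_ 1); apply: cvg_trans; apply: near_eq_cvg; near=> n; rewrite /= mul1r.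
  move=> /cvgrPdist_lt/(_ _ e0)[N _ HN].
  exists (a N); exists N => // m /= Nm; rewrite /ball/= distrC.
  apply: le_lt_trans (hc _ _ Nm) _.
  have := HN N (leqnn _); rewrite /= sub0r normrN ger0_norm//.
  by rewrite !mulr_ge0// exprn_ge0.
split=> // n; rewrite distrC.
have : (fun m => `|a m - a n|) @ \oo --> `|limn a - a n|.
  by apply: cvg_norm; apply: cvgB => //; exact: cvg_cst.
move=> h; have <- := cvg_lim (@Rhausdorff R) h.
apply: limr_le; first by apply/cvg_ex; eexists; exact: h.
by exists n => // m /= nm; exact: hc.
Unshelve. all: by end_near. Qed.

(** Riesz-Fischer with a rate. The weighted series [M] of the terms 4^k d_k^2 has integral at most
    the sum of 4^k 16^-k, that is 4/3. Where [M] is finite the steps are geometric, so the error at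
    stage n is at most 2 sqrt(M) 2^-n; squaring and integrating gives [C]. The limit [g] may be any
    measurable function that agrees with the pointwise limit where it exists; this freedom is used
    later to choose an odd one. *)
Lemma L2_complete (f : nat -> R -> R) : (forall n, L2 (f n)) ->
  (forall n, nrm (f n.+1 \- f n) <= 4^-1 ^+ n) ->
  exists2 C : R, 0 <= C & forall g, measurable_fun setT g ->
    (forall x, cvgn (f ^~ x) -> g x = limn (f ^~ x)) ->
    L2 g /\ forall n, nrm (f n \- g) <= C * 2^-1 ^+ n.
Proof.
move=> Lf hf.
pose d n := f n.+1 \- f n.
have Ld n : L2 (d n) by exact: L2B.
have md n : measurable_fun setT (fun x => ((4 ^+ n : R) * (d n x) ^+ 2)%:E).
  apply/measurable_EFinP; apply: measurable_funM => //.
  by apply: measurable_funX; apply: L2_measurable.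
pose M x := (\sum_(0 <= k <oo) ((4 ^+ k : R) * (d k x) ^+ 2)%:E)%E.
have term_ge0 k x : (0 <= ((4 ^+ k : R) * (d k x) ^+ 2)%:E)%E.
  by rewrite lee_fin mulr_ge0 ?sqr_ge0// exprn_ge0.
have M0 x : (0 <= M x)%E by apply: nneseries_ge0 => n _ _; exact: term_ge0.
have mM : measurable_fun setT M.
  by apply: ge0_emeasurable_sum => // k x _ _; exact: term_ge0.
have intM : (\int[mu]_x M x <= 2%:E)%E.
  rewrite /M integral_nneseries//.
  apply: lime_le.
    by apply: is_cvg_nneseries => n _ _; apply: integral_ge0.
  apply: nearW => n.
  apply: (@le_trans _ _ (\sum_(0 <= k < n) ((4^-1 ^+ k : R)%:E))%E).
    apply: lee_sum => k _.
    have -> : (\int[mu]_x ((4 ^+ k : R) * d k x ^+ 2)%:E = (4 ^+ k * (nrm (d k)) ^+ 2)%:E)%E.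
      rewrite sqr_nrm EFinM /ip /Rintegral fineK; last first.
        by apply: integrable_fin_num => //; exact: ip_integrable.
      rewrite -integralZl//; last exact: ip_integrable.
    rewrite lee_fin.
    apply: (@le_trans _ _ (4 ^+ k * (4^-1 ^+ k) ^+ 2)).
      rewrite ler_wpM2l ?exprn_ge0// lerXn2r ?nnegrE ?nrm_ge0 ?exprn_ge0//.
      by rewrite hf.
    by rewrite expr2 mulrA -exprMn divff// expr1n mul1r.
  rewrite sumEFin lee_fin.
  have : 0 <= (1:R) by [].
  move=> /(@geometric_le_lim R n 1 4^-1) -/(_ _ _); rewrite invr_gt0 => /(_ _)/wrap[//|].
  rewrite ger0_norm ?invr_ge0// => /(_ _)/wrap[|]; first by rewrite invf_lt1 ?ltr1n.
  have -> : 1 / (1 - 4^-1) = 4 / 3 :> R by field.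
  rewrite /series/= => h; apply: (@le_trans _ _ (4 / 3)); last by lra.
  by apply: le_trans h; apply: ler_sum => i _; rewrite mul1r.
have iM : mu.-integrable setT M.
  apply/integrableP; split=> //.
  under eq_integral do rewrite gee0_abs//.
  by apply: le_lt_trans intM _; rewrite ltry.
pose J := fine (\int[mu]_x M x).
have J0 : 0 <= J by apply: fine_ge0; exact: integral_ge0.
exists (2 * Num.sqrt J); first by rewrite mulr_ge0 ?sqrtr_ge0.
move=> g mg gE.
have aeM := integrable_ae measurableT iM.
have pw n : {ae mu, forall x, setT x -> (((f n x - g x) ^+ 2)%:E <= ((4 * 4^-1 ^+ n : R)%:E * M x))%E}.
  apply: filterS aeM => x /(_ I) Mfin _.
  pose c := Num.sqrt (fine (M x)).
  have c0 : 0 <= c by rewrite sqrtr_ge0.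
  (* One term of a nonnegative series is bounded by its sum: 4^k d_k^2 <= M. *)
  have hd k : `|f k.+1 x - f k x| <= c * 2^-1 ^+ k.
    rewrite -(@ler_pXn2r _ 2)// ?nnegrE// ?mulr_ge0 ?exprn_ge0//.
    rewrite real_normK ?num_real// exprMn sqr_sqrtr ?fine_ge0//.
    have : (((4 ^+ k : R) * (d k x) ^+ 2)%:E <= M x)%E.
      apply: le_trans (nneseries_lim_ge k.+1 _) => //.
      rewrite big_nat_recr//= leeDr//; apply: sume_ge0 => i _; exact: term_ge0.
    rewrite -[M x]fineK// lee_fin => h.
    rewrite -exprM mulnC exprM (_ : 2^-1 ^+ 2 = 4^-1); last by field.
    by rewrite exprVn ler_pdivlMr ?exprn_gt0// mulrC.
  have [ca lim_a] := geometric_steps_cvg c0 hd.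
  rewrite (gE _ ca) -[M x]fineK// -EFinM lee_fin.
  rewrite -[leLHS]real_normK ?num_real//.
  have /le_trans : `|f n x - limn (f ^~ x)| ^+ 2 <= (2 * c * 2^-1 ^+ n) ^+ 2.
    by rewrite lerXn2r ?nnegrE ?mulr_ge0 ?exprn_ge0.
  apply.
  rewrite !exprMn sqr_sqrtr ?fine_ge0// -!exprM [(n * 2)%N]mulnC exprM.
  by rewrite le_eqVlt (_ : 2^-1 ^+ 2 = 4^-1)//; [apply/orP; left; apply/eqP; ring|field].
have mfg n : measurable_fun setT (fun x => f n x - g x).
  by apply: measurable_funB => //; exact: L2_measurable.
have mfg2 n : measurable_fun setT (fun x : R => ((f n x - g x) ^+ 2)%:E).
  by apply/measurable_EFinP; exact: (measurable_funX 2 (mfg n)).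
have intle n : (\int[mu]_x ((f n x - g x) ^+ 2)%:E <= (4 * 4^-1 ^+ n * J)%:E)%E.
  apply: le_trans (ae_ge0_le_integral measurableT _ _ _ _ (pw n)) _.
  - by move=> x _; rewrite lee_fin sqr_ge0.
  - exact: mfg2.
  - by move=> x _; rewrite mule_ge0// lee_fin mulr_ge0// exprn_ge0.
  - exact: measurable_funeM.
  - rewrite integralZl// [leRHS]EFinM /J fineK//.
    exact: integrable_fin_num.
have Lfg n : L2 (f n \- g).
  apply/L2P; split; first exact: mfg.
  apply/integrableP; split.
    exact: mfg2.
  under eq_integral do rewrite gee0_abs ?lee_fin ?sqr_ge0//.
  by apply: le_lt_trans (intle n) _; rewrite ltry.
split.
  have := L2B (Lf 0%N) (Lfg 0%N); congr (L2 _); apply/funext => x /=; ring.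
move=> n; rewrite -(@ler_pXn2r _ 2)// ?nnegrE ?nrm_ge0// ?mulr_ge0 ?exprn_ge0 ?sqrtr_ge0//.
rewrite sqr_nrm -lee_fin /ip /Rintegral fineK; last first.
  by apply: integrable_fin_num => //; exact: ip_integrable.
under eq_integral do rewrite -expr2.
apply: le_trans (intle n) _; rewrite lee_fin !exprMn sqr_sqrtr//.
rewrite -!exprM [(n * 2)%N]mulnC exprM.
by rewrite le_eqVlt (_ : 2^-1 ^+ 2 = 4^-1)//; [apply/orP; left; apply/eqP; ring|field].
Qed.

End L2_toolkit.

(** * Absolutely continuous functions *)

Section absolutely_continuous.
Context {R : realType}.
Local Notation mu := (@lebesgue_measure R).
Implicit Types f g h : R -> R.

Lemma integrableD_EFin (D : set R) f g : measurable D ->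
  mu.-integrable D (EFin \o f) -> mu.-integrable D (EFin \o g) ->
  mu.-integrable D (EFin \o (fun x => f x + g x)).
Proof. by move=> mD i j; have := @integrableD _ _ R mu D mD _ _ i j; apply. Qed.

Lemma integrableB_EFin (D : set R) f g : measurable D ->
  mu.-integrable D (EFin \o f) -> mu.-integrable D (EFin \o g) ->
  mu.-integrable D (EFin \o (fun x => f x - g x)).
Proof. by move=> mD i j; have := @integrableB _ _ R mu D mD _ _ i j; apply. Qed.

Lemma integrableZ_EFin (D : set R) (c : R) f : measurable D ->
  mu.-integrable D (EFin \o f) ->
  mu.-integrable D (EFin \o (fun x => c * f x)).
Proof. by move=> mD i; have := @integrableZl _ _ R mu D mD c _ i; apply. Qed.

Lemma bounded_integrable_itv f (a b M : R) : measurable_fun `]a, b[ f ->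
  (forall x, a < x < b -> `|f x| <= M) ->
  mu.-integrable `]a, b[ (EFin \o f).
Proof.
move=> mf fM; apply: measurable_bounded_integrable => //.
  by rewrite /= lebesgue_measure_itv/=; case: ifP => _; rewrite ltry.
exists M; split; first exact: num_real.
by move=> C MC x /=; rewrite in_itv/= => /fM /le_trans; apply; exact: ltW.
Qed.

Lemma cst_integrable_itv (c a b : R) : mu.-integrable `]a, b[ (EFin \o cst c).
Proof. by apply: (@bounded_integrable_itv _ _ _ `|c|). Qed.

Lemma Rintegral_cst_itv (c a b : R) : a <= b ->
  \int[mu]_(x in `]a, b[) c = c * (b - a).
Proof.
move=> ab; rewrite Rintegral_cst//; congr (c * _).
have := @lebesgue_measure_itv R `]a, b[; rewrite /= => ->.
by rewrite lte_fin; case: ltgtP ab => //= -> _; rewrite subrr.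
Qed.

(** The hypothesis says that the derivative of [h] vanishes, uniformly enough to cover the end
    points. It stands in for a product rule wherever only increments can be estimated. *)
Lemma flat_eq h (a b : R) : a <= b ->
  (forall s e : R, a <= s <= b -> 0 < e -> exists2 d, 0 < d &
     forall x y : R, a <= x -> x <= y -> y <= b -> `|x - s| < d -> `|y - s| < d ->
       `|h y - h x| <= e * (y - x)) ->
  h a = h b.
Proof.
move=> ab hflat.
(* Clamping to [a, b] extends [h] by constants to the whole line, so that two-sided derivatives
   exist at [a] and [b] too. The map is monotone and 1-Lipschitz, hence preserves the estimate. *)
pose cl (x : R) : R := Num.max a (Num.min b x).
have clI x : a <= cl x <= b.
  by rewrite /cl le_max lexx/= ge_max ab ge_min lexx.
have clE z : [\/ z <= a /\ cl z = a, (a <= z <= b) /\ cl z = z | b <= z /\ cl z = b].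
  rewrite /cl; have [za|az] := leP z a.
    by constructor 1; rewrite (min_idPr (le_trans za ab)) (max_idPl za).
  have [zb|bz] := leP z b.
    by constructor 2; rewrite (max_idPr (ltW az)) (ltW az).
  by constructor 3; rewrite (max_idPr ab) (ltW bz).
have clm x y : x <= y -> cl x <= cl y.
  by move=> xy; case: (clE x) => -[? ->]; case: (clE y) => -[? ->]; lra.
have clL x y : x <= y -> cl y - cl x <= y - x.
  by move=> xy; case: (clE x) => -[? ->]; case: (clE y) => -[? ->]; lra.
pose H := h \o cl.
have dH (x : R) : is_derive x 1 H 0.
  have key e : 0 < e -> exists2 d, 0 < d & forall y, `|y - x| < d ->
      `|H y - H x| <= e * `|y - x|.
    move=> e0; have [d d0 hd] := hflat (cl x) e (clI x) e0.
    exists d => // y yx.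
    have [/andP[ax xb] /andP[ay yb]] := (clI x, clI y).
    have [xy|xy] := leP x y.
      have h1 := clL _ _ xy; have h2 := clm _ _ xy.
      rewrite [in leRHS]ger0_norm ?subr_ge0//.
      apply: le_trans (hd _ _ _ _ _ _ _) _ => //.
      - by rewrite subrr normr0.
      - rewrite ger0_norm ?subr_ge0//; apply: le_lt_trans h1 _.
        by apply: le_lt_trans yx; exact: ler_norm.
      - by rewrite ler_pM2l.
    have h1 := clL _ _ (ltW xy); have h2 := clm _ _ (ltW xy).
    rewrite distrC [in leRHS]distrC [in leRHS]ger0_norm ?subr_ge0 ?(ltW xy)//.
    apply: le_trans (hd _ _ _ _ _ _ _) _ => //.
    - rewrite distrC ger0_norm ?subr_ge0//; apply: le_lt_trans h1 _.
      by apply: le_lt_trans yx; rewrite distrC; exact: ler_norm.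
    - by rewrite subrr normr0.
    - by rewrite ler_pM2l.
  have lim : t^-1 *: (H (t *: 1 + x) - H x) @[t --> 0^'] --> (0 : R).
    apply/cvgrPdist_le => e e0.
    have [d d0 hd] := key e e0.
    near=> t.
    have t0 : t != 0 by near: t; exact: nbhs_dnbhs_neq.
    rewrite sub0r normrN normrZ normfV mulrC ler_pdivrMr ?normr_gt0//.
    have := hd (t *: 1 + x); rewrite addrK [t *: 1]mulr1 => -> //.
    near: t; apply: dnbhs0_lt; exact: d0.
  by split; [apply/cvg_ex; exists 0; exact: lim|exact: cvg_lim lim].
have := is_derive_0_is_cst a b dH.
rewrite /H /cl/= (min_idPr ab) !maxxx (min_idPl (lexx b)).
by rewrite (max_idPr ab).
Unshelve. all: by end_near. Qed.

Lemma Rintegral_itv_split f a b c : a <= b -> b <= c ->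
  mu.-integrable `]a, c[ (EFin \o f) ->
  \int[mu]_(x in `]a, c[) f x =
    \int[mu]_(x in `]a, b[) f x + \int[mu]_(x in `]b, c[) f x.
Proof.
move=> ab; rewrite le_eqVlt => /predU1P[<- _|bc intf].
  by rewrite [X in _ + X](_ : _ = 0) ?addr0// set_itv_ge ?bnd_simp ?ltxx// Rintegral_set0.
have := @Rintegral_itvB R f (BRight a) (BLeft c) b intf.
rewrite !bnd_simp => /(_ ab bc) <-.
rewrite [\int[mu]_(x in `]a, b[) _]Rintegral_itv_bndo_bndc; first by rewrite addrCA subrr addr0.
by apply: integrableS intf => //; apply: subset_itvl; rewrite bnd_simp ltW.
Qed.

(** Continuity at [s] of the indefinite integral of |f|. The integrand is first extended by zero,
    because the continuity theorem is stated on a closed interval. *)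
Lemma AC_integral_norm_small f (a b s e : R) : a < b -> a <= s <= b -> 0 < e ->
  mu.-integrable `]a, b[ (EFin \o f) ->
  exists2 d, 0 < d &
     forall x y : R, a <= x -> x <= y -> y <= b -> `|x - s| < d -> `|y - s| < d ->
       \int[mu]_(r in `]x, y[) `|f r| <= e.
Proof.
move=> ab sab e0 intf.
have intn : mu.-integrable `]a, b[ (EFin \o (fun x => `|f x|)) by exact: integrable_norm.
pose F := (fun x => `|f x|) \_ `]a, b[.
have intF : mu.-integrable setT (EFin \o F).
  rewrite /F; move: intn => /integrable_mkcond -/(_ (measurable_itv _)).
  by rewrite restrict_EFin.
have intFab : mu.-integrable `[a, b] (EFin \o F) by exact: integrableS intF.
have cF := parameterized_integral_continuous (ltW ab) intFab.
have /subspace_continuousP/(_ s sab)/cvgrPdist_lt/(_ (e / 2)) := cF.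
rewrite divr_gt0// => /(_ isT) /= [d d0 hd].
exists d => // x y ax xy yb xs ys.
have [xy'|xy'] := eqVneq x y.
  by rewrite xy' set_itv_ge ?bnd_simp ?ltxx// Rintegral_set0 ltW.
have {xy'}xy' : x < y by rewrite lt_neqAle xy'.
have := @Rintegral_itvB R F (BLeft a) (BRight y) x.
rewrite !bnd_simp => /(_ _ ax xy).
rewrite -[X in _ -> _ - _ = X]Rintegral_itv_bndo_bndc; last by exact: integrableS intF.
have -> : \int[mu]_(r in `]x, y[) F r = \int[mu]_(r in `]x, y[) `|f r|.
  apply: eq_Rintegral => r; rewrite inE/= in_itv/= => /andP[xr ry].
  by rewrite /F patchE mem_set//= in_itv/= (le_lt_trans ax)//= (lt_le_trans ry).
move=> <-; last exact: integrableS intF.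
have hx : x \in `[a, b] by rewrite in_itv/= ax (le_trans xy).
have hy : y \in `[a, b] by rewrite in_itv/= yb (le_trans ax).
have := hd x; have := hd y; rewrite /ball_/= ![`|s - _|]distrC => /(_ ys hy) h1 /(_ xs hx) h2.
rewrite /parameterized_integral in h1 h2.
move: h1 h2; rewrite /from_subspace !ltr_distl => /andP[? ?] /andP[? ?]; lra.
Qed.

Lemma AC_le_norm f f' (a b : R) : AC_derivative a b f f' ->
  forall x y : R, a <= x -> x <= y -> y <= b ->
    `|f y - f x| <= \int[mu]_(r in `]x, y[) `|f' r|.
Proof.
move=> [int_f' fE] x y ax; rewrite le_eqVlt => /predU1P[-> yb|xy yb].
  by rewrite subrr normr0 Rintegral_ge0.
rewrite fE//; apply: le_normr_Rintegral => //.
by apply: integrableS int_f' => //; apply: subset_itvW.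
Qed.

Lemma AC_le_norm_ab f f' (a b : R) : AC_derivative a b f f' ->
  forall x y : R, a <= x -> x <= y -> y <= b ->
    `|f y - f x| <= \int[mu]_(r in `]a, b[) `|f' r|.
Proof.
move=> fE x y ax xy yb; apply: le_trans (AC_le_norm fE ax xy yb) _.
have intn : mu.-integrable `]a, b[ (EFin \o (fun x => `|f' x|)).
  by apply: integrable_norm; case: fE.
rewrite (@Rintegral_itv_split _ a x b)//; last exact: le_trans xy yb.
rewrite (@Rintegral_itv_split _ x y b)//; last first.
  by apply: integrableS intn => //; exact: subset_itvr.
by rewrite [X in _ <= X]addrCA lerDl addr_ge0// Rintegral_ge0.
Qed.

Lemma ler_norm_of_dist (u v c : R) : `|u - v| <= c -> `|u| <= `|v| + c.
Proof. by have := ler_normD v (u - v); rewrite addrCA subrr addr0; lra. Qed.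

(* For a partial integration defect Q one has
   |Q y - Q x| <= 2 M (y - x) \int_x^y |psi'|, which is o(y - x). *)
Lemma AC_integration_by_parts f f' g g' (a b M : R) : a < b ->
  measurable_fun `]a, b[ f -> measurable_fun `]a, b[ f' ->
  measurable_fun `]a, b[ g ->
  AC_derivative a b f f' -> (forall x, a < x < b -> `|f' x| <= M) ->
  AC_derivative a b g g' ->
  [/\ mu.-integrable `]a, b[ (EFin \o (fun x => f x * g' x)),
      mu.-integrable `]a, b[ (EFin \o (fun x => f' x * g x)) &
      \int[mu]_(x in `]a, b[) (f x * g' x) =
      f b * g b - f a * g a - \int[mu]_(x in `]a, b[) (f' x * g x)].
Proof.
move=> ab mf mf' mg fAC f'M gAC.
have M0 : 0 <= M.
  have := f'M ((a + b) / 2); have := normr_ge0 (f' ((a + b) / 2)).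
  by move=> h1 h2; apply: le_trans h1 (h2 _); lra.
have [int_f' fE] := fAC.
have [int_g' gE] := gAC.
have intng : mu.-integrable `]a, b[ (EFin \o (fun x => `|g' x|)).
  exact: integrable_norm.
pose C := `|f a| + \int[mu]_(r in `]a, b[) `|f' r|.
have fC x : x \in `]a, b[ -> `|f x| <= C.
  rewrite in_itv/= => /andP[ax xb].
  apply: ler_norm_of_dist; exact: AC_le_norm_ab fAC _ _ (lexx a) (ltW ax) (ltW xb).
pose D := `|g a| + \int[mu]_(r in `]a, b[) `|g' r|.
have gD x : x \in `]a, b[ -> `|g x| <= D.
  rewrite in_itv/= => /andP[ax xb].
  apply: ler_norm_of_dist; exact: AC_le_norm_ab gAC _ _ (lexx a) (ltW ax) (ltW xb).
have i1 : mu.-integrable `]a, b[ (EFin \o (fun x => f x * g' x)).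
  apply: (le_integrable _ _ _ (integrableZl _ C int_g')) => //.
    apply/measurable_EFinP; apply: measurable_funM => //.
    by apply/measurable_EFinP; exact: (measurable_int _ int_g').
  move=> x xab /=; rewrite lee_fin !normrM ler_wpM2r//.
  by apply: le_trans (fC x xab) _; exact: ler_norm.
have i2 : mu.-integrable `]a, b[ (EFin \o (fun x => f' x * g x)).
  apply: (le_integrable _ _ _ (integrableZl _ D int_f')) => //.
    by apply/measurable_EFinP; apply: measurable_funM.
  move=> x xab /=; rewrite lee_fin !normrM mulrC ler_wpM2r//.
  by apply: le_trans (gD x xab) _; exact: ler_norm.
split=> //.
pose w x := f x * g' x + f' x * g x.
have iw : mu.-integrable `]a, b[ (EFin \o w).
  by have := integrableD _ i1 i2; apply.
pose Q y := f y * g y - \int[mu]_(x in `]a, y[) w x.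
suff : Q a = Q b.
  rewrite /Q set_itv_ge ?bnd_simp ?ltxx// Rintegral_set0 subr0 => ->.
  rewrite RintegralD//; ring.
apply: flat_eq; first exact: ltW.
move=> s e sab e0.
have [|d d0 hd] := @AC_integral_norm_small _ a b s (e / (2 * (M + 1))) ab sab _ int_g'.
  by rewrite divr_gt0// mulr_gt0// ltr_wpDl.
exists d => // x y ax xy yb xs ys.
move: xy; rewrite le_eqVlt => /predU1P[->|xy].
  by rewrite !subrr normr0 mulr0.
have sub : `]x, y[ `<=` `]a, b[ by apply: subset_itvW.
have ig : mu.-integrable `]x, y[ (EFin \o g') by exact: integrableS int_g'.
have if' : mu.-integrable `]x, y[ (EFin \o f') by exact: integrableS int_f'.
have iwxy : mu.-integrable `]x, y[ (EFin \o w) by exact: integrableS iw.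
have := hd x y ax (ltW xy) yb xs ys.
set I := \int[mu]_(r in _) _ => hI.
have I0 : 0 <= I by exact: Rintegral_ge0.
(* From f(y)g(y) - f(x)g(x) = f(y)(g(y) - g(x)) + g(x)(f(y) - f(x)). *)
have -> : Q y - Q x = \int[mu]_(r in `]x, y[) ((f y * g' r + g x * f' r) - w r).
  have ify : mu.-integrable `]x, y[ (EFin \o (fun r => f y * g' r)).
    exact: (integrableZl _ (f y) ig).
  have igx : mu.-integrable `]x, y[ (EFin \o (fun r => g x * f' r)).
    exact: (integrableZl _ (g x) if').
  rewrite RintegralB//; last exact: integrableD_EFin.
  rewrite RintegralD// !RintegralZl// -gE// -fE//.
  rewrite /Q (@Rintegral_itv_split w a x y) ?(ltW xy)//; last first.
    by apply: integrableS iw => //; apply: subset_itvW.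
  ring.
have iwd : mu.-integrable `]x, y[ (EFin \o (fun r => (f y * g' r + g x * f' r) - w r)).
  have := integrableB _ (integrableD _ (integrableZl _ (f y) ig) (integrableZl _ (g x) if')) iwxy.
  by apply.
apply: le_trans (le_normr_Rintegral _ iwd) _ => //.
have inxy : mu.-integrable `]x, y[ (EFin \o (fun r => `|g' r|)) by exact: integrable_norm.
have ibd : mu.-integrable `]x, y[ (EFin \o (fun r => M * (y - x) * `|g' r| + M * I)).
  apply: integrableD_EFin => //; last exact: cst_integrable_itv.
  exact: integrableZ_EFin.
apply: (@le_trans _ _ (\int[mu]_(r in `]x, y[) (M * (y - x) * `|g' r| + M * I))).
  apply: le_Rintegral => //; first exact: integrable_norm.
  move=> r /[dup] rxy; rewrite /= in_itv/= => /andP[xr ry].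
  have rab : a < r < b by rewrite (le_lt_trans ax)//= (lt_le_trans ry).
  (* Each product now has a factor that is small with the interval: |f y - f r| <= M (y - x), and |g
     x - g r| <= [I]. *)
  have -> : f y * g' r + g x * f' r - w r = (f y - f r) * g' r + f' r * (g x - g r).
    rewrite /w; ring.
  apply: le_trans (ler_normD _ _) _; rewrite !normrM lerD//.
    rewrite ler_wpM2r//.
    have : AC_derivative r y f f'.
      split; first by apply: integrableS if' => //; apply: subset_itvW => //; exact: ltW.
      move=> u v ru uv vy; apply: fE => //; last exact: le_trans yb.
      by rewrite (le_trans _ ru)// (le_trans ax)// ltW.
    move=> /AC_le_norm /(_ r y (lexx _) (ltW ry) (lexx _)) /le_trans; apply.
    have iff : mu.-integrable `]r, y[ (EFin \o (fun r => `|f' r|)).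
      by apply: integrable_norm; apply: integrableS if' => //; apply: subset_itvW => //; exact: ltW.
    apply: (@le_trans _ _ (\int[mu]_(u in `]r, y[) M)).
      apply: le_Rintegral => //; first exact: cst_integrable_itv.
      move=> u /=; rewrite in_itv/= => /andP[ru uy]; apply: f'M.
      by rewrite (lt_le_trans uy yb) (le_lt_trans ax)// (lt_trans xr).
    rewrite Rintegral_cst_itv ?(ltW ry)// ler_wpM2l//.
    by rewrite lerB// ltW.
  rewrite ler_pM// ?f'M// distrC.
  have := AC_le_norm gAC ax (ltW xr) (le_trans (ltW ry) yb).
  move=> /le_trans; apply.
  rewrite /I (@Rintegral_itv_split _ x r y) ?(ltW ry) ?(ltW xr)//.
  by rewrite lerDl Rintegral_ge0.
rewrite RintegralD//; last 2 first.
  exact: integrableZ_EFin.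
  exact: cst_integrable_itv.
rewrite RintegralZl// Rintegral_cst_itv ?(ltW xy)// -/I.
have : 2 * M * I <= e.
  apply: (@le_trans _ _ (2 * (M + 1) * (e / (2 * (M + 1))))).
    by rewrite ler_pM ?mulr_ge0// ler_wpM2l// lerDl.
  by rewrite mulrC divfK// mulf_neq0// gt_eqF// ltr_wpDl.
move=> h; rewrite (_ : _ + _ = 2 * M * I * (y - x)); last by ring.
by rewrite ler_wpM2r// subr_ge0 ltW.
Qed.

Lemma cvg_Rintegral_itv_sym g : mu.-integrable setT (EFin \o g) ->
  \int[mu]_(x in `]- n.+1%:R, n.+1%:R[) g x @[n --> \oo] --> \int[mu]_x g x.
Proof.
move=> ig.
have mg : measurable_fun setT g by apply/measurable_EFinP; exact: (measurable_int _ ig).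
pose D n := `]- n.+1%:R, n.+1%:R[%classic : set R.
have [|||||_ _] := @dominated_convergence _ _ R mu setT measurableT
  (fun n => EFin \o (g \_ (D n))) (EFin \o g) (abse \o (EFin \o g)).
- move=> n; apply/measurable_EFinP.
  by apply/(measurable_restrictT g (measurable_itv _)); exact: measurable_funTS.
- exact: (measurable_int _ ig).
- apply: aeW => x _.
  apply/fine_cvgP; split; first exact: nearW.
  apply: cvg_near_cst; near=> n; rewrite /= patchE mem_set// /D/= in_itv/= -ltr_norml.
  near: n; exists (Num.trunc `|x|) => // n /= hn.
  apply: lt_le_trans (truncnS_gt _) _; by rewrite ler_nat.
- exact: integrable_abse.
- apply: aeW => x n _ /=; rewrite lee_fin patchE; case: ifPn => // _.
  by rewrite normr0.
- rewrite -[X in _ --> X -> _]fineK; last exact: integrable_fin_num.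
  move=> /fine_cvgP[_]; apply: cvg_trans.
  apply: near_eq_cvg; near=> n => /=.
  by rewrite [RHS]Rintegral_mkcond.
Unshelve. all: by end_near. Qed.

(** Pointwise |g'| <= g'^2 + 1, so an increment is at most the squared norm of g' plus the length of
    the interval. This controls the boundary terms at infinity without showing that [g] tends to
    zero. *)
Lemma AC_linear_growth g g' : L2 g' ->
  (forall a b : R, a < b -> AC_derivative a b g g') ->
  exists2 A : R, 0 <= A & forall x, `|g x| <= A + `|x|.
Proof.
move=> Lg' gAC; exists (`|g 0| + ip g' g'); first by rewrite addr_ge0// ip_ge0.
have key a b : a <= b -> `|g b - g a| <= ip g' g' + (b - a).
  rewrite le_eqVlt => /predU1P[->|ab]; first by rewrite !subrr normr0 addr0 ip_ge0.
  have [int_g' _] := gAC a b ab.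
  have i2 := ip_integrable Lg' Lg'.
  have i2ab : mu.-integrable `]a, b[ (EFin \o (fun x => g' x * g' x)) by exact: integrableS i2.
  apply: le_trans (AC_le_norm (gAC a b ab) (lexx _) (ltW ab) (lexx _)) _.
  apply: (@le_trans _ _ (\int[mu]_(x in `]a, b[) (g' x * g' x + 1))).
    apply: le_Rintegral => //; first exact: integrable_norm.
      by apply: integrableD_EFin => //; exact: cst_integrable_itv.
    move=> x _; rewrite -expr2 -[g' x ^+ 2]real_normK ?num_real//.
    have := sqr_ge0 (`|g' x| - 1); have := normr_ge0 (g' x); nra.
  rewrite RintegralD//; last exact: cst_integrable_itv.
  rewrite Rintegral_cst_itv ?(ltW ab)// mul1r lerD2r.
  rewrite Rintegral_mkcond; apply: le_Rintegral => //.
    rewrite -restrict_EFin; apply/(integrable_mkcond _ _).1 => //.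
  move=> x _; rewrite patchE; case: ifPn => // _.
  by rewrite -expr2 sqr_ge0.
move=> x; rewrite -addrA; apply: ler_norm_of_dist.
have [x0|x0] := leP 0 x.
  by apply: le_trans (key _ _ x0) _; rewrite subr0 ger0_norm.
by rewrite distrC; apply: le_trans (key _ _ (ltW x0)) _; rewrite sub0r ltr0_norm.
Qed.

(** The branches [fm] and [fp] allow [f] to jump at 0, and the jump produces the term in [g 0]. The
    boundary terms at distance n vanish in the limit since [f] is O(n^-2) there and [g] is O(n). *)
Lemma ip_integration_by_parts f fm fp f' g g' (C M : R) :
  L2 f -> L2 f' -> L2 g -> L2 g' ->
  (forall x, x < 0 -> f x = fm x) -> (forall x, 0 < x -> f x = fp x) ->
  (forall n : R, 0 < n -> AC_derivative (- n) 0 fm f') ->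
  (forall n : R, 0 < n -> AC_derivative 0 n fp f') ->
  (forall x, `|f' x| <= M) -> (forall x, `|f x| * (1 + x ^+ 2) <= C) ->
  (forall a b : R, a < b -> AC_derivative a b g g') ->
  ip f g' = (fm 0 - fp 0) * g 0 - ip f' g.
Proof.
move=> Lf Lf' Lg Lg' fmE fpE fmAC fpAC f'M fC gAC.
have mf := L2_measurable Lf; have mf' := L2_measurable Lf'; have mg := L2_measurable Lg.
have C0 : 0 <= C by apply: le_trans (fC 0); rewrite mulr_ge0// addr_ge0// sqr_ge0.
pose w x := f x * g' x + f' x * g x.
have i1 := ip_integrable Lf Lg'.
have i2 := ip_integrable Lf' Lg.
have iw : mu.-integrable setT (EFin \o w) by exact: integrableD_EFin.
suff : \int[mu]_x w x = (fm 0 - fp 0) * g 0.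
  by rewrite RintegralD// -/(ip f g') -/(ip f' g) => <-; rewrite addrK.
apply: cvg_unique (cvg_Rintegral_itv_sym iw) _; first exact: Rhausdorff.
have hw n : \int[mu]_(x in `]- n.+1%:R, n.+1%:R[) w x =
    (fm 0 - fp 0) * g 0 + (f n.+1%:R * g n.+1%:R - f (- n.+1%:R) * g (- n.+1%:R)).
  have n0 : 0 < n.+1%:R :> R by rewrite ltr0n.
  have iwn : mu.-integrable `]- n.+1%:R, n.+1%:R[ (EFin \o w) by exact: integrableS iw.
  rewrite (@Rintegral_itv_split _ _ 0)//.
  have N0 : - n.+1%:R < 0 :> R by rewrite oppr_lt0.
  have [||||h1 h2 h3] := @AC_integration_by_parts fm f' g g' _ _ M N0 _ _ _ (fmAC _ n0) _ (gAC _ _ N0).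
  - apply: eq_measurable_fun (measurable_funTS mf) => x.
    by rewrite inE/= in_itv/= => /andP[_ /fmE].
  - exact: measurable_funTS.
  - exact: measurable_funTS.
  - by move=> x _; exact: f'M.
  have [||||h4 h5 h6] := @AC_integration_by_parts fp f' g g' _ _ M n0 _ _ _ (fpAC _ n0) _ (gAC _ _ n0).
  - apply: eq_measurable_fun (measurable_funTS mf) => x.
    by rewrite inE/= in_itv/= => /andP[/fpE].
  - exact: measurable_funTS.
  - exact: measurable_funTS.
  - by move=> x _; exact: f'M.
  rewrite (fmE _ N0) (fpE _ n0).
  rewrite RintegralD//; last by apply: integrableS i1.
  rewrite RintegralD//; last by apply: integrableS i1.
  have -> : \int[mu]_(x in `]- n.+1%:R, 0[) (f x * g' x) = \int[mu]_(x in `]- n.+1%:R, 0[) (fm x * g' x).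
    by apply: eq_Rintegral => x; rewrite inE/= in_itv/= => /andP[_ /fmE ->].
  have -> : \int[mu]_(x in `]0, n.+1%:R[) (f x * g' x) = \int[mu]_(x in `]0, n.+1%:R[) (fp x * g' x).
    by apply: eq_Rintegral => x; rewrite inE/= in_itv/= => /andP[/fpE ->].
  by rewrite h3 h6; ring.
suff lim : (fm 0 - fp 0) * g 0 + (f n.+1%:R * g n.+1%:R - f (- n.+1%:R) * g (- n.+1%:R))
    @[n --> \oo] --> (fm 0 - fp 0) * g 0.
  by move: lim; apply: cvg_trans; apply: near_eq_cvg; near=> n; rewrite hw.
rewrite -[X in _ --> X]addr0; apply: cvgD; first exact: cvg_cst.
have [A A0 gA] := AC_linear_growth Lg' gAC.
(* The decay of [f] against the linear growth of [g]: |f| (A + m) m <= 2 (A + 1) |f| (1 + m^2) for m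
   >= 1. *)
have bd n x : `|x| = n.+1%:R -> `|f x * g x| <= 2 * C * (A + 1) * n.+1%:R^-1.
  move=> xn; set m : R := n.+1%:R in xn *.
  have m1 : 1 <= m by rewrite /m ler1n.
  have m0 : 0 < m by rewrite /m ltr0n.
  have := fC x; rewrite -[x ^+ 2]real_normK ?num_real// xn => h1.
  have := gA x; rewrite xn normrM => h2.
  rewrite ler_pdivlMr//.
  apply: (@le_trans _ _ (`|f x| * (A + m) * m)).
    by rewrite ler_wpM2r ?(ltW m0)// ler_wpM2l.
  apply: (@le_trans _ _ (`|f x| * (1 + m ^+ 2) * (2 * (A + 1)))); last by nra.
  rewrite -!mulrA ler_wpM2l//; nra.
have lim0 : 2 * C * (A + 1) * n.+1%:R^-1 @[n --> \oo] --> (0 : R).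
  rewrite -[X in _ --> X](mulr0 (2 * C * (A + 1))); apply: cvgMr; exact: cvg_harmonic.
have lim_bd u : (forall n, `|u n| <= 2 * C * (A + 1) * n.+1%:R^-1) -> u @ \oo --> (0 : R).
  move=> hu; apply: norm_cvg0; apply: (squeeze_cvgr _ _ lim0); last exact: (cvg_cst 0).
  by apply: nearW => n; rewrite normr_ge0 hu.
rewrite -[X in _ --> X]subr0; apply: cvgB; apply: lim_bd => n; apply: bd.
  by rewrite ger0_norm.
by rewrite normrN ger0_norm.
Unshelve. all: by end_near. Qed.

End absolutely_continuous.

(** * Heat kernels *)

Section heat_kernels.
Context {R : realType}.
Local Notation mu := (@lebesgue_measure R).
Implicit Types (f g : R -> R) (t x z : R).

(** One quantitative condition with three uses: membership in L^2, a dominating function common to a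
    range of times, and vanishing boundary terms at infinity. *)
Definition decay (C : R) f := forall x, `|f x| * (1 + x ^+ 2) <= C.

Lemma integrable_patch (D : set R) f : measurable D ->
  mu.-integrable D (EFin \o f) -> mu.-integrable setT (EFin \o (f \_ D)).
Proof.
by move=> mD i; rewrite -restrict_EFin; apply/(@integrable_mkcond _ _ R mu D _ mD).
Qed.

Lemma C1_AC f f' (a b : R) : a < b -> (forall x, is_derive x 1 f (f' x)) ->
  continuous f' -> AC_derivative a b f f'.
Proof.
move=> ab df cf'.
have ccf (s t : R) : {within `[s, t], continuous f'} by apply: continuous_subspaceT.
have intc (s t : R) : mu.-integrable `[s, t] (EFin \o f').
  by apply: continuous_compact_integrable => //; exact: segment_compact.
split.
  by apply: integrableS (intc a b) => //; exact: subset_itv_oo_cc.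
move=> s t _ st _.
have cf z : {for z, continuous f}.
  by apply: differentiable_continuous; apply/derivable1_diffP; apply: ex_derive.
have dfLR : derivable_oo_LRcontinuous f s t.
  split; first by move=> z _; apply: ex_derive.
    by apply: cvg_at_right_filter; exact: cf.
  by apply: cvg_at_left_filter; exact: cf.
have f'E : {in `]s, t[, (f^`())%classic =1 f'}.
  by move=> z _; rewrite derive1E; apply: derive_val.
have h := continuous_FTC2 st (ccf s t) dfLR f'E.
rewrite integral_itv_bndoo in h; last first.
  by apply/measurable_EFinP; apply: measurable_funTS; exact: continuous_measurable_fun.
by rewrite /Rintegral h.
Qed.

Lemma oneDsqr_gt0 x : 0 < 1 + x ^+ 2.
Proof. by rewrite ltr_pwDl// sqr_ge0. Qed.

Lemma integrable_oneDsqrV : mu.-integrable setT (EFin \o (fun x => (1 + x ^+ 2)^-1)).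
Proof.
have cont : continuous (fun x : R => (1 + x ^+ 2)^-1).
  by move=> x; exact: continuous_oneDsqrV.
apply/integrableP; split.
  by apply/measurable_EFinP; exact: continuous_measurable_fun.
under eq_integral => x _ do rewrite gee0_abs ?lee_fin ?invr_ge0 ?(ltW (oneDsqr_gt0 _))//.
rewrite ge0_symfun_integralT//.
- rewrite (_ : [set x | _] = `[0, +oo[%classic); last first.
    by apply/seteqP; split => x/=; rewrite in_itv/= andbT.
  have := @integral0y_oneDsqr R; rewrite /= => ->.
  by rewrite -EFinM ltry.
- by move=> x; rewrite invr_ge0 ltW// oneDsqr_gt0.
- by move=> x /=; rewrite sqrrN.
Qed.

Lemma decay_L2 (C : R) f : measurable_fun setT f -> decay C f -> L2 f.
Proof.
move=> mf fC; apply/L2P; split=> //.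
have C0 : 0 <= C by apply: le_trans (fC 0); rewrite mulr_ge0// ltW// oneDsqr_gt0.
apply: (le_integrable measurableT _ _ (integrableZ_EFin (C ^+ 2) measurableT integrable_oneDsqrV)).
  by apply/measurable_EFinP; exact: measurable_funX.
move=> x _ /=; rewrite lee_fin ger0_norm ?sqr_ge0// ger0_norm; last first.
  by rewrite mulr_ge0 ?sqr_ge0// invr_ge0 ltW// oneDsqr_gt0.
rewrite ler_pdivlMr ?oneDsqr_gt0//.
apply: (@le_trans _ _ ((`|f x| * (1 + x ^+ 2)) ^+ 2)); last first.
  by rewrite lerXn2r ?nnegrE// mulr_ge0// ltW// oneDsqr_gt0.
rewrite exprMn real_normK ?num_real// ler_wpM2l ?sqr_ge0//.
by rewrite expr2 ler_peMl ?(ltW (oneDsqr_gt0 _))// lerDl sqr_ge0.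
Qed.

Definition gau t x : R := expR (- (x ^+ 2 / (4 * t))).

Lemma gau_derive t x : t != 0 -> is_derive x 1 (gau t) (- (x / (2 * t)) * gau t x).
Proof.
move=> t0; rewrite /gau; apply: is_derive_eq.
rewrite /GRing.scale/= !mulr1; field; exact: t0.
Qed.

(** [hc] and [hs] split the normalization of the odd kernel into its numerical part and t^(-3/2).
    [hg t] is twice the Gauss kernel, [hk t] is minus its space derivative, and [hk1], [hk2] are the
    first two space derivatives of [hk]. *)
Definition hc : R := (2 * Num.sqrt pi)^-1.
Definition hs t : R := (t * Num.sqrt t)^-1.
Definition hg t x : R := (Num.sqrt pi * Num.sqrt t)^-1 * gau t x.
Definition hk t x : R := hc * hs t * (x * gau t x).
Definition hk1 t x : R := hc * hs t * ((1 - x ^+ 2 / (2 * t)) * gau t x).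
Definition hk2 t x : R :=
  hc * hs t * ((x ^+ 3 / (4 * t ^+ 2) - 3 * x / (2 * t)) * gau t x).

Lemma hg_derive t x : 0 < t -> is_derive x 1 (hg t) (- hk t x).
Proof.
move=> t0; have t0' : t != 0 by rewrite gt_eqF.
have st0 : Num.sqrt t != 0 by rewrite gt_eqF// sqrtr_gt0.
have sp0 : Num.sqrt pi != 0 :> R by rewrite gt_eqF// sqrtr_gt0 pi_gt0.
rewrite /hg /gau; apply: is_derive_eq.
rewrite /hk /hc /hs /gau /GRing.scale/= !mulr1; field.
by rewrite t0' st0 sp0.
Qed.

Lemma hk_derive t x : 0 < t -> is_derive x 1 (hk t) (hk1 t x).
Proof.
move=> t0; have t0' : t != 0 by rewrite gt_eqF.
rewrite /hk /gau; apply: is_derive_eq.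
rewrite /hk1 /gau /GRing.scale/= !mulr1; field; exact: t0'.
Qed.

Lemma hk1_derive t x : 0 < t -> is_derive x 1 (hk1 t) (hk2 t x).
Proof.
move=> t0; have t0' : t != 0 by rewrite gt_eqF.
rewrite /hk1 /gau; apply: is_derive_eq.
rewrite /hk2 /gau /GRing.scale/= !mulr1 ?expr1; field; exact: t0'.
Qed.

(** The heat equation: the second space derivative [hk2] is also the time derivative. *)
Lemma hk_derive_time t x : 0 < t -> is_derive t 1 (hk ^~ x) (hk2 t x).
Proof.
move=> t0; have t0' : t != 0 by rewrite gt_eqF.
have st0 : Num.sqrt t != 0 by rewrite gt_eqF// sqrtr_gt0.
have st2 : Num.sqrt t ^+ 2 = t by rewrite sqr_sqrtr// ltW.
have dsq := is_derive1_sqrt t0.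
have ts0 : t * Num.sqrt t != 0 by rewrite mulf_neq0.
have t4 : 4 * t != 0 by rewrite mulf_neq0.
rewrite /hk /gau /hs; apply: is_derive_eq.
rewrite /hk2 /hs /gau /GRing.scale/= !mulr1.
set E := expR _.
(* With q = sqrt t as the variable and t = q^2, the half-integer powers become rational and [field]
   applies. *)
move: (Num.sqrt t) st0 st2 @E => q q0 <- E.
clearbody E; field; exact: q0.
Qed.

(** With y = x^2/(4b), 1 + x^2 <= (1 + 4b)(1 + y), and the exponential series gives (1 + y)^3 <= 3!
    exp(1 + y); the factor e is what remains after multiplying by exp(-y). Of the three powers, two
    will absorb a polynomial prefactor and the third is the weight in [decay]. *)
Lemma gau_decay3 t b x : 0 < t -> t <= b ->
  (1 + x ^+ 2) ^+ 3 * gau t x <= 6 * (1 + 4 * b) ^+ 3 * expR 1.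
Proof.
move=> t0 tb; have b0 : 0 < b by exact: lt_le_trans tb.
pose y := x ^+ 2 / (4 * b).
have y0 : 0 <= y by rewrite divr_ge0 ?sqr_ge0// mulr_ge0// ltW.
have gy : gau t x <= expR (- y).
  rewrite ler_expR lerN2 /y ler_wpM2l ?sqr_ge0// lef_pV2 ?posrE ?mulr_gt0//.
  by rewrite ler_wpM2l.
have hy : (1 + y) ^+ 3 <= 6 * expR (1 + y).
  have := @expR_ge1Dxn R (1 + y) 2; rewrite addr_ge0// => /(_ isT).
  rewrite (_ : (3`!)%:R = 6) // => h.
  have : (1 + y) ^+ 3 / 6 <= expR (1 + y) by lra.
  lra.
have hx : 1 + x ^+ 2 <= (1 + 4 * b) * (1 + y).
  have -> : x ^+ 2 = 4 * b * y by rewrite /y mulrC divfK// mulf_neq0// gt_eqF.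
  nra.
apply: (@le_trans _ _ (((1 + 4 * b) * (1 + y)) ^+ 3 * expR (- y))).
  apply: ler_pM => //.
  - by rewrite exprn_ge0// ltW// oneDsqr_gt0.
  - exact: expR_ge0.
  by rewrite lerXn2r ?nnegrE// ?(ltW (oneDsqr_gt0 _))// mulr_ge0// addr_ge0// mulr_ge0// ltW.
rewrite exprMn -[leLHS]mulrA [6 * _]mulrC -[leRHS]mulrA ler_wpM2l//.
  by rewrite exprn_ge0// addr_ge0// mulr_ge0// ltW.
apply: (@le_trans _ _ (6 * expR (1 + y) * expR (- y))).
  by rewrite ler_wpM2r// expR_ge0.
by rewrite -mulrA -expRD addrK.
Qed.

Lemma hs_ge0 t : 0 <= hs t.
Proof.
rewrite /hs invr_ge0; have [t0|t0] := leP 0 t; first by rewrite mulr_ge0// sqrtr_ge0.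
by rewrite ltr0_sqrtr// mulr0.
Qed.

Lemma hc_gt0 : 0 < hc.
Proof. by rewrite /hc invr_gt0 mulr_gt0// sqrtr_gt0 pi_gt0. Qed.

Lemma hs_le a t : 0 < a -> a <= t -> hs t <= hs a.
Proof.
move=> a0 at_; have t0 : 0 < t by exact: lt_le_trans at_.
rewrite /hs lef_pV2 ?posrE ?mulr_gt0 ?sqrtr_gt0//.
by rewrite ler_pM ?(ltW a0) ?sqrtr_ge0 ?ler_wsqrtr.
Qed.

(** The constant is uniform over the time interval: [hs] is bounded by its value at [a], the
    Gaussian through [b]. The uniformity is what permits passing to the limit or differentiating in
    time under the integral. *)
Lemma gau_decay (p : R -> R -> R) (K a b : R) : 0 < a ->
  (forall t x, a <= t <= b -> `|p t x| <= K * (1 + x ^+ 2) ^+ 2) -> 0 <= K ->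
  exists C : R, forall t, a <= t <= b -> decay C (fun x => hc * hs t * (p t x * gau t x)).
Proof.
move=> a0 pK K0.
exists (hc * hs a * (K * (6 * (1 + 4 * b) ^+ 3 * expR 1))) => t /[dup] atb /andP[at_ tb] x.
have t0 : 0 < t by exact: lt_le_trans at_.
have h0 := hc_gt0.
rewrite normrM ger0_norm ?mulr_ge0 ?hs_ge0 ?(ltW h0)// -[leLHS]mulrA.
apply: ler_pM.
- by rewrite mulr_ge0 ?hs_ge0 ?(ltW h0).
- by rewrite mulr_ge0// ltW// oneDsqr_gt0.
- by rewrite ler_wpM2l ?(ltW h0)// hs_le.
rewrite normrM [`|gau t x|]ger0_norm ?expR_ge0//.
apply: le_trans (_ : K * ((1 + x ^+ 2) ^+ 3 * gau t x) <= _); last first.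
  by rewrite ler_wpM2l// gau_decay3.
have := pK t x atb; have := oneDsqr_gt0 x; set q := 1 + x ^+ 2 => q0 pq.
rewrite (_ : K * _ = K * q ^+ 2 * gau t x * q); last by ring.
by rewrite !ler_wpM2r ?expR_ge0// ltW.
Qed.

Lemma hk_decay a b : 0 < a -> exists C : R, forall t, a <= t <= b -> decay C (hk t).
Proof.
move=> a0; apply: (@gau_decay (fun _ x => x) 1) => // t x _.
rewrite mul1r; have := sqr_ge0 (`|x| - 1); have := sqr_ge0 x.
rewrite -[x ^+ 2]real_normK ?num_real//; have := normr_ge0 x; nra.
Qed.

Lemma hk1_decay a b : 0 < a -> exists C : R, forall t, a <= t <= b -> decay C (hk1 t).
Proof.
move=> a0; apply: (@gau_decay (fun t x => 1 - x ^+ 2 / (2 * t)) (1 + a^-1)) => //.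
  move=> t x /andP[at_ _].
  have t0 : 0 < t by exact: lt_le_trans at_.
  have ta : t^-1 <= a^-1 by rewrite lef_pV2.
  have t1 : 0 < t^-1 by rewrite invr_gt0.
  have x0 := sqr_ge0 x.
  rewrite invfM mulrA; set u := t^-1 in ta t1 *.
  set v := a^-1 in ta *; set y := x ^+ 2 in x0 *.
  apply: le_trans (ler_normB _ _) _; rewrite normr1 ger0_norm; last first.
    by rewrite mulr_ge0 ?(ltW t1)// divr_ge0.
  nra.
by rewrite addr_ge0// invr_ge0 ltW.
Qed.

Lemma hk2_decay a b : 0 < a -> exists C : R, forall t, a <= t <= b -> decay C (hk2 t).
Proof.
move=> a0; apply: (@gau_decay (fun t x => x ^+ 3 / (4 * t ^+ 2) - 3 * x / (2 * t)) (a^-1 ^+ 2 + 2 * a^-1)) => //.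
  move=> t x /andP[at_ _].
  have t0 : 0 < t by exact: lt_le_trans at_.
  have ta : t^-1 <= a^-1 by rewrite lef_pV2.
  have t1 : 0 < t^-1 by rewrite invr_gt0.
  rewrite (_ : _ - _ = 4^-1 * (t^-1 ^+ 2 * x ^+ 3) - 3 / 2 * (t^-1 * x)); last first.
    by field; rewrite gt_eqF.
  apply: le_trans (ler_normB _ _) _.
  rewrite (normrM 4^-1) (normrM (t^-1 ^+ 2)) (normrM (3 / 2)) (normrM t^-1 x).
  rewrite (normrX 2 t^-1) (normrX 3 x) -[x ^+ 2]real_normK ?num_real//.
  rewrite [`|4^-1|]ger0_norm// [`|3 / 2|]ger0_norm// [`|t^-1|]ger0_norm ?(ltW t1)//.
  set u := t^-1 in ta t1 *; set v := a^-1 in ta *.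
  have := normr_ge0 x; set y := `|x| => y0.
  have uv2 : u ^+ 2 <= v ^+ 2 by rewrite lerXn2r ?nnegrE ?(ltW t1)// (le_trans (ltW t1)).
  have y3 : y ^+ 3 <= (1 + y ^+ 2) ^+ 2 by nra.
  have y1 : y <= (1 + y ^+ 2) ^+ 2 by nra.
  have u2 : 0 <= u ^+ 2 by exact: sqr_ge0.
  have h1 : u ^+ 2 * y ^+ 3 <= v ^+ 2 * (1 + y ^+ 2) ^+ 2 by rewrite ler_pM ?exprn_ge0 ?(ltW t1).
  have h2 : u * y <= v * (1 + y ^+ 2) ^+ 2 by rewrite ler_pM ?(ltW t1).
  have h3 : 0 <= u ^+ 2 * y ^+ 3 by rewrite mulr_ge0 ?exprn_ge0 ?(ltW t1).
  have h4 : 0 <= u * y by rewrite mulr_ge0 ?(ltW t1).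
  lra.
by rewrite addr_ge0 ?sqr_ge0// mulr_ge0// invr_ge0 ltW.
Qed.

Lemma hg_decay t : 0 < t -> exists C : R, decay C (hg t).
Proof.
move=> t0; have [||C hC] := @gau_decay (fun _ _ => 1) 1 t t t0 _ _ => //.
  move=> _ x _; rewrite normr1 mul1r; have := sqr_ge0 x; nra.
exists (C * (2 * t)) => x.
have := hC t; rewrite !lexx => /(_ isT x); rewrite mul1r => h.
rewrite /hg.
have st0 : Num.sqrt t != 0 by rewrite gt_eqF// sqrtr_gt0.
have sp0 : Num.sqrt pi != 0 :> R by rewrite gt_eqF// sqrtr_gt0 pi_gt0.
(* Rewriting t^(-1/2) as t^(-3/2) times t brings [hg] under the general bound with prefactor 1. *)
have -> : (Num.sqrt pi * Num.sqrt t)^-1 * gau t x = (hc * hs t * gau t x) * (2 * t).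
  by rewrite /hc /hs; field; rewrite st0 sp0 gt_eqF.
rewrite normrM [`|2 * t|]ger0_norm ?mulr_ge0 ?(ltW t0)//.
by rewrite mulrAC ler_wpM2r// mulr_ge0// ltW.
Qed.

(** * The kernels as continuous functions, elements of L^2 and test functions *)

Lemma continuous_is_derive f f' : (forall x, is_derive x 1 f (f' x)) -> continuous f.
Proof.
move=> df x; apply: differentiable_continuous; apply/derivable1_diffP.
exact: ex_derive.
Qed.

Lemma continuous_hg t : 0 < t -> continuous (hg t).
Proof. by move=> t0; apply: continuous_is_derive => x; exact: hg_derive. Qed.

Lemma continuous_hk t : 0 < t -> continuous (hk t).
Proof. by move=> t0; apply: continuous_is_derive => x; exact: hk_derive. Qed.

Lemma continuous_hk1 t : 0 < t -> continuous (hk1 t).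
Proof. by move=> t0; apply: continuous_is_derive => x; exact: hk1_derive. Qed.

Lemma continuous_hk2 t : 0 < t -> continuous (hk2 t).
Proof.
move=> t0; have t0' : t != 0 by rewrite gt_eqF.
have dgau x := gau_derive x t0'.
apply: (@continuous_is_derive _ (derive1 (hk2 t))) => x.
rewrite derive1E; apply: DeriveDef => //.
Qed.

Lemma L2_hk t : 0 < t -> L2 (hk t).
Proof.
move=> t0; have [C hC] := hk_decay t t0.
apply: decay_L2 (hC t _); last by rewrite !lexx.
by apply: continuous_measurable_fun; exact: continuous_hk.
Qed.

Lemma L2_hk1 t : 0 < t -> L2 (hk1 t).
Proof.
move=> t0; have [C hC] := hk1_decay t t0.
apply: decay_L2 (hC t _); last by rewrite !lexx.
by apply: continuous_measurable_fun; exact: continuous_hk1.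
Qed.

Lemma L2_hk2 t : 0 < t -> L2 (hk2 t).
Proof.
move=> t0; have [C hC] := hk2_decay t t0.
apply: decay_L2 (hC t _); last by rewrite !lexx.
by apply: continuous_measurable_fun; exact: continuous_hk2.
Qed.

Lemma L2_hg t : 0 < t -> L2 (hg t).
Proof.
move=> t0; have [C hC] := hg_decay t0.
apply: decay_L2 hC.
by apply: continuous_measurable_fun; exact: continuous_hg.
Qed.

(** The kernels play two roles: states from which solutions are built, and test functions in the
    weak equation. The second role is what the uniqueness proof rests on. *)
Definition hkH2 t (t0 : 0 < t) : H2 R :=
  MkH2 (L2_hk t0) (L2_hk1 t0) (L2_hk2 t0)
    (fun a b ab => C1_AC ab (fun x => hk_derive x t0) (continuous_hk1 t0))
    (fun a b ab => C1_AC ab (fun x => hk1_derive x t0) (continuous_hk2 t0)).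

Lemma H2_AC (phi : H2 R) :
  (forall a b : R, a < b -> AC_derivative a b (H2_val phi) (H2_d1 phi)) *
  (forall a b : R, a < b -> AC_derivative a b (H2_d1 phi) (H2_d2 phi)).
Proof. by split; [exact: H2_val_deriv|exact: H2_d1_deriv]. Qed.

Lemma decay_bounded (C : R) f : decay C f -> forall x, `|f x| <= C.
Proof.
move=> fC x; apply: le_trans (fC x).
by rewrite ler_peMr// lerDl sqr_ge0.
Qed.

Lemma ip_smooth_parts f f' g g' (C M : R) : L2 f -> L2 f' -> L2 g -> L2 g' ->
  (forall x, is_derive x 1 f (f' x)) -> continuous f' ->
  decay C f -> decay M f' ->
  (forall a b : R, a < b -> AC_derivative a b g g') ->
  ip f g' = - ip f' g.
Proof.
move=> Lf Lf' Lg Lg' df cf' fC f'M gAC.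
rewrite (@ip_integration_by_parts _ f f f f' g g' C M)//.
- by rewrite subrr mul0r add0r.
- by move=> n n0; apply: C1_AC => //; rewrite oppr_lt0.
- by move=> n n0; apply: C1_AC.
- exact: decay_bounded.
Qed.

(** Two integrations by parts without jumps. Since [hk2] is the time derivative of the kernel, this
    is the weak heat equation for it. *)
Lemma ip_hk_d2 t (phi : H2 R) : 0 < t ->
  ip (hk t) (H2_d2 phi) = ip (hk2 t) (H2_val phi).
Proof.
move=> t0.
have [C0 hC0] := hk_decay t t0; have {}hC0 : decay C0 (hk t) by apply: hC0; rewrite !lexx.
have [C1 hC1] := hk1_decay t t0; have {}hC1 : decay C1 (hk1 t) by apply: hC1; rewrite !lexx.
have [C2 hC2] := hk2_decay t t0; have {}hC2 : decay C2 (hk2 t) by apply: hC2; rewrite !lexx.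
have L0 := L2_hk t0; have L1 := L2_hk1 t0; have L2' := L2_hk2 t0.
have [P0 P1 P2] := And3 (H2_val_L2 phi) (H2_d1_L2 phi) (H2_d2_L2 phi).
rewrite (ip_smooth_parts L0 L1 P1 P2 (fun x => hk_derive x t0) (continuous_hk1 t0) hC0 hC1 (H2_AC phi).2).
rewrite (ip_smooth_parts L1 L2' P0 P1 (fun x => hk1_derive x t0) (continuous_hk2 t0) hC1 hC2 (H2_AC phi).1).
by rewrite opprK.
Qed.

(** The complementary error function. It is written through the integral up to [z], the form to
    which the fundamental theorem of calculus applies; the total Gauss integral is sqrt(pi), so this
    equals 2/sqrt(pi) times the integral from [z] to infinity. *)
Definition erfc z : R :=
  2 - 2 / Num.sqrt pi * \int[mu]_(x in `]-oo, z]) gauss_fun x.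

Let sqrtpi_gt0 : 0 < Num.sqrt pi :> R.
Proof. by rewrite sqrtr_gt0 pi_gt0. Qed.

Lemma erfc_derive z : is_derive z 1 erfc (- (2 / Num.sqrt pi * gauss_fun z)).
Proof.
have [] := @continuous_FTC1 R gauss_fun -oo%O z (z + 1) _ _ _ _.
- by rewrite ltrDl.
- by apply: integrableS (@integrableT_gauss R).
- exact: ltNyr.
- exact: continuous_gauss_fun.
rewrite /erfc; set I := fun z : R => _ => dF; rewrite derive1E => F'.
have dI := DeriveDef dF F'.
apply: is_derive_eq; rewrite /GRing.scale/=; ring.
Qed.

Lemma Rintegral_gauss_itv (a b : R) : a <= b ->
  \int[mu]_(x in `]a, b[) gauss_fun x =
    \int[mu]_(x in `]-oo, b]) gauss_fun x - \int[mu]_(x in `]-oo, a]) gauss_fun x.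
Proof.
move=> ab.
have ig := @integrableT_gauss R.
have := @Rintegral_itvB R gauss_fun -oo%O (BRight b) a.
rewrite !bnd_simp => -> //; last by apply: integrableS ig.
by rewrite -Rintegral_itv_bndo_bndc//; apply: integrableS ig.
Qed.

Lemma erfc0 : erfc 0 = 1.
Proof.
suff h : \int[mu]_(x in `]-oo, 0]) gauss_fun x = Num.sqrt pi / 2 :> R.
  rewrite /erfc h; field; by rewrite gt_eqF.
have ig := @integrableT_gauss R.
have h1 : \int[mu]_x gauss_fun x = Num.sqrt pi :> R by rewrite /Rintegral integralT_gauss.
have h2 : \int[mu]_(x in `[0%R, +oo[) gauss_fun x = Num.sqrt pi / 2 :> R.
  by rewrite /Rintegral integral0y_gauss.
have := @Rintegral_itvB R gauss_fun -oo%O +oo%O 0.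
rewrite !bnd_simp => /(_ _ isT isT); rewrite set_itvNyy => /(_ ig).
rewrite Rintegral_itv_obnd_cbnd ?h1 ?h2; last by apply: integrableS ig.
lra.
Qed.

Lemma erfc_ge0 z : 0 <= erfc z.
Proof.
have ig := @integrableT_gauss R.
have h1 : \int[mu]_x gauss_fun x = Num.sqrt pi :> R by rewrite /Rintegral integralT_gauss.
have : \int[mu]_(x in `]-oo, z]) gauss_fun x <= Num.sqrt pi :> R.
  rewrite -h1 Rintegral_mkcond; apply: le_Rintegral => //.
    by apply: integrable_patch => //; apply: integrableS ig.
  move=> x _; rewrite patchE; case: ifPn => // _; exact: gauss_fun_ge0.
rewrite /erfc; set I := Rintegral _ _ _ => Ip.
by rewrite subr_ge0 mulrAC ler_pdivrMr// ler_wpM2l.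
Qed.

Lemma erfc_cvg0 : erfc n.+1%:R @[n --> \oo] --> 0.
Proof.
have ig := @integrableT_gauss R.
have h1 : \int[mu]_x gauss_fun x = Num.sqrt pi :> R by rewrite /Rintegral integralT_gauss.
have := cvg_Rintegral_itv_sym ig; rewrite h1 => h.
have lim : 2 - 2 / Num.sqrt pi * (\int[mu]_(x in `]- n.+1%:R, n.+1%:R[) gauss_fun x) @[n --> \oo] --> (0 : R).
  rewrite [X in _ --> X](_ : 0 = 2 - 2 / Num.sqrt pi * Num.sqrt pi); last first.
    by rewrite divfK ?subrr// gt_eqF.
  by apply: cvgB; [exact: cvg_cst|exact: cvgMr].
apply: (squeeze_cvgr _ (cvg_cst 0) lim).
apply: nearW => n; rewrite erfc_ge0/= Rintegral_gauss_itv; last by rewrite ge0_cp.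
rewrite /erfc lerD2l lerN2 ler_wpM2l ?divr_ge0 ?(ltW sqrtpi_gt0)// gerBl.
by apply: Rintegral_ge0 => x _; exact: gauss_fun_ge0.
Qed.

Lemma is_derive_eq_of f x (d d' : R) : d = d' -> is_derive x 1 f d -> is_derive x 1 f d'.
Proof. by move=> ->. Qed.

(** The difference [h] between the bound and [erfc] is nonincreasing on [0, oo[, and it is bounded
    below at n by -erfc n, which tends to 0. The exponent 2 is what both the weight 1 + x^2 and the
    linear estimate in time near t = 0 require. *)
Lemma erfc_decay : exists2 C : R, 0 <= C & forall z, 0 <= z -> erfc z <= C * (1 + z) ^- 2.
Proof.
(* 192 = 4 * 48: [gau_decay3] at t = b = 1/4 gives 6 * 2^3 * e = 48 e, and (1 + y)^3 <= 4 (1 +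
   y^2)^3 for y >= 0. *)
pose C : R := 192 * expR 1 / Num.sqrt pi.
have C0 : 0 <= C by rewrite divr_ge0 ?(ltW sqrtpi_gt0)// mulr_ge0// expR_ge0.
exists C => // z z0.
pose h y : R := C * (1 + y) ^- 2 - erfc y.
pose h' y : R := 2 / Num.sqrt pi * gauss_fun y - 2 * C * (1 + y) ^- 3.
have dh (y : R) : 0 <= y -> is_derive y 1 h (h' y).
  move=> y0; have y1 : 1 + y != 0 by rewrite gt_eqF// ltr_wpDr.
  have de := erfc_derive y.
  have d1 : is_derive y 1 (fun y : R => (1 + y) ^- 2) (- (2 * (1 + y) ^- 3)).
    have d2 : is_derive y 1 (fun y : R => (1 + y) ^+ 2) (2 * (1 + y)).
      by apply: is_derive_eq; rewrite /GRing.scale/=; ring.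
    have y2 : (1 + y) ^+ 2 != 0 by rewrite expf_eq0.
    have := @is_deriveV R (fun y => (1 + y) ^+ 2) y _ 1 y2 d2; apply: is_derive_eq_of.
    by rewrite /GRing.scale/=; field.
  have := is_deriveB (is_deriveZ C d1) de; apply: is_derive_eq_of.
  by rewrite /h' /GRing.scale/=; field; rewrite y1 gt_eqF.
have h'0 (y : R) : 0 <= y -> h' y <= 0.
  move=> y0.
  have y1 : 0 < 1 + y by rewrite ltr_wpDr.
  rewrite /h' subr_le0 ler_pdivlMr ?exprn_gt0//.
  rewrite /C -!mulrA ler_wpM2l// [leRHS]mulrA [192 * _ * _]mulrC ler_wpM2l ?invr_ge0 ?(ltW sqrtpi_gt0)//.
  have q0 : 0 < 4^-1 :> R by rewrite invr_gt0.
  have := @gau_decay3 4^-1 4^-1 y q0 (lexx _).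
  rewrite /gau divff// divr1 -/(gauss_fun y).
  set g := gauss_fun y; set e := expR 1.
  have g0 : 0 <= g by exact: gauss_fun_ge0.
  have : (1 + y) ^+ 3 <= 4 * (1 + y ^+ 2) ^+ 3 by nra.
  move=> k1 k2.
  apply: (@le_trans _ _ (g * (4 * (1 + y ^+ 2) ^+ 3))); first by rewrite ler_wpM2l.
  lra.
have key n : z < n.+1%:R -> erfc z <= C * (1 + z) ^- 2 + erfc n.+1%:R.
  move=> zn.
  have [||c] := @MVT R h h' _ _ zn.
  - by move=> y; rewrite in_itv/= => /andP[zy _]; apply: dh; exact: le_trans (ltW zy).
  - apply: derivable_within_continuous => y; rewrite in_itv/= => /andP[zy _].
    by have := dh y (le_trans z0 zy) => -[].
  rewrite in_itv/= => /andP[zc _] hE.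
  have : h n.+1%:R - h z <= 0.
    rewrite hE mulr_le0_ge0 ?subr_ge0 ?(ltW zn)// h'0//.
    exact: le_trans (ltW zc).
  rewrite /h => h1.
  have : 0 <= C * (1 + n.+1%:R) ^- 2 by rewrite mulr_ge0// invr_ge0 exprn_ge0.
  lra.
have lim : C * (1 + z) ^- 2 + erfc n.+1%:R @[n --> \oo] --> C * (1 + z) ^- 2.
  by rewrite -[X in _ --> X]addr0; apply: cvgD; [exact: cvg_cst|exact: erfc_cvg0].
apply: (cvgr_to_ge lim).
exists (Num.trunc z) => // n /= hn; apply: key.
by apply: lt_le_trans (truncnS_gt _) _; rewrite ler_nat.
Qed.

(* The state reached from 0 at time t under the control u = 1. *)
Definition hE t x : R :=
  if 0 < t then Num.sg x * erfc (`|x| / (2 * Num.sqrt t)) else 0.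

Lemma hE_derive_time t x : 0 < t -> is_derive t 1 (hE ^~ x) (hk t x).
Proof.
move=> t0.
have t0' : t != 0 by rewrite gt_eqF.
have st0 : Num.sqrt t != 0 by rewrite gt_eqF// sqrtr_gt0.
have st2 : Num.sqrt t ^+ 2 = t by rewrite sqr_sqrtr// ltW.
apply: (@near_eq_is_derive _ _ _ (fun t => Num.sg x * erfc (`|x| / (2 * Num.sqrt t)))).
  by near=> s; rewrite /hE ifT//; near: s; exact: lt_nbhsr.
have dsq := is_derive1_sqrt t0.
have s2 : 2 * Num.sqrt t != 0 by rewrite mulf_neq0.
pose z := `|x| / (2 * Num.sqrt t).
have dz : is_derive t 1 (fun t => `|x| / (2 * Num.sqrt t)) (- (`|x| / (4 * t * Num.sqrt t))).
  apply: is_derive_eq; rewrite /GRing.scale/=.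
  move: (Num.sqrt t) st0 st2 => q q0 <-; field; exact: q0.
have := @is_derive1_comp R erfc (fun t => `|x| / (2 * Num.sqrt t)) t _ _ (erfc_derive z) dz.
move=> /(is_deriveZ (Num.sg x)); apply: is_derive_eq_of.
rewrite /hk /gau /gauss_fun /GRing.scale/= /hc /hs /z.
rewrite expr_div_n exprMn st2 real_normK ?num_real//.
rewrite (_ : 2 ^+ 2 = 4) ?expr2 -?natrM//.
set E := expR _.
rewrite [RHS](_ : _ = (2 * Num.sqrt pi)^-1 / (t * Num.sqrt t) * (Num.sg x * `|x| * E)); last by rewrite -numEsg.
field.
by rewrite st0 t0' gt_eqF.
Unshelve. all: by end_near. Qed.

Lemma measurable_hE t : measurable_fun setT (hE t).
Proof.
rewrite /hE; case: (0 < t); last exact: measurable_cst.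
apply: measurable_funM.
  apply: nondecreasing_measurable => // x y xy.
  by case: (sgrP x) => hx; case: (sgrP y) => hy //; lra.
have merfc : measurable_fun setT erfc.
  by apply: continuous_measurable_fun; exact: continuous_is_derive erfc_derive.
apply: (measurableT_comp merfc).
by apply: measurable_funM => //; exact: measurableT_comp.
Qed.

Lemma hE_odd t x : hE t (- x) = - hE t x.
Proof. by rewrite /hE; case: ifP; rewrite ?oppr0// sgrN normrN mulNr. Qed.

Lemma hE_norm t x : 0 < t -> `|hE t x| <= erfc (`|x| / (2 * Num.sqrt t)).
Proof.
move=> t0; rewrite /hE t0 normrM [`|erfc _|]ger0_norm ?erfc_ge0//.
by rewrite ler_piMl ?erfc_ge0// normr_sg; case: eqP => _.
Qed.

(** With z = |x|/(2 sqrt t), the bound C z^-2 on [erfc] is 4 C t / x^2. This yields pointwise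
    continuity in time at t = 0. At x = 0 the state vanishes through the sign factor, and the
    constant, an inverse of zero, is 0. *)
Lemma hE_near0 x : exists2 C : R, 0 <= C & forall t, `|hE t x| <= C * `|t|.
Proof.
have [C C0 hC] := erfc_decay.
exists (C * 4 * x ^- 2); first by rewrite !mulr_ge0// invr_ge0 sqr_ge0.
move=> t; have [t0|t0] := ltP 0 t; last first.
  by rewrite /hE ltNge t0 normr0 !mulr_ge0// ?invr_ge0 ?sqr_ge0.
have [->|x0] := eqVneq x 0.
  by rewrite /hE t0 sgr0 mul0r normr0 !mulr_ge0// ?invr_ge0 ?sqr_ge0.
apply: le_trans (hE_norm x t0) _.
have st0 : 0 < Num.sqrt t by rewrite sqrtr_gt0.
have st2 : Num.sqrt t ^+ 2 = t by rewrite sqr_sqrtr// ltW.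
pose z := `|x| / (2 * Num.sqrt t).
have z0 : 0 < z by rewrite divr_gt0 ?normr_gt0// mulr_gt0.
apply: le_trans (hC _ (ltW z0)) _.
apply: (@le_trans _ _ (C * z ^- 2)).
  rewrite ler_wpM2l// lef_pV2 ?posrE ?exprn_gt0 ?addr_gt0//.
  by rewrite lerXn2r ?nnegrE ?(ltW z0) ?lerDr// addr_ge0// ltW.
rewrite /z expr_div_n exprMn st2 real_normK ?num_real// invf_div.
rewrite -!mulrA ler_wpM2l// ger0_norm ?(ltW t0)//.
by rewrite le_eqVlt; apply/orP; left; apply/eqP; ring.
Qed.

(** Since x^2 = 4 t z^2 with z = |x|/(2 sqrt t), the ratio (1 + x^2)/(1 + z)^2 is at most 1 + 4b.
    Unlike for the kernels, the constant is uniform down to t = 0 and below, so these states stay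
    dominated as t tends to 0. *)
Lemma hE_decay b : 0 < b -> exists C : R, forall t, t <= b -> decay C (hE t).
Proof.
move=> b0; have [C C0 hC] := erfc_decay.
exists (C * (1 + 4 * b)) => t tb x.
have [t0|t0] := ltP 0 t; last first.
  rewrite /hE ltNge t0 normr0 mul0r mulr_ge0// addr_ge0// mulr_ge0// ltW//.
apply: (@le_trans _ _ (C * (1 + (`|x| / (2 * Num.sqrt t))) ^- 2 * (1 + x ^+ 2))).
  rewrite ler_wpM2r ?(ltW (oneDsqr_gt0 _))//; apply: le_trans (hE_norm x t0) _.
  by apply: hC; rewrite divr_ge0// mulr_ge0// sqrtr_ge0.
rewrite -mulrA ler_wpM2l//.
have st0 : 0 < Num.sqrt t by rewrite sqrtr_gt0.
have st2 : Num.sqrt t ^+ 2 = t by rewrite sqr_sqrtr// ltW.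
set z := `|x| / _.
have z0 : 0 <= z by rewrite divr_ge0// mulr_ge0// ltW.
have -> : x ^+ 2 = 4 * t * z ^+ 2.
  rewrite -[x ^+ 2]real_normK ?num_real// /z expr_div_n exprMn st2; field.
  by rewrite gt_eqF.
rewrite mulrC ler_pdivrMr ?exprn_gt0 ?ltr_wpDr//.
have := mulr_ge0 (ltW b0) z0; have := sqr_ge0 z.
have : t * z ^+ 2 <= b * z ^+ 2 by rewrite ler_wpM2r ?sqr_ge0.
have := mulr_ge0 (ltW b0) (sqr_ge0 z).
nra.
Qed.

Lemma L2_hE t : L2 (hE t).
Proof.
have [|C hC] := @hE_decay (`|t| + 1); first by rewrite ltr_wpDl.
apply: decay_L2 (measurable_hE t) (hC t _).
by rewrite (le_trans (ler_norm _))// lerDl.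
Qed.

Lemma hE_continuous_time x : continuous (hE ^~ x).
Proof.
move=> t; have [t0|t0|->] := ltgtP t 0.
- have E : hE t x = 0 by rewrite /hE ltNge ltW.
  rewrite /continuous_at E; apply: cvg_near_cst; near=> s; rewrite /hE ltNge ltW//.
  by near: s; exact: lt_nbhsl.
- apply: differentiable_continuous; apply/derivable1_diffP.
  by have [] := hE_derive_time x t0.
- have [C C0 hC] := hE_near0 x.
  have E : hE 0 x = 0 by rewrite /hE ltxx.
  rewrite /continuous_at E; apply: norm_cvg0.
  apply: (@squeeze_cvgr _ _ _ _ (fun=> 0) (fun s => C * `|s|)).
  + by near=> s; rewrite normr_ge0 hC.
  + exact: cvg_cst.
  + rewrite -[X in _ --> X](mulr0 C); apply: cvgMr.
    by rewrite -[X in _ --> X](normr0 R); apply: cvg_norm.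
Unshelve. all: by end_near. Qed.

Lemma ipNl f g : L2 f -> L2 g -> ip (fun x => - f x) g = - ip f g.
Proof.
move=> Lf Lg; rewrite -mulN1r -ipZl//; congr (ip _ _).
by apply/funext => x; rewrite mulN1r.
Qed.

(* The jump of hE t at 0 produces the source term 2 phi'(0). *)
Lemma ip_hE_d2 t (phi : H2 R) : 0 < t ->
  ip (hE t) (H2_d2 phi) + 2 * H2_d1 phi 0 = ip (hk t) (H2_val phi).
Proof.
move=> t0.
have [P0 P1 P2] := And3 (H2_val_L2 phi) (H2_d1_L2 phi) (H2_d2_L2 phi).
have [C hC] := hE_decay t0; have {}hC := hC t (lexx t).
have [D hD] := hg_decay t0.
have [K hK] := hk_decay t t0; have {}hK : decay K (hk t) by apply: hK; rewrite lexx.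
have t0' : t != 0 by rewrite gt_eqF.
have st0 : Num.sqrt t != 0 by rewrite gt_eqF// sqrtr_gt0.
have st2 : Num.sqrt t ^+ 2 = t by rewrite sqr_sqrtr// ltW.
pose q := 2 * Num.sqrt t.
(* The two one-sided branches of [hE t], each smooth on the whole line, with common derivative
   [- hg t]. Their values at 0 are 1 and -1, so the jump term is -2 phi'(0) and cancels the
   source. *)
pose fp x := erfc (x / q); pose fm x := - erfc (- x / q).
have q0 : q != 0 by rewrite mulf_neq0.
have dlin (a x : R) : is_derive x 1 (fun x : R => x * a) a.
  by apply: is_derive_eq; rewrite /GRing.scale/=; ring.
have gE x : gauss_fun (x / q) = gau t x.
  by rewrite /gauss_fun /gau expr_div_n exprMn st2 -natrX.
have qE : 2 / Num.sqrt pi / q = (Num.sqrt pi * Num.sqrt t)^-1.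
  by rewrite /q; field; rewrite st0 gt_eqF.
have dfp x : is_derive x 1 fp (- hg t x).
  have := @is_derive1_comp R erfc (fun x => x * q^-1) x _ _ (erfc_derive _) (dlin q^-1 x).
  by apply: is_derive_eq_of; rewrite gE /hg -qE; ring.
have dfm x : is_derive x 1 fm (- hg t x).
  have dl : is_derive x 1 (fun x : R => - x / q) (- q^-1).
    by apply: is_derive_eq; rewrite /GRing.scale/=; ring.
  have := @is_derive1_comp R erfc (fun x => - x / q) x _ _ (erfc_derive _) dl.
  move=> /is_deriveN; apply: is_derive_eq_of.
  have -> : gauss_fun (- x / q) = gau t x by rewrite -gE /gauss_fun mulNr sqrrN.
  by rewrite /hg -qE; ring.
have cg : continuous (fun x => - hg t x).
  by move=> x; apply: cvgN; exact: continuous_hg.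
have LNg : L2 (fun x => - hg t x) by apply: L2N; exact: L2_hg.
rewrite (@ip_integration_by_parts R (hE t) fm fp (fun x => - hg t x) (H2_d1 phi) (H2_d2 phi) C D)//.
- rewrite /fm /fp oppr0 !mul0r erfc0 ipNl//; last exact: L2_hg.
  have LNk : L2 (fun x => - hk t x) by apply: L2N; exact: L2_hk.
  have dg x : is_derive x 1 (hg t) (- hk t x) by exact: hg_derive.
  have cNk : continuous (fun x => - hk t x).
    by move=> x; apply: cvgN; exact: continuous_hk.
  have dNk : decay K (fun x => - hk t x) by move=> x; rewrite normrN.
  rewrite (ip_smooth_parts (L2_hg t0) LNk P0 P1 dg cNk hD dNk (H2_AC phi).1).
  by rewrite ipNl//; [ring|exact: L2_hk].
- exact: L2_hE.
- by move=> x x0; rewrite /hE t0 /fm ltr0_sg// ltr0_norm// mulN1r.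
- by move=> x x0; rewrite /hE t0 /fp gtr0_sg// gtr0_norm// mul1r.
- by move=> n n0; apply: C1_AC => //; rewrite oppr_lt0.
- by move=> n n0; apply: C1_AC.
- by move=> x; rewrite normrN; exact: (decay_bounded hD).
- exact: (H2_AC phi).2.
Qed.

End heat_kernels.

(** * Solution curves *)

Section curves.
Context {R : realType}.
Local Notation mu := (@lebesgue_measure R).
Implicit Types (f g : R -> R) (W : R -> R -> R) (s t x : R).

(** Curves are taken over all real times, which avoids one-sided limits at 0; the concrete curves
    below are extended to negative times accordingly. *)
Definition L2_continuous W := forall t, nrm (W s \- W t) @[s --> t] --> 0.

Lemma decay_oneDsqrV (C : R) f x : decay C f -> `|f x| <= C * (1 + x ^+ 2)^-1.
Proof. by move=> /(_ x) h; rewrite ler_pdivlMr// oneDsqr_gt0. Qed.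

Lemma L2_oneDsqrV (C : R) : L2 (fun x => C * (1 + x ^+ 2)^-1).
Proof.
apply: (@decay_L2 _ `|C|).
  apply: measurable_funM => //; apply: continuous_measurable_fun => x.
  exact: continuous_oneDsqrV.
move=> x; rewrite normrM [`|_^-1|]ger0_norm ?invr_ge0 ?(ltW (oneDsqr_gt0 _))//.
by rewrite -mulrA mulVf ?mulr1// gt_eqF// oneDsqr_gt0.
Qed.

(** Dominated convergence for the square of the difference, with dominating function
    (2C/(1+x^2))^2. *)
Lemma decay_cvg_nrm W (a b C t : R) : a < t < b ->
  (forall s, a < s < b -> measurable_fun setT (W s)) ->
  (forall s, a < s < b -> decay C (W s)) ->
  (forall s x, a < s < b -> {for s, continuous (W ^~ x)}) ->
  nrm (W s \- W t) @[s --> t] --> 0.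
Proof.
move=> atb mW dW cW.
have LW s : a < s < b -> L2 (W s) by move=> sab; exact: decay_L2 (mW s sab) (dW s sab).
pose f s x := (W s x - W t x) * (W s x - W t x).
pose G x : R := (2 * C * (1 + x ^+ 2)^-1) * (2 * C * (1 + x ^+ 2)^-1).
have h := @continuity_under_integral R _ _ mu f setT measurableT a b _ _ G _ _.
have tI : t \in `]a, b[%classic by rewrite inE/= in_itv/=.
have := h _ _ _ _ t tI; rewrite /continuous_at.
move=> H; have {H} : ip (W s \- W t) (W s \- W t) @[s --> t] --> (0 : R).
  have : \int[mu]_x f t x = 0.
    by rewrite /f; under eq_Rintegral do rewrite subrr mul0r; rewrite Rintegral_cst// mul0r.
  move=> E; rewrite E in H; apply: H.
  - move=> s; rewrite /= in_itv/= => sab.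
    by apply: ip_integrable; apply: L2B; exact: LW.
  - apply: aeW => x _ s; rewrite inE/= in_itv/= => sab.
    have c : W s x - W t x @[s --> s] --> W s x - W t x.
      by apply: cvgB; [exact: cW|exact: cvg_cst].
    exact: cvgM.
  - by apply: ip_integrable; exact: L2_oneDsqrV.
  - move=> s; rewrite /= in_itv/= => sab; apply: aeW => x _.
    have hx : `|W s x - W t x| <= 2 * C * (1 + x ^+ 2)^-1.
      apply: le_trans (ler_normB _ _) _.
      have := decay_oneDsqrV x (dW s sab); have := decay_oneDsqrV x (dW t atb); lra.
    by rewrite /f /G normrM ler_pM.
move=> H.
have : Num.sqrt (ip (W s \- W t) (W s \- W t)) @[s --> t] --> Num.sqrt (0 : R).
  by apply: continuous_cvg => //; exact: sqrt_continuous.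
by rewrite sqrtr0.
Qed.

(** Differentiation under the integral; the time derivative is dominated by C |f|/(1+x^2),
    integrable as a product of two L^2 functions. *)
Lemma decay_ip_derive W W' f (a b C t : R) : a < t < b -> L2 f ->
  (forall s, a < s < b -> L2 (W s)) ->
  (forall s x, a < s < b -> is_derive s 1 (W ^~ x) (W' s x)) ->
  (forall s, a < s < b -> decay C (W' s)) ->
  is_derive t 1 (fun s => ip (W s) f) (ip (W' t) f).
Proof.
move=> atb Lf LW dW dW'.
have C0 : 0 <= C.
  apply: le_trans (dW' t atb 0); rewrite mulr_ge0// ltW//; exact: oneDsqr_gt0.
pose F s x := W s x * f x.
pose G x : R := C * (1 + x ^+ 2)^-1 * `|f x|.
have Lnf : L2 (fun x => `|f x|).
  apply: (L2_le _ Lf); last by move=> x; rewrite normr_id.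
  by apply: measurableT_comp => //; exact: L2_measurable Lf.
have dF s x : a < s < b -> is_derive s 1 (F ^~ x) (W' s x * f x).
  move=> sab; have d := dW s x sab.
  have := is_deriveZ (f x) d.
  rewrite /F (_ : (fun s => W s x * f x) = f x \*: (W ^~ x)); last first.
    by apply/funext => r; rewrite /= mulrC.
  by rewrite [f x *: _]mulrC.
have dE s x : a < s < b -> partial1of2 F s x = W' s x * f x.
  by move=> sab; rewrite partial1of2E; have [] := dF s x sab.
have G0 x : 0 <= G x.
  by rewrite /G !mulr_ge0// invr_ge0 ltW// oneDsqr_gt0.
have iG : mu.-integrable setT (EFin \o G) by apply: ip_integrable => //; exact: L2_oneDsqrV.
have h := @cvg_differentiation_under_integral R _ _ mu F setT measurableT t a b.
have lim : h^-1 *: ((\int[mu]_y F (h *: 1 + t) y) - \int[mu]_y F t y) @[h --> 0^'] --> ip (W' t) f.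
  rewrite (_ : ip (W' t) f = \int[mu]_y (partial1of2 F) t y); last first.
    by apply: eq_Rintegral => x _; rewrite dE.
  under eq_fun do rewrite [_ *: 1]mulr1.
  apply: (h _ _ _ G).
  - by rewrite /= in_itv.
  - by move=> s; rewrite /= in_itv/= => sab; apply: ip_integrable => //; exact: LW.
  - by move=> s x; rewrite /= in_itv/= => sab _; have [] := dF s x sab.
  - exact: G0.
  - exact: iG.
  - move=> s x; rewrite /= in_itv/= => sab _; rewrite dE// normrM /G ler_wpM2r//.
    exact: decay_oneDsqrV (dW' s sab).
by split; [apply/cvg_ex; exists (ip (W' t) f); exact: lim|exact: cvg_lim lim].
Qed.

Lemma L2_continuous_ip W f : L2_continuous W -> (forall t, L2 (W t)) -> L2 f ->
  continuous (fun t => ip (W t) f).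
Proof.
move=> cW LW Lf t.
apply: cvg_zero.
apply: norm_cvg0.
apply: (@squeeze_cvgr _ _ _ _ (fun=> 0) (fun s => nrm (W s \- W t) * nrm f)).
- near=> s; rewrite normr_ge0/=.
  have -> : ((fun s => ip (W s) f) - cst (ip (W t) f)) s = ip (W s \- W t) f by rewrite ipBl.
  by apply: CS => //; exact: L2B.
- exact: cvg_cst.
- rewrite -[X in _ --> X](mul0r (nrm f)); apply: cvgMl; exact: cW.
Unshelve. all: by end_near. Qed.

(** A stricter notion than [is_solution]: curves on all of R and oddness at every point, with the
    equation imposed from time 0 on. The sign of the source is reversed because [delta'] pairs with
    phi to -phi'(0). *)
Definition heat_sol (u : R -> R) W :=
  [/\ forall t, L2 (W t), forall t x, W t (- x) = - W t x, L2_continuous W &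
    forall (phi : H2 R) s t, 0 <= s -> s < t ->
      ip (W t) (H2_val phi) - ip (W s) (H2_val phi) =
      \int[mu]_(r in `]s, t[) (ip (W r) (H2_d2 phi) + 2 * u r * H2_d1 phi 0)].

Definition bounded_control (u : R -> R) :=
  measurable_fun setT u /\ exists M, forall t, `|u t| <= M.

Lemma heat_sol_rhs_integrable u W (phi : H2 R) s t : bounded_control u ->
  heat_sol u W ->
  mu.-integrable `]s, t[ (EFin \o (fun r => ip (W r) (H2_d2 phi))) /\
  mu.-integrable `]s, t[ (EFin \o (fun r => 2 * u r * H2_d1 phi 0)).
Proof.
move=> [mu' [M uM]] [LW oW cW _]; split.
  have h : continuous (fun r => ip (W r) (H2_d2 phi)).
    by apply: L2_continuous_ip => //; exact: H2_d2_L2.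
  have : mu.-integrable `[s, t] (EFin \o (fun r => ip (W r) (H2_d2 phi))).
    apply: continuous_compact_integrable => //; first exact: segment_compact.
    exact: continuous_subspaceT.
  by apply: integrableS => //; exact: subset_itv_oo_cc.
apply: (@bounded_integrable_itv _ _ _ _ (2 * M * `|H2_d1 phi 0|)).
  apply: measurable_funTS; apply: measurable_funM => //.
  by apply: measurable_funM.
by move=> r _; rewrite !normrM ler_wpM2r// ger0_norm// ler_wpM2l.
Qed.

Lemma heat_sol_lin c u1 u2 W1 W2 : bounded_control u1 -> bounded_control u2 ->
  heat_sol u1 W1 -> heat_sol u2 W2 ->
  heat_sol (fun t => u1 t + c * u2 t) (fun t => W1 t \+ (fun x => c * W2 t x)).
Proof.
move=> b1 b2 s1 s2; have [L1 o1 c1 e1] := s1; have [L2' o2 c2 e2] := s2.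
split.
- by move=> t; apply: L2D => //; exact: L2Z.
- by move=> t x /=; rewrite o1 o2; ring.
- move=> t.
  apply: (@squeeze_cvgr _ _ _ _ (fun=> 0) (fun s => nrm (W1 s \- W1 t) + `|c| * nrm (W2 s \- W2 t))).
  + near=> s; rewrite nrm_ge0/= -nrmZ; last exact: L2B.
    apply: le_trans (nrmD _ _); [|exact: L2B|by apply: L2Z; exact: L2B].
    rewrite le_eqVlt; apply/orP; left; apply/eqP; congr nrm; apply/funext => x /=; ring.
  + exact: cvg_cst.
  + rewrite -[X in _ --> X](addr0 0); apply: cvgD; first exact: c1.
    rewrite -[X in _ --> X](mulr0 `|c|); apply: cvgMr; exact: c2.
- move=> phi s t s0 st.
  have P0 := H2_val_L2 phi; have P2 := H2_d2_L2 phi.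
  rewrite !ipDl ?ipZl//; try exact: L2Z.
  have [i1 j1] := heat_sol_rhs_integrable phi s t b1 s1.
  have [i2 j2] := heat_sol_rhs_integrable phi s t b2 s2.
  have k1 := integrableD_EFin (measurable_itv _) i1 j1.
  have k2 := integrableD_EFin (measurable_itv _) i2 j2.
  rewrite (_ : _ - _ = (ip (W1 t) (H2_val phi) - ip (W1 s) (H2_val phi)) +
     c * (ip (W2 t) (H2_val phi) - ip (W2 s) (H2_val phi))); last by ring.
  rewrite e1// e2// -RintegralZl// -RintegralD//; last exact: integrableZ_EFin.
  apply: eq_Rintegral => r _; rewrite ipDl ?ipZl//; last exact: L2Z.
  ring.
Unshelve. all: by end_near. Qed.

(** In the weak equation every derivative falls on the test function, so it survives limits that are
    uniform in time in L^2. *)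
Lemma heat_sol_limit u (Wn : nat -> R -> R -> R) W (e : nat -> R) :
  bounded_control u -> (forall n, heat_sol u (Wn n)) ->
  (forall t, L2 (W t)) -> (forall t x, W t (- x) = - W t x) ->
  (forall n t, nrm (Wn n t \- W t) <= e n) -> e n @[n --> \oo] --> 0 ->
  heat_sol u W.
Proof.
move=> bu sol LW oW We e0.
have Ln n t : L2 (Wn n t) by have [] := sol n.
have cW : L2_continuous W.
  move=> t; apply/cvgrPdist_le => d d0.
  have d3 : 0 < d / 3 by rewrite divr_gt0.
  have /cvgrPdist_le/(_ _ d3)[N _ /(_ N (leqnn _))/=] := e0.
  rewrite sub0r normrN => eN.
  have [_ _ cN _] := sol N.
  have /cvgrPdist_le/(_ _ d3) := cN t; apply: filterS => s.
  rewrite !sub0r !normrN !ger0_norm ?nrm_ge0// => h.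
  apply: le_trans (nrm_triangle (LW s) (Ln N s) (LW t)) _.
  have := nrm_triangle (Ln N s) (Ln N t) (LW t).
  have := We N s; have := We N t; have := ler_norm (e N); rewrite [nrm (W s \- _)]nrmC; lra.
split=> // phi s t s0 st.
have P0 := H2_val_L2 phi; have P2 := H2_d2_L2 phi.
have cd2 : continuous (fun r => ip (W r) (H2_d2 phi)) by exact: L2_continuous_ip.
have i1 : mu.-integrable `]s, t[ (EFin \o (fun r => ip (W r) (H2_d2 phi))).
  have : mu.-integrable `[s, t] (EFin \o (fun r => ip (W r) (H2_d2 phi))).
    apply: continuous_compact_integrable => //; first exact: segment_compact.
    exact: continuous_subspaceT.
  by apply: integrableS => //; exact: subset_itv_oo_cc.
have [_ i2] := heat_sol_rhs_integrable phi s t bu (sol 0%N).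
set lhs := LHS; set rhs := RHS.
(* Two end-point terms, each at most [e n] times the norm of phi, and an integral over length t - s
   against phi''. *)
pose K := 2 * nrm (H2_val phi) + (t - s) * nrm (H2_d2 phi).
have K0 : 0 <= K by rewrite addr_ge0// ?mulr_ge0// ?nrm_ge0// subr_ge0 ltW.
have key n : `|lhs - rhs| <= K * e n.
  have [_ _ _ eqn] := sol n.
  have [in1 _] := heat_sol_rhs_integrable phi s t bu (sol n).
  have cn : `|ip (Wn n t) (H2_val phi) - ip (W t) (H2_val phi)| <= e n * nrm (H2_val phi).
    rewrite -ipBl//; apply: le_trans (CS _ P0) _; first exact: L2B.
    by rewrite ler_wpM2r ?nrm_ge0.
  have cs : `|ip (Wn n s) (H2_val phi) - ip (W s) (H2_val phi)| <= e n * nrm (H2_val phi).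
    rewrite -ipBl//; apply: le_trans (CS _ P0) _; first exact: L2B.
    by rewrite ler_wpM2r ?nrm_ge0.
  have id : mu.-integrable `]s, t[ (EFin \o (fun r => ip (Wn n r) (H2_d2 phi) - ip (W r) (H2_d2 phi))).
    exact: integrableB_EFin.
  have cr : `|(\int[mu]_(r in `]s, t[) (ip (Wn n r) (H2_d2 phi) + 2 * u r * H2_d1 phi 0)) - rhs| <=
      e n * nrm (H2_d2 phi) * (t - s).
    rewrite /rhs !RintegralD// opprD addrACA subrr addr0 -RintegralB//.
    apply: le_trans (le_normr_Rintegral _ id) _ => //.
    rewrite -Rintegral_cst_itv ?(ltW st)//; apply: le_Rintegral => //.
    - exact: integrable_norm.
    - exact: cst_integrable_itv.
    move=> r _; rewrite -ipBl//; apply: le_trans (CS _ P2) _; first exact: L2B.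
    by rewrite ler_wpM2r ?nrm_ge0.
  move: cn cs cr; rewrite -eqn// /lhs !ler_norml => /andP[? ?] /andP[? ?] /andP[? ?].
  rewrite /K; apply/andP; split; lra.
have lim : K * e n @[n --> \oo] --> (0 : R).
  by rewrite -[X in _ --> X](mulr0 K); apply: cvgMr.
have : `|lhs - rhs| <= 0.
  by apply: (cvgr_to_ge lim); apply: nearW => n; exact: key.
by rewrite normr_le0 subr_eq0 => /eqP.
Qed.

Lemma FTC_itv (F f : R -> R) (s t : R) : s < t ->
  (forall r, s < r < t -> is_derive r 1 F (f r)) -> continuous F -> continuous f ->
  F t - F s = \int[mu]_(r in `]s, t[) f r.
Proof.
move=> st dF cF cf.
have ccf : {within `[s, t], continuous f} by exact: continuous_subspaceT.
have dfLR : derivable_oo_LRcontinuous F s t.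
  split.
  - by move=> z; rewrite in_itv/= => /dF[].
  - by apply: cvg_at_right_filter; exact: cF.
  - by apply: cvg_at_left_filter; exact: cF.
have f'E : {in `]s, t[, (F^`())%classic =1 f}.
  by move=> z; rewrite in_itv/= => /dF[? ?]; rewrite derive1E.
have h := continuous_FTC2 st ccf dfLR f'E.
rewrite integral_itv_bndoo in h; last first.
  by apply/measurable_EFinP; apply: measurable_funTS; exact: continuous_measurable_fun.
by rewrite /Rintegral h.
Qed.

Lemma hk_odd t x : hk t (- x) = - hk t x.
Proof. by rewrite /hk /gau sqrrN; ring. Qed.

Lemma hk_continuous_time t : 0 < t -> nrm (hk s \- hk t) @[s --> t] --> (0 : R).
Proof.
move=> t0.
have [C hC] := @hk_decay R (t / 2) (2 * t) (divr_gt0 t0 (ltr0Sn R 1)).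
have pos s : t / 2 < s < 2 * t -> 0 < s by lra.
apply: (@decay_cvg_nrm (@hk R) (t / 2) (2 * t) C).
- lra.
- by move=> s /pos s0; apply: continuous_measurable_fun; exact: continuous_hk.
- by move=> s /andP[? ?]; apply: hC; rewrite !ltW.
- move=> s x /pos s0; apply: differentiable_continuous; apply/derivable1_diffP.
  by have [] := hk_derive_time x s0.
Qed.

Lemma hk_ip_derive t f : 0 < t -> L2 f ->
  is_derive t 1 (fun s => ip (hk s) f) (ip (hk2 t) f).
Proof.
move=> t0 Lf.
have [C hC] := @hk2_decay R (t / 2) (2 * t) (divr_gt0 t0 (ltr0Sn R 1)).
have pos s : t / 2 < s < 2 * t -> 0 < s by lra.
apply: (@decay_ip_derive (@hk R) (@hk2 R) f (t / 2) (2 * t) C) => //.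
- lra.
- by move=> s /pos; exact: L2_hk.
- by move=> s x /pos; exact: hk_derive_time.
- by move=> s /andP[? ?]; apply: hC; rewrite !ltW.
Qed.

Lemma hE_ip_derive t f : 0 < t -> L2 f ->
  is_derive t 1 (fun s => ip (hE s) f) (ip (hk t) f).
Proof.
move=> t0 Lf.
have [C hC] := @hk_decay R (t / 2) (2 * t) (divr_gt0 t0 (ltr0Sn R 1)).
have pos s : t / 2 < s < 2 * t -> 0 < s by lra.
apply: (@decay_ip_derive (@hE R) (@hk R) f (t / 2) (2 * t) C) => //.
- lra.
- by move=> s _; exact: L2_hE.
- by move=> s x /pos; exact: hE_derive_time.
- by move=> s /andP[? ?]; apply: hC; rewrite !ltW.
Qed.

Lemma is_derive_shift (F : R -> R) (c d t : R) :
  is_derive (c + t) 1 F d -> is_derive t 1 (fun s => F (c + s)) d.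
Proof.
move=> dF.
have ds : is_derive t 1 (fun s : R => c + s) 1.
  have := @is_deriveD R _ _ (cst c) id t 1 0 1 _ _; rewrite add0r; apply.
by have := @is_derive1_comp R F (fun s => c + s) t _ _ dF ds; rewrite mulr1.
Qed.

Lemma continuous_shift_max (c : R) : continuous (fun t : R => c + Num.max t 0).
Proof.
move=> t; apply: cvgD; first exact: cvg_cst.
by apply: (@continuous_max _ _ (fun x : R => x) (fun=> 0)) => //; exact: cvg_cst.
Qed.

(** The free evolution of a kernel only increases its age. Freezing the curve for negative times by
    [Num.max t 0] keeps the age positive and the curve continuous on R. *)
Lemma heat_sol_hk tau : 0 < tau ->
  heat_sol (fun=> 0) (fun t => hk (tau + Num.max t 0)).
Proof.
move=> tau0.
have pos t : 0 < tau + Num.max t 0 by rewrite ltr_pwDl// le_max lexx orbT.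
have LW t : L2 (hk (tau + Num.max t 0)) by exact: L2_hk.
have cW : L2_continuous (fun t => hk (tau + Num.max t 0)).
  move=> t.
  have := @hk_continuous_time _ (pos t).
  move=> /(cvg_comp (fun s => tau + Num.max s 0) _ (@continuous_shift_max tau t)).
  exact.
split=> //; first by move=> t x; exact: hk_odd.
move=> phi s t s0 st.
have P0 := H2_val_L2 phi; have P2 := H2_d2_L2 phi.
under [RHS]eq_Rintegral do rewrite mulr0 mul0r addr0.
apply: (@FTC_itv (fun r => ip (hk (tau + Num.max r 0)) (H2_val phi))
    (fun r => ip (hk (tau + Num.max r 0)) (H2_d2 phi))) => //; last 2 first.
- exact: (@L2_continuous_ip (fun t => hk (tau + Num.max t 0))).
- exact: (@L2_continuous_ip (fun t => hk (tau + Num.max t 0))).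
move=> r /andP[sr rt].
have r0 : 0 < r by exact: le_lt_trans sr.
rewrite ip_hk_d2// (max_idPl (ltW r0)).
apply: (@near_eq_is_derive _ _ _ (fun s => ip (hk (tau + s)) (H2_val phi))).
  near=> q; rewrite (max_idPl _)//; apply: ltW; near: q; exact: lt_nbhsr.
apply: (@is_derive_shift (fun q => ip (hk q) (H2_val phi))).
by apply: hk_ip_derive => //; rewrite addr_gt0.
Unshelve. all: by end_near. Qed.

Definition step (a t : R) : R := if a < t then 1 else 0.

Lemma bounded_step a : bounded_control (step a).
Proof.
split; last by exists 1 => t; rewrite /step; case: ifP; rewrite ?normr1 ?normr0.
apply: nondecreasing_measurable => // x y xy.
by rewrite /step; case: ifP => ax; case: ifP => ay//; rewrite (lt_le_trans ax) in ay.
Qed.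

Lemma hE_L2_continuous : L2_continuous (@hE R).
Proof.
move=> t.
have [|C hC] := @hE_decay R (`|t| + 1); first by rewrite ltr_wpDl.
have tb : t < `|t| + 1 by rewrite ltr_pwDr// ler_norm.
apply: (@decay_cvg_nrm (@hE R) (t - 1) (`|t| + 1) C).
- by rewrite gtrBl ltr01.
- by move=> s _; exact: measurable_hE.
- by move=> s /andP[_ /ltW]; exact: hC.
- by move=> s x _; exact: hE_continuous_time.
Qed.

(** The response to a unit control switched on at time [a]. Before [a] both sides of the equation
    vanish; after [a] the time derivative [hk] is matched with the source by [ip_hE_d2]; an interval
    containing [a] is cut there. *)
Lemma heat_sol_hE a : heat_sol (step a) (fun t => hE (t - a)).
Proof.
have LW t : L2 (hE (t - a)) by exact: L2_hE.
have cW : L2_continuous (fun t => hE (t - a)).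
  move=> t.
  have cs : s - a @[s --> t] --> t - a by apply: cvgB => //; exact: cvg_cst.
  have := hE_L2_continuous (t - a).
  move=> /(cvg_comp (fun s => s - a) _ cs).
  exact.
split=> //; first by move=> t x; exact: hE_odd.
move=> phi s t _.
have P0 := H2_val_L2 phi; have P2 := H2_d2_L2 phi.
have z f r : r <= a -> ip (hE (r - a)) f = 0.
  move=> ra; rewrite /ip; under eq_Rintegral do rewrite /hE subr_gt0 ltNge ra/= mul0r.
  by rewrite Rintegral_cst// mul0r.
pose w r := ip (hE (r - a)) (H2_d2 phi) + 2 * step a r * H2_d1 phi 0.
have before p q : p < q -> q <= a -> ip (hE (q - a)) (H2_val phi) - ip (hE (p - a)) (H2_val phi) =
    \int[mu]_(r in `]p, q[) w r.
  move=> pq qa; rewrite !z ?subrr//; last by rewrite (le_trans (ltW pq)).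
  rewrite (@eq_Rintegral _ _ _ mu _ (fun=> 0)); first by rewrite Rintegral_cst// mul0r.
  move=> r; rewrite inE/= in_itv/= => /andP[_ rq].
  have ra : r <= a by rewrite (le_trans (ltW rq)).
  by rewrite /w z// /step ltNge ra/= mulr0 mul0r addr0.
(* The value [p = a] is allowed: the derivative is needed only inside the interval, and replacing
   [step a] by 1 makes the integrand continuous at [a] as well. *)
have after p q : p < q -> a <= p -> ip (hE (q - a)) (H2_val phi) - ip (hE (p - a)) (H2_val phi) =
    \int[mu]_(r in `]p, q[) w r.
  move=> pq ap.
  rewrite (@eq_Rintegral _ _ _ mu _ (fun r => ip (hE (r - a)) (H2_d2 phi) + 2 * H2_d1 phi 0)); last first.
    move=> r; rewrite inE/= in_itv/= => /andP[pr _].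
    by rewrite /w /step (le_lt_trans ap pr) mulr1.
  apply: (@FTC_itv (fun r => ip (hE (r - a)) (H2_val phi))) => //.
  - move=> r /andP[pr _].
    have ra : 0 < r - a by rewrite subr_gt0 (le_lt_trans ap).
    rewrite ip_hE_d2//.
    rewrite (_ : (fun r => _) = (fun r => ip (hE (- a + r)) (H2_val phi))); last first.
      by apply/funext => b; rewrite addrC.
    apply: (@is_derive_shift (fun q => ip (hE q) (H2_val phi))).
    by rewrite addrC; exact: hE_ip_derive.
  - exact: L2_continuous_ip.
  - move=> r; apply: cvgD; last exact: cvg_cst.
    by apply: (@L2_continuous_ip (fun t => hE (t - a))).
move=> st; have [ta|at_] := leP t a; first exact: before.
have [as_|sa] := leP a s; first exact: after.
suff iw : mu.-integrable `]s, t[ (EFin \o w).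
  have := Rintegral_itv_split (ltW sa) (ltW at_) iw.
  by rewrite -(before s a sa (lexx a)) -(after a t at_ (lexx a)) addrC subrKA => <-.
have cd2 : continuous (fun r => ip (hE (r - a)) (H2_d2 phi)).
  exact: (@L2_continuous_ip (fun t => hE (t - a))).
apply: integrableD_EFin => //.
  have : mu.-integrable `[s, t] (EFin \o (fun r => ip (hE (r - a)) (H2_d2 phi))).
    apply: continuous_compact_integrable => //; first exact: segment_compact.
    exact: continuous_subspaceT.
  by apply: integrableS => //; exact: subset_itv_oo_cc.
have [ms _] := bounded_step a.
apply: (@bounded_integrable_itv _ _ _ _ (2 * `|H2_d1 phi 0|)).
  by apply: measurable_funTS; apply: measurable_funM => //; apply: measurable_funM.
move=> r _; rewrite !normrM ler_wpM2r// ger0_norm// ler_piMr//.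
by rewrite /step; case: ifP; rewrite ?normr1 ?normr0.
Qed.

End curves.

(** * Combinations of heat kernels *)

Section span.
Context {R : realType}.
Local Notation mu := (@lebesgue_measure R).
Implicit Types (f g : R -> R) (t x : R) (l : seq (R * R)).

(** This function is used in two ways. In space, [hk t] is a multiple of it at parameter 1/(4t); in
    frequency, the sine transform of [hk t] is a multiple of it at parameter [t]. *)
Definition gk (a x : R) : R := x * expR (- (a * x ^+ 2)).

Lemma hkE t x : hk t x = hc * hs t * gk (4 * t)^-1 x.
Proof. by rewrite /hk /gk /gau [(4 * t)^-1 * _]mulrC. Qed.

Lemma gkE (a x : R) : 0 < a -> exists2 t, 0 < t & gk a = (fun x => (hc * hs t)^-1 * hk t x).
Proof.
move=> a0; exists (4 * a)^-1; first by rewrite invr_gt0 mulr_gt0.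
apply/funext => y; rewrite hkE mulKf.
  by congr (gk _ _); field; rewrite gt_eqF.
have h0 := @hc_gt0 R.
rewrite mulf_neq0// ?gt_eqF// /hs invr_gt0 mulr_gt0 ?sqrtr_gt0 ?invr_gt0 ?mulr_gt0//.
Qed.

Lemma L2_gk a : 0 < a -> L2 (gk a).
Proof. by move=> /(gkE 0)[t t0 ->]; apply: L2Z; exact: L2_hk. Qed.

Lemma ge0_Rintegral_scaling (G : R -> R) (c : R) : 0 < c -> continuous G ->
  (forall x, 0 <= G x) ->
  \int[mu]_x G x = \int[mu]_x (c * G (c * x)).
Proof.
move=> c0 cG G0.
have dF x : is_derive x 1 (fun x : R => c * x) c.
  by apply: is_derive_eq; rewrite /GRing.scale/=; ring.
have F'E : (fun x : R => c * x)^`()%classic = cst c.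
  by apply/funext => x; rewrite derive1E; apply: derive_val.
have h := @increasing_ge0_integration_by_substitutionT R (fun x => c * x) G.
rewrite /Rintegral h//.
- by rewrite F'E; under eq_integral => x _ do rewrite /= mulrC.
- by move=> x y xy; rewrite /= ltr_pM2l.
- by rewrite F'E; exact: cst_continuous.
- by rewrite F'E; exact: is_cvg_cst.
- by rewrite F'E; exact: is_cvg_cst.
- exact: gt0_cvgMrNy.
- exact: gt0_cvgMry.
Qed.

(** Parseval's identity for two kernels, without a transform: both sides are integrals of x^2 times
    a Gaussian, and a scaling carries one to the other. *)
Lemma Rintegral_gk2 (a b : R) : 0 < a -> 0 < b ->
  ip (hk a) (hk b) = 8 * hc ^+ 2 * ip (gk a) (gk b).
Proof.
move=> a0 b0.
pose G x : R := x ^+ 2 * expR (- ((a^-1 + b^-1) / 4 * x ^+ 2)).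
(* The scale with q^2 (1/a + 1/b)/4 = a + b. The factor 8 arises as q^3 [hs a] [hs b]. *)
pose q := 2 * (Num.sqrt a * Num.sqrt b).
have sa : 0 < Num.sqrt a by rewrite sqrtr_gt0.
have sb : 0 < Num.sqrt b by rewrite sqrtr_gt0.
have q0 : 0 < q by rewrite !mulr_gt0.
have a2 : Num.sqrt a ^+ 2 = a by rewrite sqr_sqrtr// ltW.
have b2 : Num.sqrt b ^+ 2 = b by rewrite sqr_sqrtr// ltW.
have cG : continuous G.
  move=> x; apply: cvgM; first exact: exprn_continuous.
  apply: continuous_comp; last exact: continuous_expR.
  by apply: cvgN; apply: cvgMr; exact: exprn_continuous.
have G0 x : 0 <= G x by rewrite mulr_ge0 ?sqr_ge0// expR_ge0.
have hG := ge0_Rintegral_scaling q0 cG G0.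
have -> : ip (hk a) (hk b) = \int[mu]_x (hc ^+ 2 * hs a * hs b * G x).
  apply: eq_Rintegral => x _; rewrite !hkE /gk /G.
  rewrite (_ : _ * _ = hc ^+ 2 * hs a * hs b * (x ^+ 2 * (expR (- ((4 * a)^-1 * x ^+ 2)) * expR (- ((4 * b)^-1 * x ^+ 2))))); last by ring.
  rewrite -expRD; congr (_ * (_ * expR _)); field.
  by rewrite !gt_eqF.
have iG : mu.-integrable setT (EFin \o G).
  have := ip_integrable (L2_gk (_ : 0 < (a^-1 + b^-1) / 8)) (L2_gk (_ : 0 < (a^-1 + b^-1) / 8)).
  have p8 : 0 < (a^-1 + b^-1) / 8 by rewrite divr_gt0// addr_gt0// invr_gt0.
  move=> /(_ p8 p8); congr (_.-integrable _ (EFin \o _)); apply/funext => x.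
  rewrite /gk /G mulrACA -expRD -expr2; congr (_ * expR _); field.
  by rewrite !gt_eqF.
rewrite RintegralZl// hG.
have E : (fun x => q * G (q * x)) = (fun x => q ^+ 3 * (gk a x * gk b x)).
  apply/funext => x; rewrite /G /gk.
  have q2 : (q * x) ^+ 2 = 4 * a * b * x ^+ 2 by rewrite /q !exprMn a2 b2; ring.
  have q3 : q ^+ 3 = q * (4 * a * b).
    by rewrite exprS; congr (q * _); rewrite /q !exprMn a2 b2; ring.
  rewrite q2 q3 [RHS](_ : _ = q * (4 * a * b * x ^+ 2 * (expR (- (a * x ^+ 2)) * expR (- (b * x ^+ 2))))); last by ring.
  rewrite -expRD; congr (q * (_ * expR _)); field.
  by rewrite !gt_eqF.
rewrite E RintegralZl//; last by apply: ip_integrable; exact: L2_gk.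
rewrite -/(ip _ _) mulrA; congr (_ * _).
rewrite /hs /q -{1}a2 -{1}b2; field.
by rewrite !gt_eqF.
Qed.

(** A pair holds a coefficient and an age. The argument [t] is the heat flow: on [gcomb] the same
    shift is multiplication by exp(-t x^2). *)
Definition kcomb l t x : R := \sum_(p <- l) p.1 * hk (p.2 + t) x.
Definition gcomb l t x : R := \sum_(p <- l) p.1 * gk (p.2 + t) x.

Lemma kcomb_cons p l t : kcomb (p :: l) t = (fun x => p.1 * hk (p.2 + t) x) \+ kcomb l t.
Proof. by apply/funext => x; rewrite /kcomb big_cons. Qed.

Lemma gcomb_cons p l t : gcomb (p :: l) t = (fun x => p.1 * gk (p.2 + t) x) \+ gcomb l t.
Proof. by apply/funext => x; rewrite /gcomb big_cons. Qed.

Lemma kcomb_nil t : kcomb [::] t = (fun=> 0).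
Proof. by apply/funext => x; rewrite /kcomb big_nil. Qed.

Lemma gcomb_nil t : gcomb [::] t = (fun=> 0).
Proof. by apply/funext => x; rewrite /gcomb big_nil. Qed.

Definition positive_times l := all (fun p => 0 < p.2) l.

Lemma L2_kcomb l t : 0 <= t -> positive_times l -> L2 (kcomb l t).
Proof.
move=> t0; elim: l => [|p l IH]; first by rewrite kcomb_nil => _; exact: L20.
move=> /= /andP[p0 pl]; rewrite kcomb_cons; apply: L2D; last exact: IH.
by apply: L2Z; apply: L2_hk; rewrite ltr_pwDl.
Qed.

Lemma L2_gcomb l t : 0 <= t -> positive_times l -> L2 (gcomb l t).
Proof.
move=> t0; elim: l => [|p l IH]; first by rewrite gcomb_nil => _; exact: L20.
move=> /= /andP[p0 pl]; rewrite gcomb_cons; apply: L2D; last exact: IH.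
by apply: L2Z; apply: L2_gk; rewrite ltr_pwDl.
Qed.

Lemma ip0l f : ip (fun=> 0) f = 0.
Proof. by rewrite /ip; under eq_Rintegral do rewrite mul0r; rewrite Rintegral_cst// mul0r. Qed.

(* Up to the factor 8 hc^2, [hk a |-> gk a] is the sine transform. *)
Lemma ip_kcomb l l' t : 0 <= t -> positive_times l -> positive_times l' ->
  ip (kcomb l t) (kcomb l' t) = 8 * hc ^+ 2 * ip (gcomb l t) (gcomb l' t).
Proof.
move=> t0 pl pl'; elim: l pl => [|p l IH] /=.
  by rewrite kcomb_nil gcomb_nil !ip0l mulr0.
move=> /andP[p0 pl]; have pt0 : 0 < p.2 + t by rewrite ltr_pwDl.
have Lk := L2_kcomb t0 pl; have Lk' := L2_kcomb t0 pl'.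
have Lg := L2_gcomb t0 pl; have Lg' := L2_gcomb t0 pl'.
have Lkp := L2_hk pt0; have Lgp := L2_gk pt0.
rewrite kcomb_cons gcomb_cons !ipDl ?(ipZl p.1)//; try exact: L2Z.
rewrite IH// mulrDr; congr (_ + _); rewrite mulrCA; congr (_ * _).
elim: l' pl' {Lk' Lg' IH} => [|p' l' IH] /=.
  by rewrite kcomb_nil gcomb_nil ![ip _ (fun=> 0)]ipC !ip0l mulr0.
move=> /andP[p'0 pl']; have pt'0 : 0 < p'.2 + t by rewrite ltr_pwDl.
have Lk' := L2_kcomb t0 pl'; have Lg' := L2_gcomb t0 pl'.
have Lkp' := L2_hk pt'0; have Lgp' := L2_gk pt'0.
rewrite kcomb_cons gcomb_cons !ipDr ?(ipZr p'.1)//; try exact: L2Z.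
by rewrite IH// Rintegral_gk2//; ring.
Qed.

(** After [ip_kcomb] the norms are compared on the frequency side, where the flow multiplies
    pointwise by a number in [0, 1]. *)
Lemma nrm_kcomb_contract l t : 0 <= t -> positive_times l ->
  nrm (kcomb l t) <= nrm (kcomb l 0).
Proof.
move=> t0 pl; apply: ler_wsqrtr; rewrite (ip_kcomb t0 pl pl) (ip_kcomb (lexx 0) pl pl).
have c0 : 0 <= 8 * hc ^+ 2 :> R by rewrite mulr_ge0 ?sqr_ge0.
apply: (ler_wpM2l c0).
have Lg := L2_gcomb t0 pl; have Lg0 := L2_gcomb (lexx 0) pl.
apply: le_Rintegral; [by []|exact: ip_integrable|exact: ip_integrable|].
move=> x _.
have -> : gcomb l t x = expR (- (t * x ^+ 2)) * gcomb l 0 x.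
  rewrite /gcomb mulr_sumr; apply: eq_bigr => p _.
  by rewrite /gk addr0 mulrDl opprD expRD; ring.
set y := gcomb l 0 x; set E := expR _.
have E0 : 0 <= E by exact: expR_ge0.
have E1 : E <= 1 by rewrite -expR0 ler_expR oppr_le0 mulr_ge0 ?sqr_ge0.
rewrite mulrACA -!expr2 ler_piMl ?sqr_ge0//.
by rewrite expr_le1.
Qed.

End span.

(** * Density in the odd functions of L^2 *)

Section density.
Context {R : realType}.
Local Notation mu := (@lebesgue_measure R).
Implicit Types (f g : R -> R) (t x : R) (l : seq (R * R)).

Lemma L2_dominated_cvg (fn : nat -> R -> R) f g : L2 g ->
  (forall n, measurable_fun setT (fn n)) -> measurable_fun setT f ->
  (forall n x, `|fn n x| <= `|g x|) -> (forall x, `|f x| <= `|g x|) ->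
  (forall x, fn n x @[n --> \oo] --> f x) ->
  nrm (f \- fn n) @[n --> \oo] --> (0 : R).
Proof.
move=> Lg mfn mf fng fg fnf.
have Lf : L2 f by exact: L2_le mf Lg fg.
have Lfn n : L2 (fn n) by exact: L2_le (mfn n) Lg (fng n).
pose d n x := (f x - fn n x) * (f x - fn n x).
have id n : mu.-integrable setT (EFin \o d n).
  by apply: ip_integrable; apply: L2B.
have ig := integrableZ_EFin 4 measurableT (ip_integrable Lg Lg).
have [|||||_ _] := @dominated_convergence _ _ R mu setT measurableT
  (fun n => EFin \o d n) (cst 0%E) (EFin \o (fun x => 4 * (g x * g x))).
- by move=> n; exact: (measurable_int _ (id n)).
- exact: measurable_cst.
- apply: aeW => x _.
  apply/fine_cvgP; split; first exact: nearW.
  have h : f x - fn n x @[n --> \oo] --> (0 : R).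
    by rewrite -[X in _ --> X](subrr (f x)); apply: cvgB => //; exact: cvg_cst.
  by rewrite -[X in _ --> X](mulr0 0); apply: cvgM.
- exact: ig.
- apply: aeW => x n _ /=; rewrite lee_fin /d normrM -expr2 -[g x * g x]expr2.
  rewrite -[g x ^+ 2]real_normK ?num_real// (_ : 4 * _ = (2 * `|g x|) ^+ 2); last by ring.
  rewrite lerXn2r ?nnegrE ?mulr_ge0//.
  apply: le_trans (ler_normB _ _) _; have := fg x; have := fng n x; lra.
- rewrite integral_cst// mul0e => /fine_cvgP[_ h].
  have : Num.sqrt (ip (f \- fn n) (f \- fn n)) @[n --> \oo] --> Num.sqrt (0 : R).
    by apply: continuous_cvg => //; exact: sqrt_continuous.
  by rewrite sqrtr0.
Qed.

(** The L^2 closure of the span of young kernels. The bound [d] on the ages will be the control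
    time, since a kernel of age s is produced by an action at time T - s; elsewhere 1 serves. *)
Definition hk_span (d : R) f := L2 f /\ forall e : R, 0 < e ->
  exists l, all (fun p => 0 < p.2 < d) l /\ nrm (f \- kcomb l 0) < e.

Lemma positive_times_lt d l : all (fun p : R * R => 0 < p.2 < d) l -> positive_times l.
Proof. by apply: sub_all => p /andP[]. Qed.

Lemma hk_span_lim d f : L2 f -> (forall e : R, 0 < e -> exists2 g, hk_span d g & nrm (f \- g) < e) ->
  hk_span d f.
Proof.
move=> Lf h; split=> // e e0.
have [g [Lg hg] fg] := h _ (divr_gt0 e0 (ltr0Sn R 1)).
have [l [pl gl]] := hg _ (divr_gt0 e0 (ltr0Sn R 1)).
exists l; split=> //.
have Lk := L2_kcomb (lexx 0) (positive_times_lt pl).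
apply: le_lt_trans (nrm_triangle Lf Lg Lk) _; lra.
Qed.

Lemma hk_span_scale d c f : hk_span d f -> hk_span d (fun x => c * f x).
Proof.
move=> [Lf hf]; split; first exact: L2Z.
move=> e e0.
have [l [pl fl]] := hf (e / (`|c| + 1)) (divr_gt0 e0 (ltr_wpDl (normr_ge0 c) ltr01)).
exists [seq (c * p.1, p.2) | p <- l]; split; first by rewrite all_map.
have Lk := L2_kcomb (lexx 0) (positive_times_lt pl).
rewrite (_ : _ \- _ = (fun x => c * (f \- kcomb l 0) x)); last first.
  apply/funext => x /=; rewrite mulrBr; congr (_ - _).
  by rewrite /kcomb big_map mulr_sumr; apply: eq_bigr => p _ /=; rewrite -mulrA.
rewrite nrmZ; last exact: L2B.
rewrite ltr_pdivlMr in fl; last by rewrite ltr_wpDl.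
apply: le_lt_trans fl; rewrite mulrC ler_wpM2l ?nrm_ge0//.
by rewrite lerDl.
Qed.

Lemma hk_span_add d f g : hk_span d f -> hk_span d g -> hk_span d (f \+ g).
Proof.
move=> [Lf hf] [Lg hg]; split; first exact: L2D.
move=> e e0.
have [l [pl fl]] := hf _ (divr_gt0 e0 (ltr0Sn R 1)).
have [l' [pl' gl]] := hg _ (divr_gt0 e0 (ltr0Sn R 1)).
exists (l ++ l'); split; first by rewrite all_cat pl.
have Lk := L2_kcomb (lexx 0) (positive_times_lt pl).
have Lk' := L2_kcomb (lexx 0) (positive_times_lt pl').
rewrite (_ : _ \- _ = (f \- kcomb l 0) \+ (g \- kcomb l' 0)); last first.
  by apply/funext => x /=; rewrite /kcomb big_cat/=; ring.
apply: le_lt_trans (nrmD (L2B Lf Lk) (L2B Lg Lk')) _; lra.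
Qed.

Lemma hk_span_sub d f g : hk_span d f -> hk_span d g -> hk_span d (f \- g).
Proof.
move=> Vf Vg; have := hk_span_add Vf (hk_span_scale (-1) Vg); congr (hk_span d _).
by apply/funext => x /=; rewrite mulN1r.
Qed.

Lemma hk_span_hk d t : 0 < t -> t < d -> hk_span d (hk t).
Proof.
move=> t0 td; split; first exact: L2_hk.
move=> e e0; exists [:: (1, t)]; split; first by rewrite /= t0 td.
rewrite (_ : _ \- _ = (fun=> 0)) ?nrm0//.
by apply/funext => x; rewrite /kcomb/= big_seq1/= addr0 mul1r subrr.
Qed.

Lemma hk_span_zero d : hk_span d (fun=> 0).
Proof.
split; first exact: L20.
move=> e e0; exists [::]; split=> //.
rewrite (_ : _ \- _ = (fun=> 0)) ?nrm0//.
by apply/funext => x; rewrite /kcomb/= big_nil subrr.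
Qed.

Lemma hk_span_sum d (I : Type) (r : seq I) (F : I -> R -> R) : (forall i, hk_span d (F i)) ->
  hk_span d (fun x => \sum_(i <- r) F i x).
Proof.
move=> VF; elim: r => [|i r IH].
  by have := hk_span_zero d; congr (hk_span d _); apply/funext => x; rewrite big_nil.
have := hk_span_add (VF i) IH; congr (hk_span d _); by apply/funext => x; rewrite big_cons.
Qed.

(** The tool for each limit below: a closed subspace of L^2 is stable under dominated pointwise
    limits. *)
Lemma hk_span_dominated d (fn : nat -> R -> R) f g : L2 g ->
  (forall n, hk_span d (fn n)) -> measurable_fun setT f ->
  (forall n x, `|fn n x| <= `|g x|) -> (forall x, `|f x| <= `|g x|) ->
  (forall x, fn n x @[n --> \oo] --> f x) -> hk_span d f.
Proof.
move=> Lg Vfn mf fng fg fnf.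
have h := L2_dominated_cvg Lg (fun n => L2_measurable (Vfn n).1) mf fng fg fnf.
apply: hk_span_lim; first exact: L2_le mf Lg fg.
move=> e e0; have /cvgrPdist_lt/(_ _ e0)[N _ /(_ N (leqnn N))/=] := h.
rewrite sub0r normrN ger0_norm ?nrm_ge0// => hN.
by exists (fn N).
Qed.

(** * From polynomials in [z] to arbitrary odd functions, with the fixed weight [w] *)

Section weighted.
Context (d : R) (d0 : 0 < d).

Definition w x : R := gk d^-1 x.
Definition z x : R := expR (- (d^-1 * x ^+ 2)).

Lemma L2_w : L2 w.
Proof. by apply: L2_gk; rewrite invr_gt0. Qed.

(** The product is x exp(-(n+1)x^2/d), a multiple of the kernel of age t with 1/(4t) = (n+1)/d. All
    these ages are at most d/4, hence below [d]. *)
Lemma hk_span_w_zX n : hk_span d (fun x => w x * z x ^+ n).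
Proof.
have n0 : 0 < n.+1%:R :> R by rewrite ltr0n.
pose t := d / (4 * n.+1%:R).
have t0 : 0 < t by rewrite divr_gt0// mulr_gt0.
have td : t < d.
  rewrite ltr_pdivrMr ?mulr_gt0// ltr_pMr//.
  have : 1 <= n.+1%:R :> R by rewrite ler1n.
  lra.
have := hk_span_scale (hc * hs t)^-1 (hk_span_hk t0 td); congr (hk_span d _).
apply/funext => x; rewrite hkE mulKf; last first.
  have h0 := @hc_gt0 R.
  by rewrite mulf_neq0// ?gt_eqF// /hs invr_gt0 mulr_gt0 ?sqrtr_gt0.
rewrite /w /z /gk -mulrA -expRM_natl -expRD; congr (x * expR _).
rewrite /t -natr1; field; rewrite gt_eqF//= ?gt_eqF//.
Qed.

Lemma hk_span_w_poly (q : {poly R}) : hk_span d (fun x => w x * q.[z x]).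
Proof.
have := @hk_span_sum d _ (index_enum 'I_(size q)) (fun i x => q`_i * (w x * z x ^+ i)).
move=> /(_ (fun i => hk_span_scale _ (hk_span_w_zX i))); congr (hk_span d _).
apply/funext => x; rewrite horner_coef mulr_sumr; apply: eq_bigr => i _; exact: mulrCA.
Qed.

Lemma bernoulli_ge (a : R) n : 0 <= a -> 1 + n%:R * a <= (1 + a) ^+ n.
Proof.
move=> a0; elim: n => [|n IH]; first by rewrite mul0r addr0 expr0.
rewrite exprS; apply: (@le_trans _ _ ((1 + a) * (1 + n%:R * a))).
  rewrite -natr1; have : 0 <= n%:R :> R by []. nra.
by rewrite ler_wpM2l// addr_ge0.
Qed.

Lemma bernoulli_le (a : R) n : 0 <= a <= 1 -> 1 - n%:R * a <= (1 - a) ^+ n.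
Proof.
move=> /andP[a0 a1]; elim: n => [|n IH]; first by rewrite mul0r subr0 expr0.
rewrite exprS; apply: (@le_trans _ _ ((1 - a) * (1 - n%:R * a))).
  rewrite -natr1; have : 0 <= n%:R :> R by []. nra.
by rewrite ler_wpM2l// subr_ge0.
Qed.

(** Split q^N as s^N s^N with s = sqrt q. Bernoulli's inequality for 1/s gives N (1/s - 1) <= s^-N,
    so one factor absorbs N and the other tends to 0. *)
Lemma cvg_natMexpr (q : R) : 0 < q < 1 -> n.+1%:R * q ^+ n.+1 @[n --> \oo] --> (0 : R).
Proof.
move=> /andP[q0 q1].
pose s := Num.sqrt q.
have s0 : 0 < s by rewrite sqrtr_gt0.
have s2 : s ^+ 2 = q by rewrite sqr_sqrtr// ltW.
have s1 : s < 1.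
  by rewrite -(@ltr_pXn2r _ 2)// ?nnegrE ?(ltW s0)// s2 expr1n.
pose a := s^-1 - 1.
have a0 : 0 < a by rewrite subr_gt0 invf_gt1.
have lim : a^-1 * s ^+ n.+1 @[n --> \oo] --> (0 : R).
  rewrite -[X in _ --> X](mulr0 a^-1); apply: cvgMr.
  have : `|s| < 1 by rewrite ger0_norm// ltW.
  move=> /cvg_geometric -/(_ s); apply: cvg_trans; apply: near_eq_cvg.
  by near=> n; rewrite /= exprS.
apply: (squeeze_cvgr _ (cvg_cst 0) lim).
near=> n; rewrite mulr_ge0 ?exprn_ge0 ?(ltW q0)//=.
rewrite -s2 -exprM mulnC exprM expr2 mulrA ler_wpM2r ?exprn_ge0 ?(ltW s0)//.
have := bernoulli_ge n.+1 (ltW a0).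
have a1 : 1 + a = s^-1 by rewrite /a addrCA subrr addr0.
rewrite a1 exprVn => h.
have sn0 : 0 < s ^+ n.+1 by rewrite exprn_gt0.
rewrite -[leRHS]mul1r ler_pdivlMr// mulrAC -ler_pdivlMr// mul1r.
by apply: le_trans h; rewrite lerDr.
Unshelve. all: by end_near. Qed.

(* Kuhn's polynomials (1 - X^n)^m, with n c^-n <= m <= n c^-n + 1, tend to the
   indicator of [0, c[ on [0, 1]. *)
Lemma kuhn_polynomials (c : R) : 0 < c <= 1 -> exists q : nat -> {poly R},
  forall y, 0 < y <= 1 ->
    (forall n, 0 <= (q n).[y] <= 1) /\
    (q n).[y] @[n --> \oo] --> (if y < c then 1 else 0 : R).
Proof.
move=> /andP[c0 c1].
pose m n := (Num.trunc (n.+1%:R * c ^- n.+1)).+1.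
have mge n : n.+1%:R * c ^- n.+1 <= (m n)%:R by rewrite ltW// truncnS_gt.
have mle n : (m n)%:R <= n.+1%:R * c ^- n.+1 + 1.
  rewrite /m -natr1 lerD2r truncn_le// mulr_ge0// invr_ge0 exprn_ge0// ltW//.
exists (fun n => (1 - 'X^(n.+1)) ^+ m n) => y /andP[y0 y1].
have E n : ((1 - 'X^(n.+1)) ^+ m n).[y] = (1 - y ^+ n.+1) ^+ m n.
  by rewrite horner_exp !hornerE.
have yn n : 0 <= y ^+ n.+1 <= 1 by rewrite exprn_ge0 ?exprn_ile1 ?(ltW y0).
have b n : 0 <= (1 - y ^+ n.+1) ^+ m n <= 1.
  have /andP[h1 h2] := yn n.
  by rewrite exprn_ge0 ?exprn_ile1 ?subr_ge0// gerBl.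
split; first by move=> n; rewrite E.
suff lim0 : (1 - y ^+ n.+1) ^+ m n @[n --> \oo] --> (if y < c then 1 else 0 : R).
  by apply: cvg_trans lim0; apply: near_eq_cvg; near=> n; rewrite E.
case: ifPn => yc.
  (* Below the threshold, with N = n + 1: Bernoulli's inequality bounds the polynomial from below by
     1 - m y^N, and m <= N c^-N + 1 <= 2 N c^-N because c <= 1. *)
  have lim : 1 - 2 * (n.+1%:R * (y / c) ^+ n.+1) @[n --> \oo] --> (1 : R).
    rewrite -[X in _ --> X]subr0 -[X in _ - X](mulr0 2).
    apply: cvgB; first exact: cvg_cst; apply: cvgMr; apply: cvg_natMexpr.
    by rewrite divr_gt0//= ltr_pdivrMr// mul1r.
  apply: (@squeeze_cvgr _ _ _ _ (fun n => 1 - 2 * (n.+1%:R * (y / c) ^+ n.+1)) (fun=> 1)); [|exact: lim|exact: cvg_cst].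
  near=> n.
  have /andP[_ ->] := b n; rewrite andbT.
  apply: le_trans (bernoulli_le (m n) (yn n)).
  rewrite lerD2l lerN2 expr_div_n.
  apply: (@le_trans _ _ ((n.+1%:R * c ^- n.+1 + 1) * y ^+ n.+1)).
    by rewrite ler_wpM2r//; case/andP: (yn n).
  rewrite (_ : 2 * _ = (n.+1%:R * c ^- n.+1 + n.+1%:R * c ^- n.+1) * y ^+ n.+1); last by ring.
  rewrite ler_wpM2r//; first by case/andP: (yn n).
  rewrite lerD2l -[leLHS](mulr1 1) ler_pM// ?ler1n//.
  by rewrite invf_ge1 ?exprn_gt0// exprn_ile1// ltW.
rewrite -leNgt in yc.
have lim : n.+1%:R^-1 @[n --> \oo] --> (0 : R) by exact: cvg_harmonic.
apply: (squeeze_cvgr _ (cvg_cst 0) lim); near=> n.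
have /andP[-> _] := b n; rewrite andTb.
have /andP[h1 h2] := yn n.
have yn0 : 0 < y ^+ n.+1 by rewrite exprn_gt0.
(* From the threshold on: the product with (1 + y^N)^m is at most 1, whereas (1 + y^N)^m >= m y^N >=
   N (y/c)^N >= N. The value is therefore at most 1/N, also at y = c. *)
have k1 : (1 - y ^+ n.+1) ^+ m n * (1 + y ^+ n.+1) ^+ m n <= 1.
  rewrite -exprMn (_ : (1 - _) * _ = 1 - (y ^+ n.+1) ^+ 2); last by ring.
  rewrite exprn_ile1// ?gerBl ?sqr_ge0// subr_ge0.
  by rewrite exprn_ile1.
have k2 : n.+1%:R <= (1 + y ^+ n.+1) ^+ m n.
  apply: le_trans (bernoulli_ge (m n) h1).
  apply: (@le_trans _ _ ((m n)%:R * y ^+ n.+1)); last by rewrite lerDr.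
  apply: (@le_trans _ _ (n.+1%:R * c ^- n.+1 * y ^+ n.+1)); last by rewrite ler_wpM2r.
  rewrite -mulrA ler_peMr// mulrC ler_pdivlMr ?exprn_gt0// mul1r.
  by rewrite lerXn2r// nnegrE ltW.
rewrite -[leRHS]mul1r ler_pdivlMr ?ltr0n//.
apply: le_trans k1; rewrite ler_wpM2l//.
by case/andP: (b n).
Unshelve. all: by end_near. Qed.

(** Since [z] decreases in |x|, the ray is the set where z < z(r), so the polynomials with threshold
    c = z(r) apply. For negative r the indicator is 1 everywhere and the function is [w] itself. *)
Lemma hk_span_w_ray r : hk_span d (fun x => w x * (if r < `|x| then 1 else 0)).
Proof.
have wm : measurable_fun setT w by exact: L2_measurable L2_w.
have z01 x : 0 < z x <= 1.
  rewrite /z expR_gt0 -expR0 ler_expR oppr_le0 mulr_ge0 ?sqr_ge0//.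
  by rewrite invr_ge0 ltW.
have [r0|r0] := ltP r 0.
  have := hk_span_w_zX 0; congr (hk_span d _); apply/funext => x.
  by rewrite expr0 (lt_le_trans r0).
have [q hq] := kuhn_polynomials (z01 r).
apply: (@hk_span_dominated d (fun n x => w x * (q n).[z x]) _ w L2_w).
- by move=> n; exact: hk_span_w_poly.
- apply: measurable_funM => //.
  have mst : measurable_fun setT (fun y : R => if r < y then 1 else 0 : R).
    apply: nondecreasing_measurable => // x y xy.
    by case: ifP => ax; case: ifP => ay//; rewrite (lt_le_trans ax) in ay.
  exact: (measurableT_comp mst).
- move=> n x; rewrite normrM ler_piMr//.
  by have [/(_ n)/andP[h1 h2] _] := hq _ (z01 x); rewrite ger0_norm.
- by move=> x; rewrite normrM ler_piMr//; case: ifP; rewrite ?normr1 ?normr0.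
- move=> x; apply: cvgMr; have [_] := hq _ (z01 x).
  rewrite (_ : (z x < z r) = (r < `|x|))//.
  rewrite /z ltr_expR ltrN2 ltr_pM2l ?invr_gt0//.
  by rewrite -[x ^+ 2]real_normK ?num_real// ltr_pXn2r ?nnegrE.
Qed.

(** Disjointness keeps the partial sums in {0, 1}, which gives domination by [w] as well as their
    pointwise limit. *)
Lemma sum_indic_trivIset (F : nat -> set R) (y : R) n : trivIset setT F ->
  ((exists2 k, (k < n)%N & F k y) /\ \sum_(i < n) \1_(F i) y = 1 :> R) \/
  ((forall k, (k < n)%N -> ~ F k y) /\ \sum_(i < n) \1_(F i) y = 0 :> R).
Proof.
move=> tF; elim: n => [|n IH]; first by right; rewrite big_ord0.
rewrite big_ord_recr/=; have [yF|nyF] := pselect (F n y).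
  left; split; first by exists n.
  case: IH => [[[k kn Fk] _]|[_ ->]]; last by rewrite add0r indicE mem_set.
  have kn' := tF k n I I (ex_intro _ y (conj Fk yF)).
  by rewrite kn' ltnn in kn.
rewrite [\1_(F n) y]indicE memNset// addr0.
case: IH => [[[k kn Fk] ->]|[h ->]]; [left|right]; split=> //.
  by exists k => //; exact: ltnW.
move=> k; rewrite ltnS leq_eqVlt => /predU1P[->//|]; exact: h.
Qed.

(** Dynkin's theorem: the open rays form a generating class stable under intersection, complements
    are handled by linearity, and disjoint countable unions by dominated limits. *)
Lemma hk_span_w_indic (A : set R) : measurable A -> hk_span d (fun x => w x * \1_A `|x|).
Proof.
have wm : measurable_fun setT w by exact: L2_measurable L2_w.
move=> mA.
pose P (A : set R) := hk_span d (fun x => w x * \1_A `|x|).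
suff : P A by [].
have VT : P setT.
  have := hk_span_w_zX 0; congr (hk_span d _); apply/funext => x.
  by rewrite expr0 indicT.
have ME := @RGenOInfty.measurableE R.
have {}mA : (@RGenOInfty.G R).-sigma.-measurable A by rewrite -ME.
apply: (@dynkin_induction _ (measurableTypeR R) (@RGenOInfty.G R) P ME) mA => //.
- move=> _ _ [a ->] [b ->]; exists (Num.max a b).
  by apply/seteqP; split => x /=; rewrite !in_itv/= !andbT gt_max; [move=> [-> ->]|move=> /andP[]].
- move=> _ [a ->]; have := hk_span_w_ray a; congr (hk_span d _); apply/funext => x; congr (_ * _).
  by rewrite indicE; case: ifPn => h; [rewrite mem_set//= in_itv/= h|rewrite memNset//= in_itv/= andbT; exact/negP].
- move=> S _ PS; have := hk_span_sub VT PS; congr (hk_span d _); apply/funext => x /=.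
  rewrite -mulrBr; congr (_ * _); rewrite !indicE in_setC in_setT.
  by case: (_ \in S); rewrite ?subrr ?subr0.
- move=> F mF tF PF.
  have S01 n (y : R) : 0 <= (\sum_(i < n) \1_(F i) y : R) <= 1.
    by case: (sum_indic_trivIset y n tF) => -[_ ->]; rewrite ?lexx ?ler01.
  apply: (@hk_span_dominated d (fun n x => w x * \sum_(i < n) \1_(F i) `|x|) _ w L2_w).
  + move=> n; have := @hk_span_sum d _ (index_enum 'I_n) _ (fun i => PF i).
    by congr (hk_span d _); apply/funext => x; rewrite mulr_sumr.
  + apply: measurable_funM => //.
    have mi : measurable_fun setT (\1_(\bigcup_k F k) : R -> R).
      by apply: measurable_indic; exact: bigcupT_measurable.
    exact: (measurableT_comp mi).
  + move=> n x; have /andP[h1 h2] := S01 n `|x|.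
    by rewrite normrM ler_piMr// ger0_norm.
  + by move=> x; rewrite normrM ler_piMr// indicE; case: (_ \in _); rewrite ?normr1 ?normr0.
  + move=> x; apply: cvgMr; have [[k _ Fk]|nF] := pselect ((\bigcup_k F k) `|x|).
      rewrite indicE mem_set; last by exists k.
      apply: cvg_near_cst; exists k.+1 => // n /= kn.
      case: (sum_indic_trivIset `|x| n tF) => -[]// h.
      by have := h k kn.
    rewrite indicE memNset//; apply: cvg_near_cst; near=> n.
    case: (sum_indic_trivIset `|x| n tF) => -[]// [k _ Fk].
    by exfalso; apply: nF; exists k.
Unshelve. all: by end_near. Qed.

Import HBSimple HBNNSimple.

(** Approximation of [h] from below by simple functions; the limit function itself dominates. *)
Lemma hk_span_w_ge0 (h : R -> R) : measurable_fun setT h -> (forall y, 0 <= h y) ->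
  L2 (fun x => w x * h `|x|) -> hk_span d (fun x => w x * h `|x|).
Proof.
move=> mh h0 Lh.
have mhE : measurable_fun setT (EFin \o h) by exact/measurable_EFinP.
pose s n := nnsfun_approx measurableT mhE n.
have s_le n (y : R) : 0 <= s n y <= h y.
  apply/andP; split=> //.
  rewrite -lee_fin /s nnsfun_approxE; apply: le_approx => // t _; rewrite lee_fin; exact: h0.
have s_cvg (y : R) : s n y @[n --> \oo] --> h y.
  have := @cvg_nnsfun_approx _ _ R setT measurableT _ mhE.
  by move=> /(_ _ y I)/fine_cvgP[]// t _; rewrite lee_fin h0.
have Vs n : hk_span d (fun x => w x * s n `|x|).
  have fr : finite_set (range (s n)) by exact: fimfunP.
  have := @hk_span_sum d _ (finmap.enum_fset (fset_set (range (s n)))) (fun y x => y * (w x * \1_(s n @^-1` [set y]) `|x|)).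
  move=> /(_ (fun y => hk_span_scale _ (hk_span_w_indic _))) H.
  have {H} := H (fun y => measurable_sfunP _ (measurable_set1 y)).
  congr (hk_span d _); apply/funext => x.
  rewrite [in RHS](fimfunE (s n)) fsbig_finite//= mulr_sumr.
  by apply: eq_bigr => y _; rewrite mulrCA.
apply: (@hk_span_dominated d _ _ _ Lh Vs) => //.
- exact: L2_measurable Lh.
- move=> n x; have /andP[a b] := s_le n `|x|.
  by rewrite !normrM ler_wpM2l// (ger0_norm a) (ger0_norm (h0 _)).
- by move=> x; apply: cvgMr; exact: s_cvg.
Qed.

(** An odd [f] is [w] times an even function, because [w] is odd and vanishes only at 0, where [f]
    vanishes too. The even quotient is split into its positive and negative parts. *)
Theorem hk_span_odd f : L2 f -> (forall x, f (- x) = - f x) -> hk_span d f.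
Proof.
move=> Lf of_.
have mf := L2_measurable Lf.
have mw : measurable_fun setT w by exact: L2_measurable L2_w.
have wN x : w (- x) = - w x by rewrite /w /gk sqrrN mulNr.
have w0 x : 0 < x -> 0 < w x by move=> x0; rewrite /w /gk mulr_gt0// expR_gt0.
(* The quotient f/w on the positive half-line. The inverse is written as a real power, whose
   measurability is at hand. *)
pose h y := f y * (y `^ (-1) * expR (d^-1 * y ^+ 2)).
have mh : measurable_fun setT h.
  apply: measurable_funM => //; apply: measurable_funM; first exact: measurable_powR.
  apply: continuous_measurable_fun => y.
  apply: (@continuous_comp _ _ _ (fun y : R => d^-1 * y ^+ 2) expR); last exact: continuous_expR.
  by apply: cvgMr; exact: exprn_continuous.
have f0 : f 0 = 0 by have := of_ 0; rewrite oppr0; lra.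
have wh x : w x * h `|x| = f x.
  have [->|x0] := eqVneq x 0; first by rewrite /w /gk !mul0r f0.
  have nx0 : 0 < `|x| by rewrite normr_gt0.
  rewrite /h powR_inv1 ?(ltW nx0)// /w /gk real_normK ?num_real//.
  rewrite (_ : _ * _ = x / `|x| * f `|x| * (expR (- (d^-1 * x ^+ 2)) * expR (d^-1 * x ^+ 2))); last by ring.
  rewrite -expRD addNr expR0 mulr1.
  have [xp|xn] := leP 0 x; first by rewrite ger0_norm// divff// mul1r.
  by rewrite ltr0_norm// of_; field; rewrite ?oppr_eq0 x0.
have absh x : `|w x| * `|h `|x| | = `|f x| by rewrite -[f x]wh -normrM.
pose hp y := Num.max (h y) 0; pose hn y := Num.max (- h y) 0.
have mhp : measurable_fun setT hp by exact: measurable_maxr.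
have mhn : measurable_fun setT hn by apply: measurable_maxr => //; exact: measurableT_comp.
have Lp : L2 (fun x => w x * hp `|x|).
  apply: (L2_le _ Lf).
    by apply: measurable_funM => //; exact: (measurableT_comp mhp).
  move=> x; rewrite normrM -absh ler_wpM2l// /hp.
  by case: (leP (h `|x|) 0) => hx; rewrite ?normr0.
have Ln : L2 (fun x => w x * hn `|x|).
  apply: (L2_le _ Lf).
    by apply: measurable_funM => //; exact: (measurableT_comp mhn).
  move=> x; rewrite normrM -absh ler_wpM2l// /hn.
  by case: (leP (- h `|x|) 0) => hx; rewrite ?normr0 ?normrN.
have hp0 y : 0 <= hp y by rewrite /hp le_max lexx orbT.
have hn0 y : 0 <= hn y by rewrite /hn le_max lexx orbT.
have := hk_span_sub (hk_span_w_ge0 mhp hp0 Lp) (hk_span_w_ge0 mhn hn0 Ln).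
congr (hk_span d _); apply/funext => x /=.
rewrite -mulrBr -[RHS]wh; congr (_ * _); rewrite /hp /hn.
by case: (leP (h `|x|) 0) => hx; case: (leP (- h `|x|) 0) => hx'; lra.
Qed.

End weighted.

End density.

(** * Existence *)

Section existence.
Context {R : realType}.
Local Notation mu := (@lebesgue_measure R).
Implicit Types (f g : R -> R) (t x : R) (l : seq (R * R)).

Lemma heat_sol_zero : heat_sol (fun=> 0 : R) (fun _ _ => 0 : R).
Proof.
split; [by move=> _; exact: L20|by move=> t x; rewrite oppr0| |].
- move=> t; rewrite (_ : (fun s => _) = (fun=> 0)); first exact: cvg_cst.
  apply/funext => s; rewrite (_ : _ \- _ = (fun=> 0)) ?nrm0//.
  by apply/funext => x /=; rewrite subrr.
- move=> phi s t _ _; rewrite !ip0l subrr.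
  under eq_Rintegral do rewrite mulr0 mul0r addr0.
  by rewrite Rintegral_cst// mul0r.
Qed.

Lemma bounded_control0 : bounded_control (fun=> 0 : R).
Proof. by split=> //; exists 0 => t; rewrite normr0. Qed.

Lemma bounded_control_lin c (u1 u2 : R -> R) : bounded_control u1 -> bounded_control u2 ->
  bounded_control (fun t => u1 t + c * u2 t).
Proof.
move=> [m1 [M1 b1]] [m2 [M2 b2]]; split.
  by apply: measurable_funD => //; exact: measurable_funM.
exists (M1 + `|c| * M2) => t; apply: le_trans (ler_normD _ _) _.
by rewrite lerD// normrM ler_wpM2l.
Qed.

Lemma heat_sol_kcomb l : positive_times l ->
  heat_sol (fun=> 0) (fun t => kcomb l (Num.max t 0)).
Proof.
elim: l => [_|p l IH /= /andP[p0 /IH sl]].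
  rewrite (_ : (fun t => _) = (fun _ _ => 0)); first exact: heat_sol_zero.
  by apply/funext => t; rewrite kcomb_nil.
have := heat_sol_lin p.1 bounded_control0 bounded_control0 sl (heat_sol_hk p0).
rewrite (_ : (fun t => 0 + p.1 * 0) = (fun=> 0)); last by apply/funext => t; rewrite mulr0 addr0.
congr heat_sol; apply/funext => t; rewrite kcomb_cons; apply/funext => x /=.
by rewrite addrC.
Qed.

(** A difference of combinations is again a combination, so contraction turns an initial Cauchy
    estimate into one uniform in time. *)
Lemma nrm_kcomb_sub l l' t : 0 <= t -> positive_times l -> positive_times l' ->
  nrm (kcomb l t \- kcomb l' t) <= nrm (kcomb l 0 \- kcomb l' 0).
Proof.
move=> t0 pl pl'.
have E s : kcomb l s \- kcomb l' s = kcomb (l ++ [seq (- p.1, p.2) | p <- l']) s.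
  apply/funext => x; rewrite /kcomb big_cat big_map/= -sumrN; congr (_ + _).
  by apply: eq_bigr => p _; rewrite -mulNr.
rewrite !E; apply: nrm_kcomb_contract => //.
rewrite /positive_times all_cat; apply/andP; split; first exact: pl.
by rewrite all_map.
Qed.

(** The real part of the upper limit is measurable and equals the limit wherever that exists. Its
    odd part has the same property, because convergence at x forces convergence at -x to the
    opposite value; it is odd even where the sequence diverges. *)
Lemma L2_complete_odd (F : nat -> R -> R) : (forall n, L2 (F n)) ->
  (forall n x, F n (- x) = - F n x) ->
  (forall n, nrm (F n.+1 \- F n) <= 4^-1 ^+ n) ->
  exists g, [/\ L2 g, forall x, g (- x) = - g x &
    exists C : R, forall n, nrm (F n \- g) <= C * 2^-1 ^+ n].
Proof.
move=> LF oF hF; have [C C0 hC] := L2_complete LF hF.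
pose G x : R := fine (limn_esup (fun n => (F n x)%:E)).
have mG : measurable_fun setT G.
  suff h : measurable_fun setT (fun x => limn_esup (fun n => (F n x)%:E)).
    exact: (measurableT_comp (@fine_measurable R setT measurableT) h).
  by apply: measurable_fun_limn_esup => n; apply/measurable_EFinP; exact: L2_measurable (LF n).
have GE x : cvgn (F ^~ x) -> G x = limn (F ^~ x).
  move=> cF; rewrite /G; suff -> : limn_esup (fun n => (F n x)%:E) = (limn (F ^~ x))%:E by [].
  rewrite is_cvg_limn_esupE.
    by apply/cvg_lim => //; apply/cvg_EFin; [exact: nearW|exact: cF].
  by apply/cvg_ex; exists (limn (F ^~ x))%:E; apply/cvg_EFin; [exact: nearW|exact: cF].
pose g x := (G x - G (- x)) / 2.
have mg : measurable_fun setT g.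
  apply: measurable_funM => //; apply: measurable_funB => //.
  exact: (measurableT_comp mG).
have [|Lg hg] := hC g mg.
  move=> x cF.
  have cFN : F n (- x) @[n --> \oo] --> - limn (F ^~ x).
    under eq_fun do rewrite oF.
    by apply: cvgN.
  rewrite /g (GE x cF) (GE (- x)); last by apply/cvg_ex; eexists; exact: cFN.
  by rewrite (cvg_lim _ cFN)//; field.
exists g; split=> //; last by exists C.
by move=> x; rewrite /g opprK; field.
Qed.

(** Density gives combinations within 4^-n/2 of [f]; by contraction their evolutions are Cauchy at
    the rate 4^-n, uniformly in time, and their limit is the free evolution. *)
Lemma heat_sol_initial f : L2 f -> (forall x, f (- x) = - f x) ->
  exists2 W, heat_sol (fun=> 0) W & W 0 = f.
Proof.
move=> Lf of_.
have [_ Vf] := hk_span_odd (@ltr01 R) Lf of_.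
have e0 n : 0 < 4^-1 ^+ n / 2 :> R by rewrite divr_gt0// exprn_gt0.
have /choice[l hl] : forall n, exists l, positive_times l /\ nrm (f \- kcomb l 0) < 4^-1 ^+ n / 2.
  move=> n; have [l [pl hl]] := Vf _ (e0 n); exists l; split=> //.
  exact: positive_times_lt pl.
have pl n : positive_times (l n) by have [] := hl n.
have LK n t : 0 <= t -> L2 (kcomb (l n) t) by move=> t0; exact: L2_kcomb.
have d0 n : nrm (kcomb (l n) 0 \- f) <= 4^-1 ^+ n / 2.
  by rewrite nrmC; have [_ /ltW] := hl n.
have dK n m t : (n <= m)%N -> 0 <= t -> nrm (kcomb (l n) t \- kcomb (l m) t) <= 4^-1 ^+ n.
  move=> nm t0; apply: le_trans (nrm_kcomb_sub t0 (pl n) (pl m)) _.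
  apply: le_trans (nrm_triangle (LK n 0 (lexx _)) Lf (LK m 0 (lexx _))) _.
  have : 4^-1 ^+ m <= 4^-1 ^+ n :> R by rewrite ler_wiXn2l// invf_le1// ler1n.
  have := d0 n; have [_ /ltW] := hl m; lra.
have max0 t : 0 <= Num.max t 0 by rewrite le_max lexx orbT.
have odd_kcomb k t x : kcomb k t (- x) = - kcomb k t x.
  by rewrite /kcomb -sumrN; apply: eq_bigr => p _; rewrite hk_odd mulrN.
have /choice[g hg] : forall t, exists g, [/\ L2 g, forall x, g (- x) = - g x &
    exists C : R, forall n, nrm (kcomb (l n) (Num.max t 0) \- g) <= C * 2^-1 ^+ n].
  move=> t; apply: L2_complete_odd.
  - by move=> n; exact: LK.
  - by move=> n x; exact: odd_kcomb.
  - by move=> n; rewrite nrmC; exact: dK.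
(* Setting [f] itself for t <= 0 makes the initial value exact; the limit [g 0] would agree with it
   only almost everywhere. *)
pose W t := if t <= 0 then f else g t.
exists W; last by rewrite /W lexx.
apply: (@heat_sol_limit _ _ (fun n t => kcomb (l n) (Num.max t 0)) _ (fun n => 4^-1 ^+ n)).
- exact: bounded_control0.
- by move=> n; exact: heat_sol_kcomb.
- by move=> t; rewrite /W; case: ifP => // _; have [] := hg t.
- by move=> t; rewrite /W; case: ifP => // _; have [] := hg t.
- move=> n t; rewrite /W; have [t0|t0] := leP t 0.
    apply: le_trans (d0 n) _.
    by rewrite ler_pdivrMr// ler_peMr ?exprn_ge0// ler1n.
  have [Lg _ [C hC]] := hg t; rewrite (max_idPl (ltW t0)) in hC.
  have t0' := ltW t0.
  (* The constant [C] depends on the time. Passing through a later stage m and letting m tend to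
     infinity removes it and leaves the uniform bound 4^-n. *)
  have lim : 4^-1 ^+ n + C * 2^-1 ^+ m @[m --> \oo] --> (4^-1 ^+ n : R).
    rewrite -[X in _ --> X]addr0; apply: cvgD; first exact: cvg_cst.
    rewrite -[X in _ --> X](mulr0 C); apply: cvgMr; apply: cvg_expr.
    by rewrite ger0_norm// invf_lt1// ltr1n.
  apply: (cvgr_to_ge lim); exists n => // m /= nm.
  apply: le_trans (nrm_triangle (LK n _ t0') (LK m _ t0') Lg) _.
  by rewrite lerD// dK.
- by apply: cvg_expr; rewrite ger0_norm// invf_lt1// ltr1n.
Qed.

(** * Duality between solutions and kernels *)

Lemma hk2_continuous_time t : 0 < t -> nrm (hk2 s \- hk2 t) @[s --> t] --> (0 : R).
Proof.
move=> t0.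
have [C hC] := @hk2_decay R (t / 2) (2 * t) (divr_gt0 t0 (ltr0Sn R 1)).
have pos s : t / 2 < s < 2 * t -> 0 < s by lra.
apply: (@decay_cvg_nrm _ (@hk2 R) (t / 2) (2 * t) C).
- lra.
- by move=> s /pos s0; apply: continuous_measurable_fun; exact: continuous_hk2.
- by move=> s /andP[? ?]; apply: hC; rewrite !ltW.
- move=> s x /pos s0; apply: differentiable_continuous; apply/derivable1_diffP.
  have s0' : s != 0 by rewrite gt_eqF.
  have ds := is_derive1_sqrt s0.
  have st0 : Num.sqrt s != 0 by rewrite gt_eqF// sqrtr_gt0.
  have ts0 : s * Num.sqrt s != 0 by rewrite mulf_neq0.
  have t4 : 4 * s != 0 by rewrite mulf_neq0.
  have t2 : 2 * s != 0 by rewrite mulf_neq0.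
  have t42 : 4 * s ^+ 2 != 0 by rewrite mulf_neq0// expf_neq0.
  by rewrite /hk2 /gau /hs; apply: ex_derive.
Qed.

Lemma ltr_dist_between (a b m d x : R) : a <= x <= b -> `|a - m| < d -> `|b - m| < d ->
  `|x - m| < d.
Proof.
by move=> /andP[ax xb]; rewrite !ltr_norml => /andP[? ?] /andP[? ?]; apply/andP; split; lra.
Qed.

Lemma le_norm_Rintegral_itv f (a b M : R) : a <= b -> mu.-integrable `]a, b[ (EFin \o f) ->
  (forall x, a < x < b -> `|f x| <= M) ->
  `|\int[mu]_(x in `]a, b[) f x| <= M * (b - a).
Proof.
move=> ab intf fM; apply: le_trans (le_normr_Rintegral _ intf) _ => //.
rewrite -Rintegral_cst_itv//.
apply: le_Rintegral => //; [exact: integrable_norm|exact: cst_integrable_itv].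
Qed.

(** Joint continuity of the inner product in quantitative form, the two pairs being close to a
    common center (f0, g0). *)
Lemma ip_variation f f' f0 g g' g0 eta :
  L2 f -> L2 f' -> L2 f0 -> L2 g -> L2 g' -> L2 g0 -> eta <= 1 ->
  nrm (f \- f0) < eta -> nrm (f' \- f0) < eta ->
  nrm (g \- g0) < eta -> nrm (g' \- g0) < eta ->
  `|ip f g - ip f' g'| <= 2 * eta * (nrm f0 + nrm g0 + 2).
Proof.
move=> Lf Lf' Lf0 Lg Lg' Lg0 eta1 hf hf' hg hg'.
rewrite (_ : _ - _ = ip (f \- f') g + ip f' (g \- g')); last first.
  by rewrite ipBl// ipBr// addrA subrK.
apply: le_trans (ler_normD _ _) _.
have A1 := nrm_triangle Lf Lf0 Lf'; rewrite [nrm (f0 \- _)]nrmC in A1.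
have A2 := nrm_triangle Lg Lg0 Lg'; rewrite [nrm (g0 \- _)]nrmC in A2.
have B1 := nrmD (L2B Lg Lg0) Lg0.
rewrite (_ : (_ \- _) \+ _ = g) in B1; last by apply/funext => z /=; rewrite subrK.
have B2 := nrmD (L2B Lf' Lf0) Lf0.
rewrite (_ : (_ \- _) \+ _ = f') in B2; last by apply/funext => z /=; rewrite subrK.
have C1 := CS (L2B Lf Lf') Lg; have C2 := CS Lf' (L2B Lg Lg').
have D1 : nrm (f \- f') * nrm g <= (2 * eta) * (nrm g0 + 1).
  apply: ler_pM; rewrite ?nrm_ge0//.
    by apply: le_trans A1 _; rewrite mulr_natl mulr2n lerD// ltW.
  by apply: le_trans B1 _; rewrite addrC lerD2l (le_trans _ eta1)// ltW.
have D2 : nrm f' * nrm (g \- g') <= (nrm f0 + 1) * (2 * eta).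
  apply: ler_pM; rewrite ?nrm_ge0//.
    by apply: le_trans B2 _; rewrite addrC lerD2l (le_trans _ eta1)// ltW.
  by apply: le_trans A2 _; rewrite mulr_natl mulr2n lerD// ltW.
apply: le_trans (lerD (le_trans C1 D1) (le_trans C2 D2)) _.
by rewrite le_eqVlt; apply/orP; left; apply/eqP; ring.
Qed.

(* Along s + tau = c, s |-> <D s, hk tau> is constant: d/ds D = D_xx and
   d/dtau hk tau = (hk tau)_xx. *)
Lemma homogeneous_ip_hk (D : R -> R -> R) (T tau : R) : 0 < T -> 0 < tau ->
  (forall t, 0 <= t <= T -> L2 (D t)) ->
  (forall t e : R, 0 <= t <= T -> 0 < e -> exists2 d, 0 < d &
     forall s, 0 <= s <= T -> `|s - t| < d -> nrm (D s \- D t) < e) ->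
  (forall phi : H2 R, AC_derivative 0 T (fun t => ip (D t) (H2_val phi))
     (fun t => ip (D t) (H2_d2 phi))) ->
  ip (D T) (hk tau) = ip (D 0) (hk (T + tau)).
Proof.
move=> T0 tau0 LD cD weak.
pose c := T + tau.
pose h s := ip (D s) (hk (c - s)).
suff : h 0 = h T by rewrite /h /c subr0 addrAC subrr add0r => ->.
apply: flat_eq; first exact: ltW.
move=> s e sT e0.
have cs0 : 0 < c - s by rewrite /c; case/andP: sT; lra.
(* The closeness for which the bound of [ip_variation] around (D s, hk2 (c - s)) is at most [e]. *)
have [eta [eta0 eta1 etae]] : exists eta : R, [/\ 0 < eta, eta <= 1 &
    2 * eta * (nrm (D s) + nrm (hk2 (c - s)) + 2) <= e].
  have den0 : 0 < 2 * (nrm (D s) + nrm (hk2 (c - s)) + 2).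
    by rewrite mulr_gt0// ltr_wpDl// addr_ge0// nrm_ge0.
  exists (Num.min 1 (e / (2 * (nrm (D s) + nrm (hk2 (c - s)) + 2)))); split.
  - by rewrite lt_min ltr01 divr_gt0.
  - by rewrite ge_min lexx.
  - by rewrite mulrAC mulrC -ler_pdivlMr// ge_min lexx orbT.
have [d1 d10 hd1] := cD s eta sT eta0.
have /cvgrPdist_lt/(_ _ eta0)[d2 /= d20 hd2] := hk2_continuous_time cs0.
exists (Num.min d1 (Num.min d2 (c - s))); first by rewrite !lt_min d10 d20.
move=> x y x0 xy yT; rewrite !lt_min => /and3P[xd1 xd2 xcs] /and3P[yd1 yd2 ycs].
move: xy; rewrite le_eqVlt => /predU1P[->|xy].
  by rewrite !subrr normr0 mulr0.
have xT : 0 <= x <= T by rewrite x0 (le_trans (ltW xy)).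
have y0T : 0 <= y <= T by rewrite yT (le_trans x0 (ltW xy)).
have cy0 : 0 < c - y by rewrite /c; lra.
have [int_d2 weakE] := weak (hkH2 cy0).
have LDx := LD x xT; have LDy := LD y y0T; have LDs := LD s sT.
(* The increment of [h] is taken in two moves. Here the state moves and the kernel is frozen at c -
   y, so the weak equation applies with a fixed test function. *)
have first : ip (D y) (hk (c - y)) - ip (D x) (hk (c - y)) =
    \int[mu]_(r in `]x, y[) ip (D r) (hk2 (c - y)) := weakE x y x0 xy yT.
have cycx : c - y < c - x by rewrite ltrD2l ltrN2.
(* The second move: the state is frozen at [x] and the kernel ages. To first order the two
   contributions cancel, both being close to (y - x) times the product of D s and hk2 (c - s), with
   opposite signs. *)
have [||sig] := @MVT R (fun r => ip (hk r) (D x)) (fun r => ip (hk2 r) (D x)) _ _ cycx.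
- move=> r; rewrite in_itv/= => /andP[r1 _]; apply: hk_ip_derive => //.
  exact: lt_trans r1.
- apply: derivable_within_continuous => r; rewrite in_itv/= => /andP[r1 _].
  by have [] := @hk_ip_derive R r (D x) (lt_le_trans cy0 r1) LDx.
rewrite in_itv/= => /andP[sig1 sig2] second.
have sig0 : 0 < sig by exact: lt_trans sig1.
have near_hk2 r : `|r - (c - s)| < d2 -> nrm (hk2 r \- hk2 (c - s)) < eta.
  move=> hr; have := hd2 r; rewrite /= distrC => /(_ hr).
  by rewrite sub0r normrN ger0_norm ?nrm_ge0.
have h1 : nrm (hk2 (c - y) \- hk2 (c - s)) < eta.
  by apply: near_hk2; rewrite (_ : _ - _ = s - y) 1?distrC//; ring.
have h2 : nrm (hk2 sig \- hk2 (c - s)) < eta.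
  apply: near_hk2; apply: (@ltr_dist_between (c - y) (c - x)); first by rewrite !ltW.
    by rewrite (_ : _ - _ = s - y) 1?distrC//; ring.
  by rewrite (_ : _ - _ = s - x) 1?distrC//; ring.
have Lcy := L2_hk2 cy0; have Lsig := L2_hk2 sig0; have Lcs := L2_hk2 cs0.
have -> : h y - h x = \int[mu]_(r in `]x, y[) (ip (D r) (hk2 (c - y)) - ip (D x) (hk2 sig)).
  have ir : mu.-integrable `]x, y[ (EFin \o (fun r => ip (D r) (hk2 (c - y)))).
    by apply: integrableS int_d2 => //; apply: subset_itvW.
  rewrite RintegralB; [|by []|exact: ir|exact: cst_integrable_itv].
  rewrite -first Rintegral_cst_itv ?(ltW xy)//.
  rewrite (_ : y - x = (c - x) - (c - y)) ?[ip (D x) (hk2 sig)]ipC; last by rewrite opprB [RHS]addrC subrKA.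
  by rewrite -second /h /= ![ip (hk _) _]ipC opprB addrA subrK.
have int2 : mu.-integrable `]x, y[ (EFin \o (fun r => ip (D r) (hk2 (c - y)) - ip (D x) (hk2 sig))).
  apply: integrableB_EFin; [by []| |exact: cst_integrable_itv].
  by apply: integrableS int_d2 => //; apply: subset_itvW.
refine (le_norm_Rintegral_itv (ltW xy) int2 _).
move=> r /andP[xr ry].
have rT : 0 <= r <= T by rewrite (le_trans x0 (ltW xr)) (le_trans (ltW ry)).
have LDr := LD r rT.
have hx : nrm (D x \- D s) < eta by exact: hd1.
have hr : nrm (D r \- D s) < eta.
  by apply: hd1 => //; apply: (@ltr_dist_between x y); rewrite // !ltW.
apply: le_trans (ip_variation LDr LDx LDs Lcy Lsig Lcs eta1 hr hx h1 h2) _.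
exact: etae.
Qed.

Lemma nrm_eq0_ae f : L2 f -> nrm f = 0 -> ae_eq_fun f (fun=> 0).
Proof.
move=> Lf f0; have := normL2E Lf; rewrite f0 /normL2 => N0.
have mf := L2_measurable Lf.
have mfE : measurable_fun setT (EFin \o f) by exact/measurable_EFinP.
have [] := @Lnorm_eq0_eq0 _ _ R mu (EFin \o f) 2%:E mfE _ N0 => //.
move=> A [mA A0 hA]; exists A; split=> // x /= fx; apply: hA => /= e.
by apply: fx; case: (e I).
Qed.

End existence.

(** * Uniqueness *)

Section uniqueness.
Context {R : realType}.
Local Notation mu := (@lebesgue_measure R).
Implicit Types (f g : R -> R) (t x : R).

#[local] Instance lebesgue_ae_filter : Filter (almost_everywhere mu).
Proof. exact: ae_filter_ringOfSetsType. Qed.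

Lemma nrm_ae0 f : measurable_fun setT f -> ae_eq_fun f (fun=> 0) -> nrm f = 0.
Proof.
move=> mf f0; rewrite /nrm /ip /Rintegral (@ae_eq_integral _ _ R mu setT (cst 0%E))//.
- by rewrite integral_cst// mul0e sqrtr0.
- by apply/measurable_EFinP; exact: measurable_funM.
- by apply: filterS f0 => x /= -> _; rewrite mul0r.
Qed.

Lemma ae_eq_fun_sub0 f g : ae_eq_fun f g -> ae_eq_fun (f \- g) (fun=> 0).
Proof. by apply: filterS => x /= ->; rewrite subrr. Qed.

Lemma ae_eq_fun_sym f g : ae_eq_fun f g -> ae_eq_fun g f.
Proof. by apply: filterS. Qed.

Lemma nrm_sub_ae f g : L2 f -> L2 g -> ae_eq_fun f g -> nrm (f \- g) = 0.
Proof.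
by move=> Lf Lg fg; apply: nrm_ae0 (ae_eq_fun_sub0 fg); exact: L2_measurable (L2B Lf Lg).
Qed.

Lemma ip_ae f f' g : L2 f -> L2 f' -> L2 g -> ae_eq_fun f f' -> ip f g = ip f' g.
Proof.
move=> Lf Lf' Lg ff'; apply/eqP; rewrite -subr_eq0 -ipBl// -normr_le0.
by apply: le_trans (CS (L2B Lf Lf') Lg) _; rewrite nrm_sub_ae// mul0r.
Qed.

Lemma L2_ae f f' : L2 f -> measurable_fun setT f' -> ae_eq_fun f f' -> L2 f'.
Proof.
move=> /L2P[mf /integrableP[_ fi]] mf' ff'; apply/L2P; split=> //.
have m2 (h : R -> R) : measurable_fun setT h -> measurable_fun setT (EFin \o (fun x : R => h x ^+ 2 : R)).
  by move=> mh; apply/measurable_EFinP; exact: measurable_funX.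
apply/integrableP; split; first exact: m2.
rewrite (@ae_eq_integral _ _ R mu setT (abse \o (EFin \o (fun x => f x ^+ 2))))//.
- by apply: measurableT_comp => //; exact: m2.
- by apply: measurableT_comp => //; exact: m2.
- by apply: filterS ff' => x /= -> _.
Qed.

(** The constructions require oddness at every point, whereas states are odd only almost everywhere;
    taking the odd part changes [f] on a null set only. *)
Lemma odd_representative f : Htilde0 f ->
  exists f', [/\ L2 f', forall x, f' (- x) = - f' x & ae_eq_fun f f'].
Proof.
move=> [Lf of_]; have mf := L2_measurable Lf.
exists (fun x => (f x - f (- x)) / 2).
have aef : ae_eq_fun f (fun x => (f x - f (- x)) / 2).
  by apply: filterS of_ => x /= ->; field.
split=> //; last by move=> x; rewrite opprK; field.
apply: (L2_ae Lf) => //; apply: measurable_funM => //; apply: measurable_funB => //.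
exact: (measurableT_comp mf).
Qed.

Lemma Htilde0B f g : Htilde0 f -> Htilde0 g -> Htilde0 (f \- g).
Proof.
move=> [Lf of_] [Lg og]; split; first exact: L2B.
by apply: filterS2 of_ og => x /= -> ->; rewrite opprB opprK addrC.
Qed.

(** If the norm were positive, some combination k of kernels would be closer to f' than that norm;
    then <f', f'> = <f', f' - k> contradicts the Cauchy-Schwarz inequality. *)
Lemma odd_orthogonal_hk f : Htilde0 f -> (forall tau, 0 < tau -> ip f (hk tau) = 0) ->
  ae_eq_fun f (fun=> 0).
Proof.
move=> Hf f_hk; have [f' [Lf' of' ff']] := odd_representative Hf; have [Lf _] := Hf.
have f'_hk tau : 0 < tau -> ip f' (hk tau) = 0.
  by move=> tau0; rewrite -(ip_ae Lf)//; [exact: f_hk|exact: L2_hk].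
have f'_kcomb l : positive_times l -> ip f' (kcomb l 0) = 0.
  elim: l => [|p l IH /= /andP[p0 pl]]; first by rewrite kcomb_nil ipC ip0l.
  rewrite kcomb_cons addr0 ipDr//; [|by apply: L2Z; exact: L2_hk|exact: L2_kcomb].
  by rewrite ipZr// ?f'_hk// ?IH// ?mulr0 ?addr0//; exact: L2_hk.
suff f'0 : nrm f' = 0.
  by have := nrm_eq0_ae Lf' f'0; apply: filterS2 ff' => x -> ->.
apply/eqP; rewrite eq_le nrm_ge0 andbT leNgt; apply/negP => f'0.
have [_ Vf'] := hk_span_odd (@ltr01 R) Lf' of'.
have [l [/positive_times_lt pl hl]] := Vf' _ f'0.
have Lk := L2_kcomb (lexx 0) pl.
have := CS Lf' (L2B Lf' Lk); rewrite ipBr// f'_kcomb// subr0.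
rewrite leNgt => /negP; apply; rewrite -sqr_nrm ger0_norm ?sqr_ge0// expr2.
by rewrite ltr_pM2l.
Qed.

Lemma continuous_L2_dist T (W : R -> R -> R) : continuous_L2 T W ->
  (forall t, 0 <= t <= T -> L2 (W t)) ->
  forall t e : R, 0 <= t <= T -> 0 < e -> exists2 d, 0 < d &
    forall s, 0 <= s <= T -> `|s - t| < d -> nrm (W s \- W t) < e.
Proof.
move=> cW LW t e tT e0.
have /cW : `[0, T]%classic t by rewrite /= in_itv.
move=> /fine_cvgP[_ /cvgrPdist_lt/(_ _ e0)].
rewrite near_withinE => /nbhs_ballP[d /= d0 hd]; exists d => // s sT st.
have ts : ball t d s by rewrite /ball/= distrC.
have := hd s ts; rewrite /= in_itv/= => /(_ sT).
rewrite sub0r normrN normL2E; last by apply: L2B; exact: LW.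
by rewrite /= ger0_norm ?nrm_ge0.
Qed.

(** In the difference of two solutions the control terms cancel. Duality on [0, t] moves the pairing
    with each kernel back to time 0, where the difference vanishes almost everywhere. *)
Lemma solution_unique T (W0 u : R -> R) (W1 W2 : R -> R -> R) :
  is_solution T W0 u W1 -> is_solution T W0 u W2 ->
  forall t, 0 <= t <= T -> ae_eq_fun (W1 t) (W2 t).
Proof.
move=> [H1 c1 e1 i1] [H2' c2 e2 i2].
have {}H1 t : 0 <= t <= T -> Htilde0 (W1 t) by move=> tT; apply: H1; rewrite /= in_itv.
have {}H2' t : 0 <= t <= T -> Htilde0 (W2 t) by move=> tT; apply: H2'; rewrite /= in_itv.
have L1 t : 0 <= t <= T -> L2 (W1 t) by move=> /H1[].
have L2' t : 0 <= t <= T -> L2 (W2 t) by move=> /H2'[].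
pose D t := W1 t \- W2 t.
have LD t : 0 <= t <= T -> L2 (D t) by move=> tT; apply: L2B; [exact: L1|exact: L2'].
have D0 : ae_eq_fun (D 0) (fun=> 0).
  by apply: ae_eq_fun_sub0; apply: filterS2 i1 i2 => x -> ->.
have cD : forall t e : R, 0 <= t <= T -> 0 < e -> exists2 d, 0 < d &
    forall s, 0 <= s <= T -> `|s - t| < d -> nrm (D s \- D t) < e.
  move=> t e tT e0; have e20 : 0 < e / 2 by rewrite divr_gt0.
  have [d1 d10 h1] := continuous_L2_dist c1 L1 tT e20.
  have [d2 d20 h2] := continuous_L2_dist c2 L2' tT e20.
  exists (Num.min d1 d2); first by rewrite lt_min d10.
  move=> s sT; rewrite lt_min => /andP[/(h1 s sT) a1 /(h2 s sT) a2].
  rewrite (_ : D s \- D t = (W1 s \- W1 t) \- (W2 s \- W2 t)); last first.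
    by apply/funext => x; rewrite /D/=; ring.
  apply: le_lt_trans (nrmB (L2B (L1 s sT) (L1 t tT)) (L2B (L2' s sT) (L2' t tT))) _.
  by rewrite [e]splitr ltrD.
move=> t /andP[t0 tT].
suff Dt0 : ae_eq_fun (D t) (fun=> 0).
  by apply: filterS Dt0 => x /= /eqP; rewrite subr_eq0 => /eqP.
move: t0; rewrite le_eqVlt => /predU1P[<-//|t0].
have tT' : 0 <= t <= T by rewrite ltW.
have sub s : 0 <= s <= t -> 0 <= s <= T by move=> /andP[-> st]; exact: le_trans tT.
apply: odd_orthogonal_hk; first by apply: Htilde0B; [exact: H1|exact: H2'].
move=> tau tau0; rewrite (@homogeneous_ip_hk _ D t tau)//.
- have z0 : 0 <= (0 : R) <= T by rewrite lexx (le_trans (ltW t0)).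
  by rewrite (ip_ae (LD 0 z0) (@L20 R)) ?ip0l//; apply: L2_hk; rewrite addr_gt0.
- by move=> s /sub; exact: LD.
- move=> s e /sub sT e0; have [d d0 hd] := cD s e sT e0.
  by exists d => // r /sub; exact: hd.
move=> phi; have [j1 w1] := e1 phi; have [j2 w2] := e2 phi.
have P0 := H2_val_L2 phi; have P2 := H2_d2_L2 phi.
have E s : 0 <= s <= T -> ip (D s) (H2_d2 phi) =
    (dxx (W1 s) phi - 2 * u s * delta' phi) - (dxx (W2 s) phi - 2 * u s * delta' phi).
  move=> sT; rewrite /D ipBl//; [|exact: L1|exact: L2'].
  by rewrite opprB addrA subrK.
have subi a b : 0 <= a -> b <= T -> `]a, b[%classic `<=` `]0, T[%classic.
  by move=> a0 bT; exact: subset_itvW.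
have EI a b s : 0 <= a -> b <= T -> s \in `]a, b[%classic -> 0 <= s <= T.
  by move=> a0 bT; rewrite inE/= in_itv/= => /andP[as_ sb]; rewrite (le_trans a0 (ltW as_)) (le_trans (ltW sb)).
have j12 := integrableB_EFin (measurable_itv `]0, T[) j1 j2.
split.
  have j : mu.-integrable `]0, t[ (EFin \o (fun s => (dxx (W1 s) phi - 2 * u s * delta' phi) -
      (dxx (W2 s) phi - 2 * u s * delta' phi))).
    by apply: integrableS j12 => //; exact: subi.
  apply: eq_integrable j => //.
  by move=> s sI; rewrite /= E//; exact: (EI 0 t).
move=> s r s0 sr rt; have rT := le_trans rt tT.
have sT : 0 <= s <= T by rewrite s0 (le_trans (ltW sr)).
have rT' : 0 <= r <= T by rewrite rT (le_trans s0 (ltW sr)).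
transitivity (\int[mu]_(x in `]s, r[) ((dxx (W1 x) phi - 2 * u x * delta' phi) -
    (dxx (W2 x) phi - 2 * u x * delta' phi))).
  rewrite RintegralB; [|by []| |]; last 2 first.
  - by apply: integrableS j1 => //; exact: subi.
  - by apply: integrableS j2 => //; exact: subi.
  rewrite -w1// -w2// /D !ipBl//; [|exact: L1|exact: L2'|exact: L1|exact: L2'].
  have swap (a b c d : R) : a - b - (c - d) = a - c - (b - d) by ring.
  exact: swap.
by apply: eq_Rintegral => x xI; rewrite E//; exact: EI xI.
Qed.

End uniqueness.

(** * Approximate controllability *)

Section controllability.
Context {R : realType}.
Local Notation mu := (@lebesgue_measure R).
Implicit Types (f g : R -> R) (t x : R) (l : seq (R * R)).

Lemma L2_continuous_continuous_L2 T (W : R -> R -> R) : L2_continuous W ->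
  (forall t, L2 (W t)) -> continuous_L2 T W.
Proof.
move=> cW LW t _; rewrite (_ : (fun s => _) = EFin \o (fun s => nrm (W s \- W t))).
  apply: cvg_EFin; first exact: nearW.
  exact: cvg_within_filter (cW t).
by apply/funext => s; rewrite normL2E//; exact: L2B.
Qed.

Lemma Linfty_bounded_control T (u : R -> R) : bounded_control u -> Linfty T u.
Proof.
move=> [mu' [M uM]]; rewrite /Linfty/=; apply/andP; split; rewrite inE/=.
  by apply/(measurable_restrictT _ _).1 => //; exact: measurable_funTS.
rewrite /finite_norm unlock /Lnorm; case: ifP => // _.
apply: (@le_lt_trans _ _ (Num.max M 0)%:E); last exact: ltry.
apply/ess_supP; apply: aeW => x /=; rewrite lee_fin /patch.
by case: ifP => _; rewrite ?normr0 le_max ?lexx ?orbT// uM.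
Qed.

Lemma heat_sol_Htilde0 u (W : R -> R -> R) t : heat_sol u W -> Htilde0 (W t).
Proof. by move=> [LW oW _ _]; split=> //; apply: aeW => x; exact: oW. Qed.

Lemma heat_sol_is_solution T (W0 u : R -> R) (W : R -> R -> R) : bounded_control u ->
  heat_sol u W -> ae_eq_fun (W 0) W0 -> is_solution T W0 u W.
Proof.
move=> bu sW W00; have [LW oW cW eW] := sW; split=> //.
- by move=> t _; exact: heat_sol_Htilde0 sW.
- exact: L2_continuous_continuous_L2.
move=> phi.
have E t : dxx (W t) phi - 2 * u t * delta' phi = ip (W t) (H2_d2 phi) + 2 * u t * H2_d1 phi 0.
  by rewrite /delta' mulrN opprK.
split.
  have [i1 i2] := heat_sol_rhs_integrable phi 0 T bu sW.
  have := integrableD_EFin (measurable_itv _) i1 i2.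
  by apply: eq_integrable => // t _; rewrite /= E.
move=> s t s0 st _; rewrite eW//.
by apply: eq_Rintegral => r _; rewrite E.
Qed.

(** Here the second entry of a pair is the instant at which a constant control is switched on, not
    an age as in [kcomb]. *)
Definition Ecomb l t x : R := \sum_(p <- l) p.1 * hE (t - p.2) x.
Definition step_comb l t : R := \sum_(p <- l) p.1 * step p.2 t.

Lemma Ecomb_cons p l t : Ecomb (p :: l) t = (fun x => p.1 * hE (t - p.2) x) \+ Ecomb l t.
Proof. by apply/funext => x; rewrite /Ecomb big_cons. Qed.

Lemma Ecomb_nil t : Ecomb [::] t = (fun=> 0).
Proof. by apply/funext => x; rewrite /Ecomb big_nil. Qed.

Lemma L2_Ecomb l t : L2 (Ecomb l t).
Proof.
elim: l => [|p l IH]; first by rewrite Ecomb_nil; exact: L20.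
by rewrite Ecomb_cons; apply: L2D => //; apply: L2Z; exact: L2_hE.
Qed.

(** No control has acted yet at time 0, so adding such a combination leaves the initial state
    unchanged. *)
Lemma Ecomb0 l : all (fun p => 0 <= p.2) l -> Ecomb l 0 = (fun=> 0).
Proof.
elim: l => [|p l IH /= /andP[p0 /IH E]]; first by rewrite Ecomb_nil.
rewrite Ecomb_cons E; apply/funext => x /=.
by rewrite /hE sub0r oppr_gt0 ltNge p0/= mulr0 addr0.
Qed.

Lemma bounded_step_comb l : bounded_control (step_comb l).
Proof.
elim: l => [|p l IH].
  rewrite (_ : step_comb _ = (fun=> 0)); first exact: bounded_control0.
  by apply/funext => t; rewrite /step_comb big_nil.
have := bounded_control_lin p.1 IH (bounded_step p.2); congr bounded_control.
by apply/funext => t; rewrite /step_comb big_cons addrC.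
Qed.

Lemma heat_sol_Ecomb S l : heat_sol (fun=> 0) S ->
  heat_sol (step_comb l) (fun t => S t \+ Ecomb l t).
Proof.
move=> sS; elim: l => [|p l IH].
  congr heat_sol : sS; [apply/funext => t|apply/funext => t; apply/funext => x].
    by rewrite /step_comb big_nil.
  by rewrite /= Ecomb_nil addr0.
have := heat_sol_lin p.1 (bounded_step_comb l) (bounded_step p.2) IH (heat_sol_hE p.2).
congr heat_sol; apply/funext => t; first by rewrite /step_comb big_cons addrC.
by apply/funext => x; rewrite Ecomb_cons /= -addrA [X in _ + X]addrC.
Qed.

(* [hk tau] is the time derivative of [hE], hence a limit of difference quotients. *)
Lemma hk_near_Ecomb (tau T e : R) : 0 < tau < T -> 0 < e ->
  exists l, all (fun p => 0 <= p.2) l /\ nrm (hk tau \- Ecomb l T) < e.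
Proof.
move=> /andP[tau0 tauT] e0.
(* Increments that tend to 0 while tau + h stays at most T, so that no control is switched on before
   time 0. *)
pose h (n : nat) : R := (T - tau) / n.+1%:R.
have h0 n : 0 < h n by rewrite divr_gt0// subr_gt0.
have hT n : tau + h n <= T.
  rewrite -lerBrDl /h ler_pdivrMr// ler_peMr ?ler1n//.
  by rewrite subr_ge0 ltW.
pose q n x := (h n)^-1 * (hE (tau + h n) x - hE tau x).
have [C hC] := @hk_decay R tau T tau0.
have mhE t : measurable_fun setT (@hE R t) by exact: measurable_hE.
(* By the mean value theorem the quotient is a kernel of some age between tau and T, and the uniform
   decay on that range dominates it. *)
have bound n x : `|q n x| <= C * (1 + x ^+ 2)^-1.
  have tauh : tau < tau + h n by rewrite ltrDl.
  have [||c] := @MVT R (hE ^~ x) (hk ^~ x) _ _ tauh.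
  - move=> r; rewrite in_itv/= => /andP[r1 _]; apply: hE_derive_time.
    exact: lt_trans r1.
  - by apply: continuous_subspaceT => r; exact: hE_continuous_time.
  rewrite in_itv/= => /andP[c1 c2]; rewrite /q => ->.
  rewrite [tau + h n]addrC addrK mulrC mulfK ?gt_eqF//.
  apply: decay_oneDsqrV; apply: hC.
  by rewrite (ltW c1)/= (le_trans (ltW c2)).
have lim x : q n x @[n --> \oo] --> hk tau x.
  have [dE E] := hE_derive_time x tau0.
  have := dE; rewrite /derivable => /cvg_ex[/= v hv].
  have Ev : v = hk tau x by rewrite -E; apply/esym/cvg_lim.
  rewrite -Ev.
  have hn : h n @[n --> \oo] --> (0 : R).
    rewrite -[X in _ --> X](mulr0 (T - tau)); apply: cvgMr.
    exact: cvg_harmonic.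
  have := (cvgr_dnbhsP _ _ _).1 hv h (conj (fun n => lt0r_neq0 (h0 n)) hn).
  apply: cvg_trans; apply: near_eq_cvg; apply: nearW => n /=.
  by rewrite /q /GRing.scale/= mulr1 [h n + tau]addrC.
have G0 x : C * (1 + x ^+ 2)^-1 <= `|C * (1 + x ^+ 2)^-1| by exact: ler_norm.
have /cvgrPdist_lt/(_ _ e0)[n _ hn] : nrm (hk tau \- q n) @[n --> \oo] --> (0 : R).
  apply: (L2_dominated_cvg (L2_oneDsqrV C)) => //.
  - by move=> n; apply: measurable_funM => //; apply: measurable_funB.
  - by apply: continuous_measurable_fun; exact: continuous_hk.
  - by move=> n x; apply: le_trans (G0 x); exact: bound.
  - move=> x; apply: le_trans (G0 x); apply: decay_oneDsqrV; apply: hC.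
    by rewrite lexx ltW.
(* The two steps form a pulse of height 1/h and length h ending at T - tau; at time T its response
   is the difference quotient. *)
exists [:: ((h n)^-1, T - (tau + h n)); (- (h n)^-1, T - tau)]; split.
  by rewrite /= !subr_ge0 hT (ltW tauT).
have := hn n (leqnn n); rewrite sub0r normrN ger0_norm ?nrm_ge0//.
congr (nrm _ < _); apply/funext => x /=; congr (_ - _).
by rewrite /Ecomb /q !big_cons big_nil addr0 !subKr mulrBr mulNr.
Qed.

Lemma Ecomb_cat l l' t : Ecomb (l ++ l') t = Ecomb l t \+ Ecomb l' t.
Proof. by apply/funext => x; rewrite /Ecomb big_cat. Qed.

Lemma Ecomb_scale c l t :
  Ecomb [seq (c * p.1, p.2) | p <- l] t = (fun x => c * Ecomb l t x).
Proof.
apply/funext => x; rewrite /Ecomb big_map mulr_sumr.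
by apply: eq_bigr => p _; rewrite mulrA.
Qed.

Lemma kcomb_near_Ecomb (T : R) l : all (fun p => 0 < p.2 < T) l -> forall e, 0 < e ->
  exists l', all (fun p => 0 <= p.2) l' /\ nrm (kcomb l 0 \- Ecomb l' T) < e.
Proof.
elim: l => [_ e e0|p l IH /= /andP[pT lT] e e0].
  exists [::]; split=> //; rewrite kcomb_nil Ecomb_nil.
  by rewrite (_ : _ \- _ = (fun=> 0)) ?nrm0//; apply/funext => x /=; rewrite subrr.
have e20 : 0 < e / 2 by rewrite divr_gt0.
have p10 : 0 < `|p.1| + 1 by rewrite ltr_wpDl.
have [l1 [l10 hl1]] := IH lT _ e20.
(* The tolerance is divided by |p.1| + 1 rather than |p.1|, which may be 0. *)
have [l2 [l20 hl2]] := hk_near_Ecomb pT (divr_gt0 e20 p10).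
exists ([seq (p.1 * r.1, r.2) | r <- l2] ++ l1); split.
  by rewrite all_cat l10 all_map andbT.
have Lk := L2_kcomb (lexx 0) (positive_times_lt lT).
have Lh : L2 (@hk R p.2) by apply: L2_hk; case/andP: pT.
rewrite kcomb_cons addr0 Ecomb_cat Ecomb_scale.
rewrite (_ : _ \- _ = (fun x => p.1 * (hk p.2 \- Ecomb l2 T) x) \+ (kcomb l 0 \- Ecomb l1 T)); last first.
  by apply/funext => x /=; ring.
have LB := L2B Lh (L2_Ecomb l2 T).
apply: le_lt_trans (nrmD (L2Z p.1 LB) (L2B Lk (L2_Ecomb l1 T))) _.
rewrite nrmZ// [e]splitr ltr_leD//; last exact: ltW.
apply: le_lt_trans (_ : (`|p.1| + 1) * nrm (hk p.2 \- Ecomb l2 T) < _).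
  by rewrite ler_wpM2r ?nrm_ge0// lerDl.
by rewrite mulrC -ltr_pdivlMr.
Qed.

Lemma odd_near_Ecomb (T : R) f : 0 < T -> L2 f -> (forall x, f (- x) = - f x) ->
  forall e, 0 < e -> exists l, all (fun p => 0 <= p.2) l /\ nrm (f \- Ecomb l T) < e.
Proof.
move=> T0 Lf of_ e e0; have e20 : 0 < e / 2 by rewrite divr_gt0.
have [_ Vf] := hk_span_odd T0 Lf of_; have [l [lT hl]] := Vf _ e20.
have [l' [l'0 hl']] := kcomb_near_Ecomb lT e20.
exists l'; split=> //.
have Lk := L2_kcomb (lexx 0) (positive_times_lt lT).
apply: le_lt_trans (nrm_triangle Lf Lk (L2_Ecomb l' T)) _.
by rewrite [e]splitr ltrD.
Qed.

End controllability.

Theorem theorem7p2 (R : realType) (T : R) (hT : 0 < T) (W0 WT : R -> R)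
    (hW0 : Htilde0 W0) (hWT : Htilde0 WT) :
  approx_controllable T W0 WT.
Proof.
split=> // e e0.
have [f0 [Lf0 of0 W0f0]] := odd_representative hW0.
have [fT [LfT ofT WTfT]] := odd_representative hWT.
have [S sS S0] := heat_sol_initial Lf0 of0.
have [LS oS _ _] := sS.
(* By linearity it suffices to reach, from zero, the target minus the free evolution of the initial
   state at time T; this difference is again odd. *)
have [||l [l0 hl]] := @odd_near_Ecomb R T (fT \- S T) hT _ _ e e0.
- exact: L2B.
- by move=> x /=; rewrite ofT oS opprD.
pose W t := S t \+ Ecomb l t.
have sW : heat_sol (step_comb l) W by exact: heat_sol_Ecomb.
have HW t : Htilde0 (W t) by exact: heat_sol_Htilde0 sW.
have W00 : ae_eq_fun (W 0) W0.
  have -> : W 0 = f0 by rewrite /W Ecomb0// S0; apply/funext => x /=; rewrite addr0.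
  exact: ae_eq_fun_sym.
have solW := heat_sol_is_solution T (bounded_step_comb l) sW W00.
exists (W T).
  split=> //; exists (step_comb l); split.
    by apply: Linfty_bounded_control; exact: bounded_step_comb.
  exists W; split; last exact: aeW.
  split=> // W' solW' t; rewrite /= in_itv/= => tT.
  exact: solution_unique solW' solW t tT.
have [LWT _] := HW T; have [LT _] := hWT.
rewrite normL2E; last exact: L2B.
rewrite lte_fin; apply: le_lt_trans (nrm_triangle LWT LfT LT) _.
rewrite [X in _ + X]nrmC (nrm_sub_ae LT LfT WTfT) addr0 nrmC.
congr (nrm _ < e) : hl; apply/funext => x; rewrite /W/=; ring.
Qed.
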